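(* Let $G'$ be a natural unit interval graph on $[n']$ and let $\varphi'$ be a nice involution for $G'$. Let $a\ge 2$, $\epsilon\in\{0,1\}$, and $G=K_a^\epsilon+G'$. Then there is a nice involution $\varphi$ for $G$ whose set of fixed points is exactly the set of simple forest triples $\mathcal F=((T_t,\alpha^{(t)},r_t))_{t=1}^m$ of $G$ such that: $\mathcal F$ is an atom; $\mathcal F|_{\ge a}$ is fixed by $\varphi'$; $\mathrm{seg}_{[a]}(\mathcal F)\le 2$; and, letting $(T_i,\alpha^{(i)},r_i)$ be the tree triple with $a\in V(T_i)$, if $1\notin V(T_i)$ then $r_i\ge a-\epsilon$, and if $1\in V(T_i)$ then $|V(T_i)|\ge a$.
   Context: Natural unit interval graph: $G=([n],E)$ with, for $1\le i<j<k\le n$, $\{i,k\}\in E$ implying $\{i,j\},\{j,k\}\in E$. $K_a^0$ is the complete graph on $[a]$ and $K_a^1$ is the complete graph on $[a]$ with the edge $\{1,a\}$ removed. The sum of graphs $G_1=([n_1],E_1)$, $G_2=([n_2],E_2)$ is $G_1+G_2=([n_1+n_2-1],E_1\cup\{\{i+n_1-1,j+n_1-1\}:\{i,j\}\in E_2\})$ (vertex $n_1$ of $G_1$ glued to vertex $1$ of $G_2$). For a natural unit interval graph $G$: a decreasing subtree is a subgraph $T$ which is a tree (nonempty vertex set) in which every vertex other than the largest has exactly one larger neighbour in $T$; $\mathrm{list}(T)$ is the permutation of $V(T)$ read by starting at the smallest vertex of $T$ and repeatedly reading the smallest unread vertex of $T$ adjacent in $T$ to an already read vertex. A tree triple is $(T,\alpha,r)$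 with $T$ a decreasing subtree, $\alpha$ a composition of $|V(T)|$, $1\le r\le\alpha_1$. A forest triple is a sequence $\mathcal F=((T_t,\alpha^{(t)},r_t))_{t=1}^m$ of tree triples with the $V(T_t)$ partitioning the vertex set and $\min V(T_1)<\dots<\min V(T_m)$; $\mathrm{type}$ = sorted concatenation of the $\alpha^{(t)}$; $\mathrm{sign}=(-1)^{\sum_t(\ell(\alpha^{(t)})-1)}$; $\mathrm{weight}=\mathrm{inv}_G(\mathrm{list}(T_1)\cdots\mathrm{list}(T_m))+\sum_t(r_t-1)$, where $\mathrm{inv}_G(\sigma)=|\{(i,j):i<j,\sigma_i>\sigma_j,\{\sigma_j,\sigma_i\}\in E\}|$. $\alpha^{(1)}_1(\mathcal F)$ is the first part of $\alpha^{(1)}$. $\mathcal F$ is simple if $r_1=1$, an atom if every $\alpha^{(t)}$ has one part. A nice involution for $G$ is a map $\varphi$ on simple forest triples of $G$ with $\varphi\circ\varphi=\mathrm{id}$, preserving type, weight and $\alpha^{(1)}_1$, all of whose fixed points are atoms, and with $\mathrm{sign}(\varphi(\mathcal F))=-\mathrm{sign}(\mathcal F)$ whenever $\varphi(\mathcal F)\neq\mathcal F$. Restriction: let $G=G_1+G_2$ with $G_1$ on $[n_1]$, and let $\mathcal F=((T_t,\alpha^{(t)},r_t))_{t=1}^m$ be a simple forest triple of $G$. Let $i$ be such that $n_1\in V(T_i)$, $\sigma=\mathrm{list}(T_i)$, $k=|V(T_i)\cap[n_1]|$, and $\mathrm{seg}_{[n_1]}(T_i)=j$ the index with $\alpha^{(i)}_1+\dots+\alpha^{(i)}_{j-1}<k\le\alpha^{(i)}_1+\dots+\alpha^{(i)}_j$.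 Let $i'\ge i$ be maximal with $V(T_{i'})\cap[n_1]\ne\emptyset$. Define $\mathrm{seg}_{[n_1]}(\mathcal F)=\mathrm{seg}_{[n_1]}(T_i)+\sum_{1\le t\le i',t\ne i}\ell(\alpha^{(t)})$. Define the tree triple $\mathcal T_i|_{\ge n_1}=(n_1\,\sigma_{k+1}\cdots\sigma_{|V(T_i)|},\ (\alpha^{(i)}_1+\dots+\alpha^{(i)}_j-k+1)\,\alpha^{(i)}_{j+1}\cdots\alpha^{(i)}_{\ell},\ 1)$ (the first entries of $\sigma$ are exactly the $k$ vertices $\le n_1$), and the simple forest triple of $G_2$: $\mathcal F|_{\ge n_1}=(\mathcal T_i|_{\ge n_1}-(n_1-1),\ \mathcal T_{i'+1}-(n_1-1),\dots,\mathcal T_m-(n_1-1))$, where $\mathcal T-x$ subtracts $x$ from every vertex label of the tree (equivalently of its list). In the claim this is applied with $G_1=K_a^\epsilon$, $n_1=a$, $G_2=G'$. *)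

(* Defs.v *)
From mathcomp Require Import all_boot all_order all_algebra finmap.

Set Implicit Arguments.
Unset Strict Implicit.
Unset Printing Implicit Defensive.

Local Open Scope fset_scope.
Local Open Scope nat_scope.

(* The set [n] = {1, ..., n}; vertices keep their 1-based labels. *)
Definition ivl (n : nat) : {fset nat} := [fset v in iota 1 n].

(* A pair (V, E); an edge {i, j} with i < j is stored as the pair (i, j). *)
Definition graph := ({fset nat} * {fset nat * nat})%type.
Definition vert (G : graph) : {fset nat} := G.1.
Definition edge (G : graph) : {fset nat * nat} := G.2.
Definition nvert (G : graph) : nat := #|` vert G|.

Definition adj (G : graph) : rel nat :=
  fun i j => ((i, j) \in edge G) || ((j, i) \in edge G).

Definition wf_graph (G : graph) : Prop :=
  forall i j, (i, j) \in edge G -> [/\ i < j, i \in vert G & j \in vert G].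

Definition subgraph (T G : graph) : Prop :=
  [/\ wf_graph T, vert T `<=` vert G & edge T `<=` edge G].

Definition natural_unit_interval (n : nat) (G : graph) : Prop :=
  [/\ vert G = ivl n, wf_graph G &
      forall i j k, 1 <= i -> i < j -> j < k -> k <= n ->
        adj G i k -> adj G i j /\ adj G j k].

(* K_a^0 (eps = false) and K_a^1 (eps = true). *)
Definition Kgraph (a : nat) (eps : bool) : graph :=
  (ivl a,
   [fset e : nat * nat in [seq (i, j) | i <- iota 1 a, j <- iota 1 a] |
     (e.1 < e.2) && ~~ (eps && (e == (1, a)))]).

Definition gsum (G1 G2 : graph) : graph :=
  let s := (nvert G1).-1 in
  (ivl (nvert G1 + nvert G2).-1,
   edge G1 `|` [fset (e.1 + s, e.2 + s) | e in edge G2]).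

Definition connected (T : graph) : Prop :=
  forall u v, u \in vert T -> v \in vert T ->
    exists p, path (adj T) u p /\ last u p = v.

(* [ucycle] also holds of the degenerate closed walks with at most two
   vertices, which are not cycles of a simple graph. *)
Definition acyclic (T : graph) : Prop :=
  forall c, ucycle (adj T) c -> size c <= 2.

Definition is_tree (T : graph) : Prop :=
  [/\ vert T != fset0, connected T & acyclic T].

Definition decreasing_subtree (G T : graph) : Prop :=
  [/\ subgraph T G, is_tree T &
      forall v w, v \in vert T -> w \in vert T -> v < w ->
        exists! u, v < u /\ adj T v u].

Definition sorted_vert (T : graph) : seq nat := sort leq (vert T).

Definition vmin (T : graph) : nat := head 0 (sorted_vert T).

(* The unread vertices adjacent to an already read one, smallest first. *)
Definition frontier (T : graph) (rd : seq nat) : seq nat :=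
  [seq v <- sorted_vert T | (v \notin rd) && has (adj T v) rd].

Fixpoint read_from (T : graph) (k : nat) (rd : seq nat) : seq nat :=
  if k is k'.+1 then
    if frontier T rd is v :: _ then read_from T k' (rcons rd v) else rd
  else rd.

Definition list_of (T : graph) : seq nat :=
  if vert T == fset0 then [::] else read_from T (nvert T).-1 [:: vmin T].

Definition ttriple := (graph * seq nat * nat)%type.
Definition tree (x : ttriple) : graph := x.1.1.
Definition parts (x : ttriple) : seq nat := x.1.2.
Definition rval (x : ttriple) : nat := x.2.

Definition composition_of (n : nat) (al : seq nat) : bool :=
  all (leq 1) al && (sumn al == n).

Definition tree_triple (G : graph) (x : ttriple) : Prop :=
  [/\ decreasing_subtree G (tree x),
      composition_of (nvert (tree x)) (parts x) &
      1 <= rval x <= head 0 (parts x)].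

Definition forest := seq ttriple.

Definition forest_triple (G : graph) (F : forest) : Prop :=
  [/\ forall x, x \in F -> tree_triple G x,
      vert G = \bigcup_(x <- F) vert (tree x),
      pairwise (fun x y => [disjoint vert (tree x) & vert (tree y)]) F &
      sorted ltn [seq vmin (tree x) | x <- F]].

Definition simple_forest_triple (G : graph) (F : forest) : Prop :=
  forest_triple G F /\ head 0 [seq rval x | x <- F] = 1.

Definition atom (F : forest) : bool := all (fun x => size (parts x) == 1) F.

Definition ftype (F : forest) : seq nat :=
  sort geq (flatten [seq parts x | x <- F]).

Definition fsign (F : forest) : int :=
  ((-1) ^+ (\sum_(x <- F) (size (parts x)).-1)%N)%R.

Definition inv_graph (G : graph) (s : seq nat) : nat :=
  #|[set p : 'I_(size s) * 'I_(size s) |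
      [&& p.1 < p.2, nth 0 s p.1 > nth 0 s p.2 &
          adj G (nth 0 s p.2) (nth 0 s p.1)]]|.

Definition weight (G : graph) (F : forest) : nat :=
  inv_graph G (flatten [seq list_of (tree x) | x <- F]) +
  \sum_(x <- F) (rval x).-1.

Definition alpha11 (F : forest) : nat :=
  head 0 (head [::] [seq parts x | x <- F]).

(* Only the values of phi on the simple forest triples of G matter. *)
Definition nice_involution (G : graph) (phi : forest -> forest) : Prop :=
  forall F, simple_forest_triple G F ->
    [/\ simple_forest_triple G (phi F), phi (phi F) = F,
        [/\ ftype (phi F) = ftype F, weight G (phi F) = weight G F &
            alpha11 (phi F) = alpha11 F],
        phi F = F -> atom F &
        phi F <> F -> fsign (phi F) = (- fsign F)%R].

Definition ttriple0 : ttriple := ((fset0, fset0), [::], 0).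

(* Positions in a forest are counted from 0 here and below. *)
Definition tree_index (v : nat) (F : forest) : nat :=
  find (fun x => v \in vert (tree x)) F.

Definition triple_at (v : nat) (F : forest) : ttriple :=
  nth ttriple0 F (tree_index v F).

Definition last_index (n1 : nat) (F : forest) : nat :=
  \max_(t < size F | (tree_index n1 F <= t) &&
          (vert (tree (nth ttriple0 F t)) `&` ivl n1 != fset0)) t.

Definition cut_size (n1 : nat) (T : graph) : nat := #|` vert T `&` ivl n1|.

(* The (1-based) j with al_1 + ... + al_(j-1) < k <= al_1 + ... + al_j. *)
Definition seg_tree (n1 : nat) (x : ttriple) : nat :=
  let k := cut_size n1 (tree x) in
  head 0 [seq j <- iota 1 (size (parts x)) |
           sumn (take j.-1 (parts x)) < k <= sumn (take j (parts x))].

Definition seg (n1 : nat) (F : forest) : nat :=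
  seg_tree n1 (triple_at n1 F) +
  \sum_(t < size F | (t <= last_index n1 F) && (t != tree_index n1 F :> nat))
     size (parts (nth ttriple0 F t)).

(* A decreasing subtree is determined by its list, and restrictions are
   specified through lists: a tree triple (T, al, r) becomes (list(T), al, r). *)
Definition ltriple := (seq nat * seq nat * nat)%type.

Definition to_list (x : ttriple) : ltriple :=
  (list_of (tree x), parts x, rval x).

Definition lshift_by (d : nat) (x : ltriple) : ltriple :=
  ([seq v - d | v <- x.1.1], x.1.2, x.2).

Definition restr_tree (n1 : nat) (x : ttriple) : ltriple :=
  let k := cut_size n1 (tree x) in
  let j := seg_tree n1 x in
  (n1 :: drop k (list_of (tree x)),
   (sumn (take j (parts x)) - k + 1) :: drop j (parts x),
   1).

Definition restr_list (n1 : nat) (F : forest) : seq ltriple :=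
  [seq lshift_by n1.-1 x |
    x <- restr_tree n1 (triple_at n1 F)
         :: [seq to_list x | x <- drop (last_index n1 F).+1 F]].

(* F' is the simple forest triple F|_{>= n1} of G2. *)
Definition is_restriction (n1 : nat) (G2 : graph) (F F' : forest) : Prop :=
  simple_forest_triple G2 F' /\ [seq to_list x | x <- F'] = restr_list n1 F.

(* Main.v *)
Require Import Defs.
From mathcomp Require Import all_boot all_order all_algebra finmap mpoly.
From mathcomp Require Import zify ring.

Set Implicit Arguments.
Unset Strict Implicit.
Unset Printing Implicit Defensive.

Local Open Scope fset_scope.
Local Open Scope nat_scope.

(* A decreasing subtree T is recovered from list(T): the neighbour of a letter
   among the letters read before it is the nearest larger one, or the largest one
   if the letter is a record. Forest triples thus become sequences of words, and
   cutting at the cut vertex a identifies the simple forest triples of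
   K_a^eps + G' with pairs (L, F'), where F' is a simple forest triple of G' and
   L is a forest on [a] with one part enlarged by b - 1, b being the first part of
   F'. Sign, weight and type are multiplicative along this bijection.

   An involution with a prescribed fixed-point set S of atoms exists as soon as,
   for each value of (type, weight, alpha), the signed number of simple forest
   triples is the number of those in S. By means of phi' the F' may be taken fixed,
   so it remains to compare, for each b, the signed generating function of all L
   with that of the L allowed by the theorem. Let [n] be the q-integer and C(m) the
   signed sum of e_p over the compositions p of m weighted by a function f of the
   first part. Since f(m) e_m = sum_s C(s) e_(m-s), removing the first tree gives
   the closed form
     [a-2]! sum_(0 <= i < a) e_i e_j (([a-1] - [i]) f(j) + ([j] - [a-1]) f(i)),
   where j = a - 1 + b - i, for eps = 0, and a similar one for eps = 1. The allowed
   L account for the terms with i < b, and the others cancel under i <-> j. *)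

(** * Decreasing subtrees as words *)

(** The involution is not built explicitly: inside each class of equal (type, weight, first part),
    negative forests are matched with the positive ones outside S, so only an equality of counts is
    needed. It is read off from integer polynomials whose monomials determine the class. The
    function f stays arbitrary because it is used twice. For a tree other than the first, summing
    q^(r-1) over 1 <= r <= alpha_1 gives f(m) = [m]; for the first tree, where r = 1 and alpha_1
    must be preserved, f(m) is a formal variable. Restricting to fixed F' works because the sum over
    L depends on F' only through b, which phi' preserves. The bounds of the theorem come from the
    last sum. If the first tree contains a and l letters besides 1 on [a], and i = a - 1 - l, then a
    part l + b of size at least a means i < b. If it misses a, summing q^(r-1) over a - eps <= r <=
    c gives [c] - [a-1-eps]. The missing edge {1, a} only forbids words that begin with 1 a. *)

Definition seqmax (p : seq nat) : nat := foldr maxn 0 p.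

Lemma seqmax_ge p x : x \in p -> x <= seqmax p.
Proof.
elim: p => //= y p IHp; rewrite inE => /predU1P[->|/IHp]; first exact: leq_maxl.
by move/leq_trans; apply; apply: leq_maxr.
Qed.

Lemma seqmax_mem p : p != [::] -> seqmax p \in p.
Proof.
elim: p => //= y [|z p] IHp _; first by rewrite maxn0 inE.
rewrite /maxn; case: ifP => _; first by rewrite inE IHp ?orbT.
by rewrite inE eqxx.
Qed.

Lemma seqmax_cat p s : seqmax (p ++ s) = maxn (seqmax p) (seqmax s).
Proof. by elim: p => [|x p IHp] /=; rewrite ?max0n // IHp maxnA. Qed.

(* The neighbour of [v] among the letters [p] preceding it in list(T): the
   nearest larger letter, or the largest letter if [v] is a record. *)
Definition par (p : seq nat) (v : nat) : nat :=
  last (seqmax p) [seq x <- p | v < x].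

Fixpoint wrec (G : graph) (p s : seq nat) : bool :=
  if s is v :: s' then
    [&& v \notin p, adj G v (par p v) & wrec G (rcons p v) s']
  else true.

(** By [wtree_decreasing], [list_of_wtree] and [list_of_tree] these are exactly the words list(T) of
    the decreasing subtrees T of G. The first letter is the smallest because reading starts
    there. *)
Definition wvalid (G : graph) (w : seq nat) : bool :=
  if w is m :: s then [&& m \in vert G, all (ltn m) s & wrec G [:: m] s]
  else false.

Fixpoint wedges (p s : seq nat) : seq (nat * nat) :=
  if s is v :: s' then
    (minn v (par p v), maxn v (par p v)) :: wedges (rcons p v) s'
  else [::].

Definition wtree (w : seq nat) : graph :=
  ([fset x in w], [fset e in wedges (take 1 w) (behead w)]).

Lemma par_mem p v : p != [::] -> par p v \in p.
Proof.
move=> p0; rewrite /par; case Es: [seq x <- p | v < x] => [|y s].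
  exact: seqmax_mem.
have: last (seqmax p) (y :: s) \in [seq x <- p | v < x] by rewrite Es /= mem_last.
by rewrite mem_filter => /andP[].
Qed.

Lemma par_gt p v x : x \in p -> v < x -> v < par p v.
Proof.
move=> xp vx; rewrite /par; have: x \in [seq x <- p | v < x].
  by rewrite mem_filter vx.
case Es: [seq x <- p | v < x] => [//|y s] _.
have: last (seqmax p) (y :: s) \in [seq x <- p | v < x] by rewrite Es /= mem_last.
by rewrite mem_filter => /andP[].
Qed.

Lemma par_max p v : ~~ has (ltn v) p -> par p v = seqmax p.
Proof.
by move=> h; rewrite /par (@eq_in_filter _ _ pred0) ?filter_pred0 // => x xp;
   apply/negP => vx; case/negP: h; apply/hasP; exists x.
Qed.

Lemma par_nearest p x s v : v < x -> all (fun z => z < v) s ->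
  par (p ++ x :: s) v = x.
Proof.
move=> vx sv; rewrite /par filter_cat /= vx last_cat /=.
rewrite (@eq_in_filter _ _ pred0 s) ?filter_pred0 // => z /(allP sv) zv.
by apply/negbTE; rewrite -leqNgt ltnW.
Qed.

Lemma wrec_cat G p s1 s2 : wrec G p (s1 ++ s2) = wrec G p s1 && wrec G (p ++ s1) s2.
Proof.
elim: s1 p => [|v s1 IHs] p /=; first by rewrite cats0.
by rewrite IHs cat_rcons !andbA.
Qed.

Lemma wedges_cat p s1 s2 : wedges p (s1 ++ s2) = wedges p s1 ++ wedges (p ++ s1) s2.
Proof.
elim: s1 p => [|v s1 IHs] p /=; first by rewrite cats0.
by rewrite IHs cat_rcons.
Qed.

Lemma wrec_uniq G p s : uniq p -> wrec G p s -> uniq (p ++ s).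
Proof.
elim: s p => [|v s IHs] p /= up; first by rewrite cats0.
case/and3P=> vp _ /IHs; rewrite cat_rcons; apply; by rewrite rcons_uniq vp.
Qed.

Lemma wvalid_uniq G w : wvalid G w -> uniq w.
Proof. by case: w => // m s /and3P[_ _ /wrec_uniq]; apply. Qed.

Lemma adj_sym G x y : adj G x y = adj G y x.
Proof. by rewrite /adj orbC. Qed.

Lemma wvalid_sub G w : wf_graph G -> wvalid G w -> {subset w <= vert G}.
Proof.
move=> wfG; case: w => // m s /and3P[mG _ ws] x; rewrite inE => /predU1P[->//|xs].
case/splitPr: xs ws => s1 s2; rewrite wrec_cat /= => /and4P[_ _ + _].
by rewrite /adj => /orP[] /wfG[].
Qed.

Lemma adj_wtreeE m s x y : adj (wtree (m :: s)) x y =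
  ((x, y) \in wedges [:: m] s) || ((y, x) \in wedges [:: m] s).
Proof. by rewrite /adj /edge /= take0 !inE. Qed.

Lemma adj_wtree_nil m x y : adj (wtree [:: m]) x y = false.
Proof. by rewrite adj_wtreeE. Qed.

Lemma adj_wtree_rcons m s v x y :
  adj (wtree (m :: rcons s v)) x y =
    [|| adj (wtree (m :: s)) x y,
        (x == v) && (y == par (m :: s) v) | (x == par (m :: s) v) && (y == v)].
Proof.
rewrite !adj_wtreeE -!cats1 wedges_cat /= !mem_cat !inE !xpair_eqE.
set p := par _ _; case: (leqP v p) => vp;
  rewrite ?(minn_idPl vp) ?(maxn_idPr vp) ?(minn_idPr (ltnW vp)) ?(maxn_idPl (ltnW vp));
  by case: (_ \in _); case: (_ \in _); case: (x == v); case: (y == p);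
     case: (x == p); case: (y == v).
Qed.

Lemma adj_wtree_mem m s x y : uniq (m :: s) -> adj (wtree (m :: s)) x y ->
  [/\ x \in m :: s, y \in m :: s & x != y].
Proof.
elim/last_ind: s => [|s v IHs]; first by rewrite adj_wtree_nil.
rewrite -rcons_cons rcons_uniq => /andP[vs us]; rewrite adj_wtree_rcons.
have ps: par (m :: s) v \in m :: s by exact: par_mem.
have vps: v != par (m :: s) v by apply: contraNneq vs => {1}->.
case/or3P=> [/(IHs us)[xs ys xy]|/andP[/eqP-> /eqP->]|/andP[/eqP-> /eqP->]].
- by rewrite !mem_rcons !inE in xs ys *; rewrite xs ys !orbT.
- by split=> //; rewrite rcons_cons -rcons_cons mem_rcons inE ?eqxx ?ps ?orbT.
by split=> //; rewrite 1?eq_sym // rcons_cons -rcons_cons mem_rcons inE ?eqxx ?ps ?orbT.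
Qed.

(** Appending v creates a larger neighbour only for v itself or for the current maximum: a record v
    is attached to that maximum, which had no larger neighbour yet, and any other v is attached to a
    letter above it. *)
Lemma wtree_larger (m : nat) (s : seq nat) (x z : nat) : uniq (m :: s) ->
    x \in m :: s -> z \in m :: s -> x < z ->
  exists! u, x < u /\ adj (wtree (m :: s)) x u.
Proof.
elim/last_ind: s x z => [|s v IHs] x z.
  by move=> _; rewrite !inE => /eqP-> /eqP->; rewrite ltnn.
rewrite -rcons_cons rcons_uniq => /andP[vs us].
have ps: par (m :: s) v \in m :: s by exact: par_mem.
have vps: v != par (m :: s) v by apply: contraNneq vs => {1}->.
have adjv y : adj (wtree (m :: s)) v y = false.
  by apply/negP=> /(adj_wtree_mem us)[]; rewrite (negbTE vs).
have adjv' y : adj (wtree (m :: s)) y v = false by rewrite adj_sym.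
rewrite !mem_rcons !(in_cons v); case: (eqVneq x v) => [->|xv] /= xs zs xz.
  have {zs} zs: z \in m :: s by case/predU1P: zs xz => // ->; rewrite ltnn.
  exists (par (m :: s) v); split.
    by split; [exact: par_gt zs xz | rewrite adj_wtree_rcons eqxx eqxx orbT].
  move=> u [vu]; rewrite adj_wtree_rcons adjv eqxx /= (negbTE vps) orbF.
  by move/eqP.
case: (boolP (has (ltn x) (m :: s))) => [/hasP[z' z's xz']|nx].
  have [u [[xu au] uu]] := IHs x z' us xs z's xz'.
  exists u; split; first by rewrite adj_wtree_rcons au.
  move=> u' [xu']; rewrite adj_wtree_rcons (negbTE xv) /=.
  case/orP=> [au'|/andP[/eqP xp /eqP u'v]]; first exact: uu.
  exfalso; move: xu'; rewrite u'v xp.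
  case: (boolP (has (ltn v) (m :: s))) => [/hasP[y ys vy]|/par_max].
    by rewrite ltnNge ltnW ?(par_gt ys).
  by move=> e; have := seqmax_ge z's; rewrite -e -xp leqNgt; case/negP.
have zv : z = v.
  by case/predU1P: zs => // zs; case/negP: nx; apply/hasP; exists z.
have xmax : x = seqmax (m :: s).
  apply/eqP; rewrite eqn_leq seqmax_ge //= leqNgt; apply/negP=> lt.
  by case/negP: nx; apply/hasP; exists (seqmax (m :: s)) => //; exact: seqmax_mem.
have pv : par (m :: s) v = x.
  rewrite xmax; apply: par_max; apply/negP=> /hasP[y ys /= vy].

  by have := leq_trans vy (seqmax_ge ys); rewrite -xmax -zv ltnNge ltnW.
exists v; split.

 by rewrite adj_wtree_rcons pv !eqxx !orbT -{1}zv.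
move=> u [xu]; rewrite adj_wtree_rcons (negbTE xv) pv eqxx /=.
case/orP=> [au|/eqP->//]; have [_ us' _] := adj_wtree_mem us au.
by case/negP: nx; apply/hasP; exists u.
Qed.

Definition linked (T : graph) (u v : nat) : Prop :=
  exists p, path (adj T) u p /\ last u p = v.

Lemma linked_refl T u : linked T u u.
Proof. by exists [::]. Qed.

Lemma linked_step T u v : adj T u v -> linked T u v.
Proof. by move=> uv; exists [:: v]; rewrite /= uv. Qed.

Lemma linked_trans T u v w : linked T u v -> linked T v w -> linked T u w.
Proof.
case=> p [pp lp] [q [pq lq]]; exists (p ++ q).
by rewrite cat_path last_cat pp lp pq lq.
Qed.

Lemma linked_sym T u v : linked T u v -> linked T v u.
Proof.
case=> p []; elim: p u => [|x p IHp] u /=; first by move=> _ ->; exact: linked_refl.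
case/andP=> ux px lp; apply: linked_trans (IHp x px lp) _.
by apply: linked_step; rewrite adj_sym.
Qed.

Lemma linked_sub T T' u v : (forall x y, adj T x y -> adj T' x y) ->
  linked T u v -> linked T' u v.
Proof. by move=> sub [p [pp lp]]; exists p; split=> //; apply: sub_path pp. Qed.

(** The smallest vertex of a cycle of length at least 3 would have two larger neighbours, its
    successor and its predecessor on the cycle. *)
Lemma decreasing_acyclic T : wf_graph T ->
  (forall v w, v \in vert T -> w \in vert T -> v < w ->
     exists! u, v < u /\ adj T v u) -> acyclic T.
Proof.
move=> wfT dec c /andP[cc uc]; rewrite leqNgt; apply/negP=> c3.
have adjT x y : adj T x y -> [/\ x \in vert T, y \in vert T & x != y].
  by case/orP=> /wfT[xy xT yT]; split; rewrite ?neq_ltn ?xy ?orbT.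
have [v vc vmin] : exists2 v, v \in c & forall y, y \in c -> v <= y.
  exists (head 0 (sort leq c)).
    rewrite -(mem_sort leq).
    by case: (sort leq c) (size_sort leq c) c3 => [<-|x t] //=; rewrite inE eqxx.
  move=> y; rewrite -(mem_sort leq).
  have := sort_sorted leq_total c; case: (sort leq c) => //= x t xt.
  rewrite inE => /predU1P[->//|yt].
  by have /allP/(_ y yt) := order_path_min leq_trans xt.
have [i c' ec] := rot_to vc.
have cyc : cycle (adj T) (v :: c') by rewrite -ec rot_cycle.
have ucv : uniq (v :: c') by rewrite -ec rot_uniq.
have sc : 2 <= size c' by rewrite -ltnS -[(size c').+1]/(size (v :: c')) -ec size_rot.
have memc y : y \in c' -> y \in c by move=> yc; rewrite -(mem_rot i) ec inE yc orbT.
case: c' => [//|y c'] in ec cyc ucv sc memc *.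
case/lastP: c' => [//|c' z] in ec cyc ucv sc memc *.
move: cyc; rewrite /= rcons_path => /andP[vy /andP[_]]; rewrite last_rcons => zv.
have [vT yT vny] := adjT _ _ vy; have [zT _ znv] := adjT _ _ zv.
have vlty : v < y by rewrite ltn_neqAle vny vmin // memc // inE eqxx.
have vltz : v < z by rewrite ltn_neqAle eq_sym znv vmin // memc // inE mem_rcons inE eqxx orbT.
have [u [_ uu]] := dec v y vT yT vlty.
have yz : y = z.
  by rewrite -(uu y (conj vlty vy)); apply: uu; rewrite adj_sym zv vltz.
by move: ucv; rewrite /= yz mem_rcons inE eqxx /= andbF.
Qed.

Lemma wedges_le p s e : e \in wedges p s -> e.1 <= e.2.
Proof.
elim: s p => //= v s IHs p; rewrite inE => /predU1P[->|/IHs//] /=.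
by rewrite geq_min !leq_max !leqnn ?orbT.
Qed.

Lemma mem_vert_wtree w x : (x \in vert (wtree w)) = (x \in w).
Proof. by rewrite /vert /= !inE. Qed.

Lemma nvert_wtree w : uniq w -> nvert (wtree w) = size w.
Proof. by move=> uw; rewrite /nvert /vert /= card_fseq undup_id. Qed.

Lemma mem_edge_wtree m s e :
  (e \in edge (wtree (m :: s))) = (e \in wedges [:: m] s).
Proof. by rewrite /edge /= take0 !inE. Qed.

Lemma wtree_wf m s : uniq (m :: s) -> wf_graph (wtree (m :: s)).
Proof.
move=> us i j; rewrite mem_edge_wtree => e.
have [] := @adj_wtree_mem m s i j us; first by rewrite adj_wtreeE e.
move=> im jm inj; rewrite !mem_vert_wtree im jm; split=> //.
by rewrite ltn_neqAle inj (wedges_le e).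
Qed.

Lemma adj_wtree_sub G m s x y : wrec G [:: m] s ->
  adj (wtree (m :: s)) x y -> adj G x y.
Proof.
elim/last_ind: s x y => [|s v IHs] x y; first by rewrite adj_wtree_nil.
rewrite -cats1 wrec_cat /= cats1 => /andP[ws /andP[_ /andP[av _]]].
rewrite adj_wtree_rcons => /or3P[/(IHs _ _ ws)//||] /andP[/eqP-> /eqP->] //.
by rewrite adj_sym.
Qed.

Lemma edge_adj G i j : wf_graph G -> (i, j) \in edge G <-> i < j /\ adj G i j.
Proof.
move=> wfG; split=> [e|[ij /orP[//|/wfG[ji _ _]]]].
  by have [ij _ _] := wfG _ _ e; rewrite /adj e.
by move: ij; rewrite ltnNge ltnW.
Qed.

Lemma wtree_connected m s : uniq (m :: s) -> connected (wtree (m :: s)).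
Proof.
move=> us; have root x : x \in m :: s -> linked (wtree (m :: s)) x m.
  elim/last_ind: s us x => [|s v IHs] us x.
    by rewrite inE => /eqP->; exact: linked_refl.
  have us' : uniq (m :: s).
    by move: us; rewrite -rcons_cons rcons_uniq => /andP[].
  have sub y z : adj (wtree (m :: s)) y z -> adj (wtree (m :: rcons s v)) y z.
    by rewrite adj_wtree_rcons => ->.
  rewrite -rcons_cons mem_rcons inE => /predU1P[->|xs]; last first.
    exact: linked_sub sub (IHs us' x xs).
  apply: linked_trans (linked_sub sub (IHs us' _ (@par_mem (m :: s) v isT))).
  by apply: linked_step; rewrite adj_wtree_rcons !eqxx orbT.
move=> u v; rewrite !mem_vert_wtree => um vm.
exact: linked_trans (root u um) (linked_sym (root v vm)).
Qed.

Lemma wtree_decreasing G w : wf_graph G -> wvalid G w ->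
  decreasing_subtree G (wtree w).
Proof.
move=> wfG vw; have uw := wvalid_uniq vw; have sub := wvalid_sub wfG vw.
case: w => // m s in vw uw sub *; case/and3P: vw => mG ms ws.
have dec v w : v \in vert (wtree (m :: s)) -> w \in vert (wtree (m :: s)) ->
    v < w -> exists! u, v < u /\ adj (wtree (m :: s)) v u.
  by rewrite !mem_vert_wtree; apply: wtree_larger.
have wfw := wtree_wf uw; split=> //.
  split=> //; first by apply/fsubsetP=> x; rewrite mem_vert_wtree => /sub.
  apply/fsubsetP=> -[i j] /(edge_adj _ _ wfw)[ij a]; apply/(edge_adj _ _ wfG).
  by split=> //; apply: adj_wtree_sub a.
split; last exact: decreasing_acyclic.
  by apply/fset0Pn; exists m; rewrite mem_vert_wtree inE eqxx.
exact: wtree_connected.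
Qed.

Lemma mem_sorted_vert T x : (x \in sorted_vert T) = (x \in vert T).
Proof. by rewrite mem_sort. Qed.

Lemma sorted_head (s : seq nat) v : sorted leq s -> v \in s ->
  (forall y, y \in s -> v <= y) -> exists t, s = v :: t.
Proof.
case: s => //= x t xt vs vmin; exists t; congr (_ :: _); apply/eqP.
rewrite eqn_leq vmin ?inE ?eqxx // andbT.
move: vs; rewrite inE => /predU1P[->//|vt].
by have /allP/(_ v vt) := order_path_min leq_trans xt.
Qed.

Lemma frontier_sorted T rd : sorted leq (frontier T rd).
Proof. by apply: sorted_filter; [exact: leq_trans | apply: sort_sorted leq_total _]. Qed.

Lemma mem_frontier T rd v : (v \in frontier T rd) =
  [&& v \notin rd, has (adj T v) rd & v \in vert T].
Proof. by rewrite mem_filter mem_sorted_vert andbA. Qed.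

(** Each letter after the first is attached to a single earlier letter, and letters appended later
    do not change this. *)
Lemma adj_wtree_before m p y s x : uniq (m :: p ++ y :: s) ->
  x \in m :: p -> adj (wtree (m :: p ++ y :: s)) x y -> x = par (m :: p) y.
Proof.
elim/last_ind: s => [|s v IHs] us xp.
  rewrite cats1 adj_wtree_rcons.
  have /negbTE yp : y \notin m :: p.
    by move: us; rewrite cats1 -rcons_cons rcons_uniq => /andP[].
  case/or3P=> [/adj_wtree_mem[]||/andP[/eqP]//].
  - by move: us; rewrite cats1 -rcons_cons rcons_uniq => /andP[].
  - by rewrite yp.
  by case/andP=> /eqP xy; rewrite -xy xp in yp.
move: us; rewrite -rcons_cons -rcons_cat -rcons_cons rcons_uniq => /andP[vs us].
rewrite rcons_cons adj_wtree_rcons; case/or3P=> [|/andP[/eqP xv _]|/andP[_ /eqP yv]].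
- exact: IHs.
- by rewrite -xv -cat_cons mem_cat xp in vs.
by move: vs; rewrite -yv -cat_cons mem_cat !inE eqxx !orbT.
Qed.

Lemma par_suffix p s v : has (ltn v) s -> par (p ++ s) v \in s.
Proof.
rewrite has_filter /par filter_cat last_cat => s0.
have sub : {subset [seq x <- s | ltn v x] <= s} by exact: mem_subseq (filter_subseq _ _).
by apply: sub; case: [seq x <- s | ltn v x] s0 => //= y t _; apply: mem_last.
Qed.

(** The next letter v is the smallest on the frontier: a later y < v adjacent to a letter x already
    read would satisfy x = [par] of y, but the nearest letter above y occurs at v or after it,
    whereas x occurs before v. *)
Lemma read_from_wtree m p s : uniq (m :: p ++ s) ->
  read_from (wtree (m :: p ++ s)) (size s) (m :: p) = m :: p ++ s.
Proof.
elim: s p => [|v s IHs] p us; first by rewrite cats0.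
set T := wtree _; rewrite [size _]/= /read_from -/read_from.
have vp : v \notin m :: p.
  by move: us; rewrite -cat_cons -cat_rcons cat_uniq rcons_uniq => /andP[/andP[]].
have Tmem x : (x \in vert T) = (x \in (m :: p) ++ v :: s) by rewrite mem_vert_wtree.
have [t ->] : exists t, frontier T (m :: p) = v :: t.
  apply: sorted_head; first exact: frontier_sorted.
    rewrite mem_frontier vp Tmem mem_cat mem_head orbT andbT andTb.
    have ps: par (m :: p) v \in m :: p by exact: par_mem.
    have vps: v != par (m :: p) v by apply: contraNneq vp => {1}->.
    have: adj T v (par (m :: p) v); last by move=> a; apply/hasP; exists (par (m :: p) v).
    rewrite adj_wtreeE wedges_cat /= !mem_cat !inE !xpair_eqE.
    by case: (ltngtP v (par (m :: p) v)) vps => //; rewrite !eqxx ?orbT.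
  move=> y; rewrite mem_frontier Tmem mem_cat => /and3P[yp /hasP[x xp yx]].
  rewrite (negbTE yp) /= inE => /predU1P[->//|ys]; rewrite leqNgt; apply/negP=> yv.
  case/splitPr: ys => s1 s2 in us T Tmem yx {IHs}.
  have E: m :: p ++ v :: s1 ++ y :: s2 = m :: (p ++ v :: s1) ++ y :: s2.
    by rewrite -catA.
  have us' := us; rewrite E in us'.
  have := @adj_wtree_before m (p ++ v :: s1) y s2 x us'.
  rewrite -E adj_sym yx -cat_cons mem_cat xp => /(_ isT isT) ex.
  have := @par_suffix (m :: p) (v :: s1) y; rewrite /= yv -ex => /(_ isT) xs.
  move: us; rewrite -cat_cons cat_uniq => /and3P[_ /hasPn/(_ x) + _].
  by rewrite -cat_cons mem_cat xs xp => /(_ isT).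
rewrite rcons_cons /T -cat_rcons; apply: IHs; by rewrite cat_rcons.
Qed.

Lemma vmin_wtree G w : wvalid G w -> vmin (wtree w) = head 0 w.
Proof.
case: w => // m s /and3P[_ ms _]; rewrite /vmin.
have [||y|t ->//] := @sorted_head (sorted_vert (wtree (m :: s))) m.
- exact: sort_sorted leq_total _.
- by rewrite mem_sorted_vert mem_vert_wtree inE eqxx.
by rewrite mem_sorted_vert mem_vert_wtree inE => /predU1P[->//|/(allP ms)/ltnW].
Qed.

Lemma list_of_wtree G w : wvalid G w -> list_of (wtree w) = w.
Proof.
move=> vw; have uw := wvalid_uniq vw; rewrite /list_of (vmin_wtree vw).
case: w => // m s in vw uw *.
have -> : (vert (wtree (m :: s)) == fset0) = false.
  by apply/negbTE/fset0Pn; exists m; rewrite mem_vert_wtree inE eqxx.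
by rewrite nvert_wtree //; apply: (@read_from_wtree m [::] s).
Qed.

Section ListOfTree.

Variables (G T : graph).
Hypothesis decT : decreasing_subtree G T.

Let wfT : wf_graph T. Proof. by case: decT => -[]. Qed.

Let larger_unique v x y : v < x -> v < y -> adj T v x -> adj T v y -> x = y.
Proof.
case: decT => _ _ dec vx vy ax ay.
have [vT xT] : v \in vert T /\ x \in vert T by case/orP: (ax) => /wfT[].
by have [u [_ uu]] := dec v x vT xT vx; rewrite -(uu x) // (uu y).
Qed.

(* In the last clause [y] lies on the frontier since [x] was read, so every
   letter read after [x] was preferred to it. *)
Definition reading (m : nat) (s : seq nat) : Prop :=
  [/\ uniq (m :: s), {subset m :: s <= vert T}, wrec T [:: m] s,
      forall x y, x \in m :: s -> y \in m :: s ->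
        adj T x y = adj (wtree (m :: s)) x y &
      forall p x q y, m :: s = p ++ x :: q -> y \in vert T ->
        y \notin m :: s -> adj T x y -> all (fun z => z < y) q].

(** If v < x, the letters read after x are all below v, so x is the nearest larger one. If x < v,
    then v is the only larger neighbour of x in T; so x has none among the read letters, which makes
    x their maximum and v a record. *)
Lemma reading_par m s v x : reading m s -> v \in vert T -> v \notin m :: s ->
  x \in m :: s -> adj T x v -> x = par (m :: s) v.
Proof.
case=> us sub _ adjs near vT vs xs xv.
have [p [q e]] : exists p q, m :: s = p ++ x :: q.
  by case/splitPr: xs => p q; exists p, q.
have qv := near p x q v e vT vs xv.
have xnv : x != v by apply: contraNneq vs => <-.
case: (ltngtP v x) xnv => // [vx|xltv] _; first by rewrite e par_nearest.
have xmax : x = seqmax (m :: s).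
  apply/eqP; rewrite eqn_leq seqmax_ge //= leqNgt; apply/negP=> lt.
  have [u [[xu au] _]] := wtree_larger us xs (@seqmax_mem (m :: s) isT) lt.
  have [_ um _] := adj_wtree_mem us au.
  by move: vs; rewrite -(larger_unique xu xltv _ xv) ?um // adjs.
rewrite par_max //; apply/negP=> /hasP[y ys /= vy].
by have := leq_trans vy (seqmax_ge ys); rewrite -xmax ltnNge ltnW.
Qed.

Lemma reading_step m s v t : reading m s -> all (ltn m) s -> vmin T = m ->
  frontier T (m :: s) = v :: t ->
  reading m (rcons s v) /\ m < v.
Proof.
move=> rd ms mT fr; have [us sub ws adjs near] := rd.
have: v \in frontier T (m :: s) by rewrite fr mem_head.
rewrite mem_frontier => /and3P[vs /hasP[x xs vx] vT].
have vmins y : y \in frontier T (m :: s) -> v <= y.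
  have := frontier_sorted T (m :: s); rewrite fr /= => st.
  rewrite inE => /predU1P[->//|yt].
  by have /allP/(_ y yt) := order_path_min leq_trans st.
have parE y : y \in m :: s -> adj T y v = (y == par (m :: s) v).
  move=> ys; apply/idP/eqP => [|->]; first exact: reading_par.
  by rewrite -(reading_par rd vT vs xs) adj_sym.
have irr y z : adj T y z -> y != z.
  by case/orP=> /wfT[yz _ _]; rewrite neq_ltn yz ?orbT.
have mv : m < v.
  have mv : m != v by apply: contraNneq vs => ->; rewrite mem_head.
  rewrite ltn_neqAle mv -mT /vmin.
  have := sort_sorted leq_total (vert T); move: vT; rewrite -mem_sorted_vert.
  rewrite /sorted_vert; case: (sort leq _) => //= y r + /(order_path_min leq_trans).
  by rewrite inE => /predU1P[->//|yr] /allP/(_ v yr).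
split=> //; split.
- by rewrite -rcons_cons rcons_uniq vs.
- by move=> y; rewrite -rcons_cons mem_rcons inE => /predU1P[->|/sub].
- by rewrite -cats1 wrec_cat ws /= vs adj_sym parE ?eqxx // par_mem.
- have adjv y : adj (wtree (m :: s)) v y = false.
    by apply/negP=> /(adj_wtree_mem us)[]; rewrite (negbTE vs).
  have adjv' y : adj (wtree (m :: s)) y v = false by rewrite adj_sym.
  have vp : (v == par (m :: s) v) = false.
    by apply/negbTE; apply: contraNneq vs => {1}->; exact: par_mem.
  move=> y z; rewrite -rcons_cons !mem_rcons !(in_cons v) adj_wtree_rcons.
  case: (eqVneq y v) => [->|yv] /=; case: (eqVneq z v) => [->|zv] //= ys zs.
  + by rewrite adjv vp; apply/negP=> /irr; rewrite eqxx.
  + by rewrite adjv andbF orbF adj_sym parE.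
  + by rewrite adjv' andbT parE.
  by rewrite andbF orbF adjs.
move=> p y q z; rewrite -rcons_cons; case/lastP: q => [//|q v'].
rewrite -rcons_cons -rcons_cat => /rcons_inj[e <-] zT.
rewrite mem_rcons inE => /norP[zv zs] yz.
rewrite all_rcons (near p y q z e) // andbT.
have : v <= z; last by rewrite leq_eqVlt eq_sym (negbTE zv).
apply: vmins; rewrite mem_frontier zs zT andbT; apply/hasP.
by exists y; rewrite 1?adj_sym // e mem_cat mem_head orbT.
Qed.

(** A path of T from m to an unread vertex leaves the set of read letters, and its first vertex
    outside lies on the frontier. *)
Lemma frontier_neq0 m s : {subset m :: s <= vert T} ->
  size (m :: s) < nvert T -> uniq (m :: s) -> frontier T (m :: s) != [::].
Proof.
move=> sub lt us; case: decT => _ [_ conT _] _.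
have [v vT vs] : exists2 v, v \in vert T & v \notin m :: s.
  apply/hasP; rewrite -[has _ _]negbK -all_predC; apply/negP=> /allP h.
  move: lt; rewrite ltnNge uniq_leq_size // => x xT.
  by have := h x xT; rewrite /= negbK.
have [p [pp lp]] := conT m v (sub m (mem_head _ _)) vT.
suff : exists2 y, y \in vert T & (y \notin m :: s) && has (adj T y) (m :: s).
  case=> y yT /andP[ys ay]; have: y \in frontier T (m :: s).
    by rewrite mem_frontier ys ay.
  by case: (frontier T _).
have := mem_head m s; elim: p {1 2 3}m pp lp => [|x p IHp] u /=.
  by move=> _ -> vs'; rewrite vs' in vs.
case/andP=> ux px lp us'; case: (boolP (x \in m :: s)) => [xs|xs].
  exact: IHp x px lp xs.
exists x; first by case/orP: ux => /wfT[].
by rewrite xs; apply/(@hasP _ (adj T x) (m :: s)); exists u; rewrite // adj_sym.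
Qed.

Lemma read_from_reading k m s : reading m s -> all (ltn m) s -> vmin T = m ->
  k + size (m :: s) = nvert T ->
  exists s', [/\ read_from T k (m :: s) = m :: s', reading m s',
    all (ltn m) s' & size (m :: s') = nvert T].
Proof.
elim: k s => [|k IHk] s rd ms mT sz; first by exists s.
have [us sub _ _ _] := rd.
have lt : size (m :: s) < nvert T by rewrite -sz addSn ltnS leq_addl.
have := frontier_neq0 sub lt us.
rewrite [read_from _ _ _]/=; case fr: (frontier T (m :: s)) => [//|v t] _.
have [rd' mv] := reading_step rd ms mT fr; rewrite -/(rcons (m :: s) v) rcons_cons.
apply: IHk => //; first by rewrite all_rcons /= mv.
by rewrite -sz /= size_rcons addSnnS.
Qed.

Lemma list_of_tree : wvalid G (list_of T) /\ wtree (list_of T) = T.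
Proof.
have [[_ subV subE] [T0 conT _] _] := decT.
have mT : vmin T \in vert T.
  rewrite /vmin -mem_sorted_vert; case: (sorted_vert T) (mem_sorted_vert T) => [|x s] e.
    by case/fset0Pn: T0 => x; rewrite -e.
  exact: mem_head.
have rd0 : reading (vmin T) [::].
  split=> // [x|x y|p x q y].
  - by rewrite inE => /eqP->.
  - rewrite !inE => /eqP-> /eqP->; rewrite adj_wtree_nil.
    by apply/negP=> /orP[] /wfT[]; rewrite ltnn.
  by case: p => [|? []] //= [_ <-].
have T1 : (nvert T).-1 + size [:: vmin T] = nvert T.
  by rewrite addn1 prednK // cardfs_gt0.
have -> : list_of T = read_from T (nvert T).-1 [:: vmin T].
  by rewrite /list_of (negbTE T0).
have [s [-> [us sub ws adjs _] ms sz]] := read_from_reading rd0 isT erefl T1.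
have vertT : vert (wtree (vmin T :: s)) = vert T.
  apply/fsetP=> x; rewrite mem_vert_wtree.
  have [|_ e] := uniq_min_size us sub; last by rewrite e.
  by rewrite -/(nvert T) sz.
split.
  rewrite /= ms (fsubsetP subV) //=.
  elim/last_ind: (s) ws => // p v IHp; rewrite -cats1 !wrec_cat /=.
  case/andP=> /IHp-> /and3P[-> + _]; rewrite andbT /=.
  by case/orP=> /(fsubsetP subE) e; rewrite /adj e ?orbT.
have wfw := wtree_wf us; rewrite (surjective_pairing T) (surjective_pairing (wtree _)).
rewrite -/(vert _) -/(vert T) vertT; congr (_, _); apply/fsetP=> -[i j].
apply/idP/idP => [/(edge_adj _ _ wfw)|/(edge_adj _ _ wfT)] [ij aij].
  apply/(edge_adj _ _ wfT); split=> //; have [im jm _] := adj_wtree_mem us aij.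
  by rewrite adjs.
apply/(edge_adj _ _ wfw); split=> //; rewrite -adjs // -mem_vert_wtree vertT.
  by case/orP: aij => /wfT[].
by case/orP: aij => /wfT[].
Qed.

End ListOfTree.

(** * Forest triples as sequences of words *)

Definition word (x : ltriple) : seq nat := x.1.1.
Definition lparts (x : ltriple) : seq nat := x.1.2.
Definition lrval (x : ltriple) : nat := x.2.

Definition of_list (x : ltriple) : ttriple := (wtree (word x), lparts x, lrval x).

Definition wtriple (G : graph) (x : ltriple) : bool :=
  [&& wvalid G (word x), composition_of (size (word x)) (lparts x) &
      1 <= lrval x <= head 0 (lparts x)].

Definition letters (W : seq ltriple) : seq nat := flatten [seq word x | x <- W].

(** The single permutation condition encodes both the covering of the vertex set and the
    disjointness of the trees; being boolean, the predicate can be filtered and counted. *)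
Definition wforest (G : graph) (W : seq ltriple) : bool :=
  [&& all (wtriple G) W, perm_eq (letters W) (vert G) &
      sorted ltn [seq head 0 (word x) | x <- W]].

Definition wsimple (G : graph) (W : seq ltriple) : bool :=
  wforest G W && (head 0 [seq lrval x | x <- W] == 1).

Lemma to_listP G x : tree_triple G x ->
  wtriple G (to_list x) /\ of_list (to_list x) = x.
Proof.
case: x => [[T al] r] [/= dT co rr]; have [vT eT] := list_of_tree dT.
rewrite /of_list /word /= eT; split=> //; rewrite /wtriple /word /= vT rr.
by rewrite -[T]eT (nvert_wtree (wvalid_uniq vT)) in co; rewrite co.
Qed.

Lemma of_listP G x : wf_graph G -> wtriple G x ->
  tree_triple G (of_list x) /\ to_list (of_list x) = x.
Proof.
move=> wfG; case: x => [[w al] r]; rewrite /wtriple /word /= => /and3P[vw co rr].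
split; last by rewrite /to_list /of_list /word /= (list_of_wtree vw).
split=> //=; first exact: wtree_decreasing.
by rewrite (nvert_wtree (wvalid_uniq vw)).
Qed.

Lemma uniq_letters G W : all (wtriple G) W ->
  uniq (letters W) =
    pairwise (fun x y => [disjoint vert (tree x) & vert (tree y)])
      [seq of_list x | x <- W].
Proof.
elim: W => // x W IHW /= /andP[/and3P[vx _ _] /IHW {IHW} <-].
rewrite {1}/letters /= cat_uniq (wvalid_uniq vx) -/(letters W) /=; congr (_ && _).
apply/hasPn/allP => [h _ /mapP[y yW ->]|h v vW].
  apply/fdisjointP => v; rewrite !mem_vert_wtree => vx'; apply: contraL vx' => vy.
  by apply: h; apply/flattenP; exists (word y); rewrite // map_f.
case/flattenP: vW => _ /mapP[y yW ->] vy; apply/negP=> vx'.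
by have /fdisjointP/(_ v) := h _ (map_f _ yW); rewrite !mem_vert_wtree vy => /(_ vx').
Qed.

Lemma mem_letters W v :
  (v \in letters W) = (v \in \bigcup_(x <- [seq of_list x | x <- W]) vert (tree x)).
Proof.
elim: W => [|x W IHW]; first by rewrite big_nil.
by rewrite /= big_cons inE /letters /= mem_cat mem_vert_wtree -IHW.
Qed.

Lemma sorted_heads G W : all (wtriple G) W ->
  [seq head 0 (word x) | x <- W] = [seq vmin (tree x) | x <- [seq of_list x | x <- W]].
Proof.
move=> /allP h; rewrite -map_comp; apply/eq_in_map => x /h /and3P[vx _ _] /=.
by rewrite (vmin_wtree vx).
Qed.

Lemma of_list_forest G W : wf_graph G -> wforest G W ->
  forest_triple G [seq of_list x | x <- W] /\
  [seq to_list x | x <- [seq of_list x | x <- W]] = W.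
Proof.
move=> wfG /and3P[aW pW sW]; split; last first.
  rewrite -map_comp -[RHS]map_id; apply/eq_in_map => x /(allP aW).
  by case/(of_listP wfG).
split; last by rewrite -(sorted_heads aW).
- by move=> _ /mapP[x xW ->]; have [] := of_listP wfG (allP aW x xW).
- by apply/fsetP=> v; rewrite -(perm_mem pW) mem_letters.
by rewrite -(uniq_letters aW) (perm_uniq pW) fset_uniq.
Qed.

Lemma to_list_forest G F : forest_triple G F ->
  wforest G [seq to_list x | x <- F] /\
  [seq of_list x | x <- [seq to_list x | x <- F]] = F.
Proof.
case=> tF vF dF sF.
have E : [seq of_list x | x <- [seq to_list x | x <- F]] = F.
  rewrite -map_comp -[RHS]map_id; apply/eq_in_map => x /tF.
  by case/to_listP.
have aF : all (wtriple G) [seq to_list x | x <- F].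
  by apply/allP=> _ /mapP[x /tF xF ->]; case/to_listP: xF.
split=> //; rewrite /wforest aF /= (sorted_heads aF) E sF andbT.
apply: uniq_perm; rewrite ?fset_uniq // ?(uniq_letters aF) ?E //.
by move=> v; rewrite mem_letters E vF.
Qed.

Lemma of_list_simple G W : wf_graph G -> wsimple G W ->
  simple_forest_triple G [seq of_list x | x <- W] /\
  [seq to_list x | x <- [seq of_list x | x <- W]] = W.
Proof.
move=> wfG /andP[fW /eqP hW]; have [fF tF] := of_list_forest wfG fW.
by split=> //; split=> //; rewrite -map_comp.
Qed.

Lemma to_list_simple G F : simple_forest_triple G F ->
  wsimple G [seq to_list x | x <- F] /\
  [seq of_list x | x <- [seq to_list x | x <- F]] = F.
Proof.
case=> fF hF; have [fW tF] := to_list_forest fF; split=> //.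
by rewrite /wsimple fW -map_comp; apply/eqP.
Qed.

Fixpoint ginv (G : graph) (s : seq nat) : nat :=
  if s is x :: s' then count (fun y => (y < x) && adj G y x) s' + ginv G s'
  else 0.

Lemma inv_graphE G s : inv_graph G s = ginv G s.
Proof.
pose b (s : seq nat) i j := [&& i < j, nth 0 s i > nth 0 s j & adj G (nth 0 s j) (nth 0 s i)].
have -> : inv_graph G s = \sum_(i < size s) \sum_(j < size s) b s i j.
  rewrite /inv_graph cardsE -sum1_card big_mkcond /= pair_big /=.
  by apply: eq_bigr.
elim: s => [|x s IHs]; first by rewrite big_ord0.
rewrite big_ord_recl big_ord_recl {1}/b /= add0n -IHs; congr (_ + _).
  rewrite -sum1_count (big_nth 0) big_mkord [RHS]big_mkcond /=.
  by apply: eq_bigr => j _; rewrite /b /=; case: (_ && _).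
by apply: eq_bigr => i _; rewrite big_ord_recl.
Qed.

Lemma weightE G F :
  weight G F = ginv G (letters [seq to_list x | x <- F]) +
    \sum_(x <- [seq to_list x | x <- F]) (lrval x).-1.
Proof. by rewrite /weight inv_graphE /letters -map_comp big_map. Qed.

Lemma mem_ivl n v : (v \in ivl n) = (1 <= v <= n).
Proof. by rewrite /ivl !inE mem_iota add1n ltnS. Qed.

Lemma wrec_eq G1 G2 p s : p != [::] ->
  (forall x y, x \in p ++ s -> y \in p ++ s -> adj G1 x y = adj G2 x y) ->
  wrec G1 p s = wrec G2 p s.
Proof.
elim: s p => //= v s IHs p p0 h; rewrite h ?mem_cat ?mem_head ?par_mem ?orbT //.
rewrite (IHs (rcons p v)) //; first by case: (p).
by rewrite cat_rcons.
Qed.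

Lemma edge_K a eps i j : ((i, j) \in edge (Kgraph a eps)) =
  [&& 1 <= i, i < j, j <= a & ~~ (eps && ((i == 1) && (j == a)))].
Proof.
rewrite /edge /= !inE /= xpair_eqE; case: (ltnP i j) => ij; rewrite ?andbF //=.
case: (~~ _); rewrite ?andbF ?andbT //=.
apply/allpairsP/andP => [[[x y] /= []]|[i1 ja]].
  by rewrite !mem_iota => /andP[x1 _] /andP[_ ya] [-> ->]; split; lia.
by exists (i, j); rewrite !mem_iota /=; split=> //; lia.
Qed.

(** * Edges and valid words of K_a^eps + G' *)

Section Glue.

Variables (n' : nat) (G' : graph) (a : nat) (eps : bool).
Hypotheses (n'0 : 1 <= n') (a2 : 2 <= a) (vG' : vert G' = ivl n') (wfG' : wf_graph G').

Let G := gsum (Kgraph a eps) G'.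
Local Notation s := (a.-1).

Lemma nvert_ivl n H : vert H = ivl n -> nvert H = n.
Proof.
by move=> vH; rewrite /nvert vH /ivl card_fseq undup_id ?iota_uniq ?size_iota.
Qed.

Lemma vert_gsum v : (v \in vert G) = (1 <= v <= s + n').
Proof.
have -> : vert G = ivl (nvert (Kgraph a eps) + nvert G').-1 by [].
rewrite mem_ivl (nvert_ivl vG') (@nvert_ivl a) //.
by case: (a) a2.
Qed.

Lemma edge_gsum i j : ((i, j) \in edge G) =
  ((i, j) \in edge (Kgraph a eps)) ||
  [&& s <= i, s <= j & (i - s, j - s) \in edge G'].
Proof.
have sE : (nvert (Kgraph a eps)).-1 = s by rewrite (@nvert_ivl a).
rewrite /G /gsum /edge /= in_fsetU sE; congr (_ || _).
apply/imfsetP/and3P => [[[x y] /= e [-> ->]]|[si sj e]].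
  by rewrite !addnK !leq_addl; split.
by exists (i - s, j - s) => //=; rewrite !subnK.
Qed.

Lemma edge_G' i j : (i, j) \in edge G' -> [/\ 1 <= i, i < j & j <= n'].
Proof. by case/wfG'=> ij; rewrite vG' !mem_ivl => /andP[i1 _] /andP[_ jn]. Qed.

Lemma gsum_wf : wf_graph G.
Proof.
move=> i j; rewrite edge_gsum edge_K !vert_gsum.
by case/orP=> [/and4P[]|/and3P[si sj /edge_G'[]]]; split; lia.
Qed.

Lemma adj_lo x y : x <= a -> y <= a -> adj G x y = adj (Kgraph a eps) x y.
Proof.
move=> xa ya; rewrite /adj !edge_gsum.
have h i j : i <= a -> j <= a -> [&& s <= i, s <= j & (i - s, j - s) \in edge G'] = false.
  by move=> ia ja; apply/negP=> /and3P[si sj /edge_G'[]]; lia.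
by rewrite !h // !orbF.
Qed.

Lemma adj_hi x y : 1 <= x -> 1 <= y -> adj G (s + x) (s + y) = adj G' x y.
Proof.
move=> x1 y1; rewrite /adj !edge_gsum !edge_K !leq_addr !addKn /=.
have h i j : 1 <= i -> 1 <= j -> [&& 0 < s + i, s + i < s + j, s + j <= a
     & ~~ (eps && ((s + i == 1) && (s + j == a)))] = false.
  by move=> i1 j1; apply/negP=> /and4P[]; lia.
by rewrite !h.
Qed.

(** This expresses that a is a cut vertex: no edge passes from below a to above a. *)
Lemma adj_mid x y : adj G x y -> x < a -> y <= a.
Proof.
rewrite /adj !edge_gsum !edge_K => /orP[]/orP[/and4P[]|/and3P[si sj /edge_G'[]]]; lia.
Qed.

Lemma wvalid_lo w : all (fun x => x <= a) w ->
  wvalid G w = wvalid (Kgraph a eps) w.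
Proof.
case: w => //= m w /andP[ma wa]; rewrite vert_gsum mem_ivl (@wrec_eq G (Kgraph a eps)) //.
  by congr andb; lia.
have h x : x \in [:: m] ++ w -> x <= a.
  by rewrite inE => /predU1P[->//|/(allP wa)].
by move=> x y /h xa /h ya; apply: adj_lo.
Qed.

Lemma par_map (p : seq nat) y : p != [::] -> par (map (addn s) p) (s + y) = s + par p y.
Proof.
move=> p0; have mx q : seqmax (map (addn s) q) = if q is [::] then 0 else s + seqmax q.
  elim: q => //= x q ->; case: q => [|z q]; rewrite ?maxn0 //.
  by rewrite addn_maxr.
rewrite /par filter_map (@eq_filter _ (preim (addn s) _) (fun x => y < x)); last first.
  by move=> x /=; rewrite ltn_add2l.
rewrite mx; case: p p0 => // x p _.
by case: [seq _ <- _ | _] => //= z t; rewrite last_map.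
Qed.

Lemma wrec_hi p v : p != [::] -> all (leq 1) (p ++ v) ->
  wrec G (map (addn s) p) (map (addn s) v) = wrec G' p v.
Proof.
elim: v p => //= y v IHv p p0 h.
have pp : par p y \in p by exact: par_mem.
have y1 : 1 <= y by apply: (allP h); rewrite mem_cat mem_head orbT.
have py : 1 <= par p y by apply: (allP h); rewrite mem_cat pp.
rewrite par_map // adj_hi // -map_rcons IHv; last 2 first.
- by case: (p).
- by rewrite cat_rcons.
by rewrite mem_map //; exact: addnI.
Qed.

Lemma wvalid_hi v : all (leq 1) v -> wvalid G (map (addn s) v) = wvalid G' v.
Proof.
case: v => // m v /= h; case/andP: (h) => m1 v1.
rewrite (@wrec_hi [:: m]) // vert_gsum vG' mem_ivl all_map; congr [&& _, _ & _].
  by rewrite leq_add2l addn_gt0 m1 orbT.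
by apply: eq_all => x /=; rewrite ltn_add2l.
Qed.

(** For a letter above a, the prefix w matters only through its maximum a, the one letter of w that
    [par] can return; so a plays the role of the letter 1 of G'. *)
Lemma wrec_mix w p v : w != [::] -> all (fun x => x <= a) w -> a \in w ->
  all (ltn 1) p -> all (ltn 1) v ->
  wrec G (w ++ map (addn s) p) (map (addn s) v) = wrec G' (1 :: p) v.
Proof.
move=> w0 wa aw; have sa : s + 1 = a by lia.
elim: v p => //= y v IHv p hp /andP[y1 hv].
have yw : s + y \in w = false by apply/negP=> /(allP wa) /=; lia.
have -> : par (w ++ map (addn s) p) (s + y) = s + par (1 :: p) y.
  rewrite -par_map //= /par filter_cat /=.
  have -> : [seq x <- w | s + y < x] = [::].
    by apply/eqP; rewrite -[_ == _]negbK -has_filter; apply/hasPn => x /(allP wa) /=; lia.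
  have -> : s + y < s + 1 = false by lia.
  rewrite last_cat /=; congr last; rewrite seqmax_cat sa; congr maxn.
  apply/eqP; rewrite eqn_leq (seqmax_ge aw) andbT.
  exact: (allP wa) (seqmax_mem w0).
rewrite adj_hi; [|lia|]; last first.
  have : par (1 :: p) y \in 1 :: p by exact: par_mem.
  by rewrite inE => /predU1P[->//|/(allP hp)/ltnW].
rewrite rcons_cat -map_rcons IHv // ?all_rcons /= ?y1 //.
rewrite mem_cat yw /=.
rewrite mem_map; last exact: addnI.
by rewrite inE (_ : (y == 1) = false) //; apply/eqP; lia.
Qed.

Lemma wvalid_mix w v : all (fun x => x <= a) w -> a \in w -> all (ltn 1) v ->
  wvalid G (w ++ map (addn s) v) = wvalid (Kgraph a eps) w && wvalid G' (1 :: v).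
Proof.
case: w => // m w wa aw v1; rewrite -(wvalid_lo wa) /= wrec_cat.
rewrite -[[:: m] ++ w]/(m :: w) -[m :: w]cats0 -[[::]]/(map (addn s) [::]) wrec_mix //.
have -> : 1 \in vert G' by rewrite vG' mem_ivl.
rewrite v1 all_cat all_map.
have -> : all (preim (addn s) (ltn m)) v = true.
  by apply/allP=> x /(allP v1) /= x1; move/andP: wa => [/= ma _]; lia.
by rewrite andbT /= -!andbA.
Qed.

End Glue.

(** * Gluing and cutting at the vertex a *)

(** The first letter of y is the vertex a, already present in x, and the first part of y is already
    counted in the last part of x; both are dropped. *)
Definition ext (d : nat) (x y : ltriple) : ltriple :=
  (word x ++ map (addn d) (behead (word y)), lparts x ++ behead (lparts y), lrval x).

Definition up (d : nat) (y : ltriple) : ltriple :=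
  (map (addn d) (word y), lparts y, lrval y).

(* Inverse to F |-> F|_{>= a}: F is the restriction, and L records the trees on
   [a], the composition of the tree containing a being cut after the part that
   contains its vertex a. *)
Definition glue (a : nat) (L F : seq ltriple) : seq ltriple :=
  if F is y :: F1 then
    [seq if a \in word x then ext a.-1 x y else x | x <- L] ++ map (up a.-1) F1
  else [::].
Arguments glue : simpl never.

(* The compositions that a tree meeting [a] in k vertices can have, once cut at
   the part containing the k-th vertex, if b - 1 further vertices of the tree
   are counted in that part. *)
Definition pcond (k b : nat) (p : seq nat) : bool :=
  [&& all (leq 1) p, sumn p == k.-1 + b & b <= last 0 p].

(** For a tree that misses a the value 1 makes [pcond] an ordinary composition of the size, by
    [pcond1]. *)
Definition litem (a : nat) (eps : bool) (b : nat) (x : ltriple) : bool :=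
  [&& wvalid (Kgraph a eps) (word x),
      pcond (size (word x)) (if a \in word x then b else 1) (lparts x) &
      1 <= lrval x <= head 0 (lparts x)].

Definition lforest (a : nat) (eps : bool) (b : nat) (L : seq ltriple) : bool :=
  [&& all (litem a eps b) L, perm_eq (letters L) (iota 1 a),
      sorted ltn [seq head 0 (word x) | x <- L] &
      head 0 [seq lrval x | x <- L] == 1].

Definition lalpha (F : seq ltriple) : nat := head 0 (head [::] [seq lparts x | x <- F]).

Fixpoint cutp (k : nat) (p : seq nat) : seq nat * seq nat :=
  if p is c :: q then
    if k <= c then ([:: c], q) else (c :: (cutp (k - c) q).1, (cutp (k - c) q).2)
  else ([::], [::]).

(** Under [pcond k b p] the parts before the last sum to at most k - 1, while p sums to at least k;
    so the part containing position k is the last part of p. *)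
Lemma cutp_cat k b p q : 1 <= b -> 1 <= k -> pcond k b p -> cutp k (p ++ q) = (p, q).
Proof.
move=> b1; elim: p k => [|c p IHp] k k1 /and3P[/= p1 /eqP sp lp]; first by lia.
case: p => [|c' p] in IHp p1 sp lp *.
  by rewrite (_ : k <= c) //=; move: sp; rewrite /= addn0; lia.
have lt : b <= sumn (c' :: p).
  apply: leq_trans lp _; rewrite -/(last 0 (c' :: p)).
  elim: (p) (c') => //= [c0|d r IHr c0]; first by rewrite addn0.
  exact: leq_trans (IHr d) (leq_addl _ _).
rewrite (_ : k <= c = false); last by rewrite /= in sp lt; lia.
rewrite IHp //; first by rewrite /= in sp lt; lia.
case/andP: p1 => c1 p1; apply/and3P; split=> //.
by apply/eqP; rewrite /= in sp lt *; lia.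
Qed.

Lemma cutpP k p : 1 <= k <= sumn p -> all (leq 1) p ->
  [/\ (cutp k p).1 ++ (cutp k p).2 = p, k <= sumn (cutp k p).1 &
      pcond k (sumn (cutp k p).1 - k.-1) (cutp k p).1].
Proof.
elim: p k => [|c p IHp] k /=; first by lia.
move=> /andP[k1 ks] /andP[c1 p1]; case: ifP => kc /=.
  by split; rewrite ?addn0 // /pcond /= addn0 c1; apply/andP; split; [apply/eqP|]; lia.
have [||e ks' /and3P[q1 /eqP sq lq]] := IHp (k - c) => //; first by lia.
split; [by rewrite e | lia | apply/and3P; split; rewrite //= ?c1 //].
  by apply/eqP; lia.
by case: (cutp _ _).1 lq ks' => /= [|d r]; lia.
Qed.

Lemma pcond1 k p : 1 <= k -> pcond k 1 p = composition_of k p.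
Proof.
move=> k1; rewrite /pcond /composition_of addn1 prednK //.
case p1: (all _ p) => //=; case: eqP => //= sp.
have : p != [::] by apply: contraTneq k1 => p0; rewrite -sp p0.
case/lastP: p => // q c in p1 sp *; rewrite last_rcons.
by move: p1; rewrite all_rcons => /andP[].
Qed.

Lemma letters_cons x W : letters (x :: W) = word x ++ letters W.
Proof. by []. Qed.

Lemma letters_cat W1 W2 : letters (W1 ++ W2) = letters W1 ++ letters W2.
Proof. by rewrite /letters map_cat flatten_cat. Qed.

Lemma letters_up d W : letters (map (up d) W) = map (addn d) (letters W).
Proof. by elim: W => //= x W IHW; rewrite !letters_cons map_cat IHW. Qed.

Lemma letters_has v W : (v \in letters W) = has (fun x => v \in word x) W.
Proof. by elim: W => //= x W IHW; rewrite letters_cons mem_cat IHW. Qed.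

Lemma glue_split a L1 x L2 y F1 : a \notin letters L1 -> a \in word x ->
  a \notin letters L2 ->
  glue a (L1 ++ x :: L2) (y :: F1) = L1 ++ ext a.-1 x y :: L2 ++ map (up a.-1) F1.
Proof.
have h L : a \notin letters L -> [seq if a \in word x then ext a.-1 x y else x | x <- L] = L.
  rewrite letters_has => /hasPn h; rewrite -[RHS]map_id; apply/eq_in_map => z /h.
  by move/negbTE->.
by move=> a1 ax a2; rewrite /glue map_cat /= ax !h // -catA.
Qed.

Lemma letters_split v W : uniq (letters W) -> v \in letters W ->
  exists W1 x W2, [/\ W = W1 ++ x :: W2, v \notin letters W1, v \in word x &
    v \notin letters W2].
Proof.
move=> uW; rewrite letters_has => /hasP[x xW vx].
case/splitPr: xW uW => W1 W2; rewrite letters_cat letters_cons => uW.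
exists W1, x, W2; split=> //; move: uW; rewrite cat_uniq => /and3P[_ h].
  by move=> _; apply: contra h => vW; apply/hasP; exists v; rewrite // mem_cat vx.
rewrite cat_uniq => /and3P[_ h' _].
by apply: contra h' => vW; apply/hasP; exists v.
Qed.

Lemma perm_ivl n s : perm_eq s (ivl n) = perm_eq s (iota 1 n).
Proof.
have h : perm_eq (ivl n) (iota 1 n).
  apply: uniq_perm; rewrite ?iota_uniq ?fset_uniq // => v.
  by rewrite mem_ivl mem_iota add1n ltnS.
by rewrite (permPr h).
Qed.

(** Words start with their smallest letter and these first letters increase along the forest, so 1
    can only be the first letter of the first word. *)
Lemma wsimple_first n G y F : 1 <= n -> vert G = ivl n -> wf_graph G ->
  wsimple G (y :: F) ->
  [/\ exists v, word y = 1 :: v, lrval y = 1 & all (ltn 1) (behead (word y) ++ letters F)].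
Proof.
move=> n1 vG wfG /andP[/and3P[/= /andP[wy wF] pW sW] /eqP r1].
rewrite vG perm_ivl in pW.
have pos v : v \in letters (y :: F) -> 1 <= v.
  by rewrite (perm_mem pW) mem_iota => /andP[].
have uW : uniq (letters (y :: F)) by rewrite (perm_uniq pW) iota_uniq.
have m1 : 1 \in letters (y :: F) by rewrite (perm_mem pW) mem_iota; lia.
have hd x : wtriple G x -> exists v, word x = head 0 (word x) :: v /\ all (ltn (head 0 (word x))) v.
  by case/and3P; case: (word x) => // m v /and3P[_ mv _] _ _; exists v.
have [v [ey yv]] := hd y wy.
have hy : 1 <= head 0 (word y).
  by apply: pos; rewrite letters_cons ey mem_cat mem_head.
have mF z u : z \in F -> u \in word z -> head 0 (word y) < u.
  move=> zF uz; have lt : head 0 (word y) < head 0 (word z).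
    have /allP := order_path_min ltn_trans sW.
    by apply; apply: (map_f (fun x => head 0 (word x))).
  have [t [ez zt]] := hd z (allP wF z zF); apply: leq_trans lt _.
  by move: uz; rewrite ez inE => /predU1P[->//|/(allP zt)/ltnW].
have h1 : head 0 (word y) = 1.
  apply/eqP; rewrite eqn_leq hy andbT; move: m1; rewrite letters_cons mem_cat.
  case/orP=> [|].
    by rewrite ey inE => /predU1P[->//|/(allP yv)/= /ltnW].
  by rewrite letters_has => /hasP[z zF /(mF z _ zF)/ltnW].
split=> //; first by exists v; rewrite ey h1.
rewrite all_cat {1}ey /= -{1}h1 yv /=; apply/allP => u.
by rewrite letters_has => /hasP[z zF /(mF z _ zF)]; rewrite h1.
Qed.

Lemma cat_sorted_ltn (l r : seq nat) c : sorted ltn l -> sorted ltn r ->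
  all (fun x => x <= c) l -> all (ltn c) r -> sorted ltn (l ++ r).
Proof.
move=> sl sr lc rc; case: l => [//|x l] in sl lc *; rewrite /= cat_path; move: sl => /= -> /=.
case: r => //= y r in sr rc *; rewrite sr andbT; case/andP: rc => cy _.
by apply: leq_ltn_trans cy; apply: (allP lc); exact: mem_last.
Qed.

Section GlueForest.

Variables (n' : nat) (G' : graph) (a : nat) (eps : bool).
Hypotheses (n'0 : 1 <= n') (a2 : 2 <= a) (vG' : vert G' = ivl n') (wfG' : wf_graph G').

Let G := gsum (Kgraph a eps) G'.
Local Notation s := (a.-1).

Lemma ltn_up u : (a < s + u) = (1 < u).
Proof. by clear -a2; lia. Qed.

Lemma leq_up u : (s + u <= a) = (u <= 1).
Proof. by clear -a2; lia. Qed.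

Lemma vert_gsumE : vert G = ivl (s + n').
Proof. by apply/fsetP=> v; rewrite (vert_gsum eps a2 vG') mem_ivl. Qed.

(** Comparing letters with a separates the two halves again: as r avoids 1, its shifted letters all
    exceed a. The 1 put before r stands for the glued vertex, counted in l. *)
Lemma perm_glue l r : all (fun x => x <= a) l -> all (ltn 1) r ->
  perm_eq (l ++ map (addn s) r) (iota 1 (s + n')) =
    perm_eq l (iota 1 a) && perm_eq (1 :: r) (iota 1 n').
Proof.
move=> la r1; have e1 : iota 1 (s + n') = iota 1 a ++ map (addn s) (iota 2 n'.-1).
  rewrite -iotaDl (_ : s + n' = a + n'.-1) ?iotaD; last lia.
  by congr (_ ++ iota _ _); lia.
have e2 : iota 1 n' = 1 :: iota 2 n'.-1 by case: (n') n'0.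
rewrite e1 e2 perm_cons; apply/idP/andP => [pe|[pl pr]]; last by rewrite perm_cat // perm_map.
have f1 t u : all (fun x => x <= a) t -> all (ltn 1) u ->
    [seq x <- t ++ map (addn s) u | x <= a] = t.
  move=> ta u1; rewrite filter_cat (all_filterP ta) filter_map.
  rewrite (@eq_in_filter _ _ pred0) ?filter_pred0 ?cats0 // => x /(allP u1) /= x1.
  by apply/negbTE; lia.
have f2 t u : all (fun x => x <= a) t -> all (ltn 1) u ->
    [seq x <- t ++ map (addn s) u | a < x] = map (addn s) u.
  move=> ta u1; rewrite filter_cat (@eq_in_filter _ _ pred0 t) ?filter_pred0.
    by apply/all_filterP/allP=> _ /mapP[x /(allP u1) /= x1 ->]; lia.
  by move=> x /(allP ta) /= xa; apply/negbTE; lia.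
have ia : all (fun x => x <= a) (iota 1 a) by apply/allP=> x; rewrite mem_iota; lia.
have i1 : all (ltn 1) (iota 2 n'.-1) by apply/allP=> x /=; rewrite mem_iota; lia.
split; first by have := perm_filter (fun x => x <= a) pe; rewrite !f1.
have := perm_filter (fun x => a < x) pe; rewrite !f2 //.
by apply: perm_map_inj; exact: addnI.
Qed.

Lemma lforest_split b L : lforest a eps b L -> exists L1 x L2,
  [/\ L = L1 ++ x :: L2, a \notin letters L1, a \in word x & a \notin letters L2].
Proof.
case/and4P=> _ pL _ _; apply: letters_split; first by rewrite (perm_uniq pL) iota_uniq.
by rewrite (perm_mem pL) mem_iota; lia.
Qed.

Lemma litem_size b x : litem a eps b x -> 1 <= size (word x).
Proof. by case/and3P; case: (word x). Qed.

Lemma wsimple_pcond y F : wsimple G' (y :: F) ->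
  [/\ all (leq 1) (lparts y), sumn (lparts y) = (size (behead (word y))).+1,
      lparts y = lalpha (y :: F) :: behead (lparts y) & 1 <= lalpha (y :: F)].
Proof.
move=> sF; have [[v wy] _ _] := wsimple_first n'0 vG' wfG' sF.
case/andP: sF => /and3P[/= /andP[/and3P[_ /andP[p1 /eqP sp] _] _] _ _] _.
rewrite /lalpha /= p1 sp wy /=.
by case: (lparts y) p1 sp => [|c p]; rewrite wy //= => /andP[].
Qed.

Lemma glue_simple y F L : wsimple G' (y :: F) ->
  lforest a eps (lalpha (y :: F)) L -> wsimple G (glue a L (y :: F)).
Proof.
move=> sF fL; have [[v wy] ry /=] := wsimple_first n'0 vG' wfG' sF.
rewrite wy /= all_cat => /andP[v1 F1].
have [q1 + ey b1] := wsimple_pcond sF; rewrite wy ey /=.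
set b := lalpha _ in fL ey b1 *; set q := behead (lparts y) in ey * => sq.
have [L1 [x [L2 [eL a1 ax a2']]]] := lforest_split fL.
case/and4P: fL => aL pL sL rL; have aL' := aL.
have {}sF := sF; case/andP: sF => /and3P[/= /andP[wy' wF] pF sF] _.
rewrite vG' perm_ivl letters_cons wy /= in pF.
have La : all (fun x => x <= a) (letters L).
  by apply/allP=> u; rewrite (perm_mem pL) mem_iota add1n ltnS => /andP[].
have eg := glue_split y F a1 ax a2'.
rewrite eL letters_cat letters_cons !all_cat in La; case/and3P: La => L1a xa L2a.
rewrite eL all_cat /= in aL; case/and3P: aL => aL1 ix aL2.
rewrite eL eg.
have itemG z : a \notin word z -> all (fun x => x <= a) (word z) -> litem a eps b z -> wtriple G z.
  move=> az za iz; have k1 := litem_size iz; case/and3P: iz; rewrite (negbTE az) pcond1 //.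
  by rewrite -(wvalid_lo eps n'0 a2 vG' wfG' za) => w c r; apply/and3P.
have listG M : a \notin letters M -> all (fun x => x <= a) (letters M) ->
    all (litem a eps b) M -> all (wtriple G) M.
  elim: M => //= z M IHM; rewrite letters_cons mem_cat all_cat.
  by move=> /norP[az aM] /andP[za Ma] /andP[iz iM]; rewrite itemG ?IHM.
have wy1 : wvalid G' (1 :: v) by rewrite -wy; case/and3P: wy'.
have w_ext : wtriple G (ext s x y).
  have k1 := litem_size ix; case/and3P: ix; rewrite ax /wtriple /ext /word /=.
  rewrite -/(word x) -/(word y) wy /= => wx /and3P[p1 /eqP sp lp] r1.
  rewrite (wvalid_mix eps n'0 a2 vG' wfG') // wx wy1 /=; apply/andP; split.
    rewrite /composition_of all_cat p1 sumn_cat sp size_cat size_map.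
    by move: q1 sq; rewrite ey /= => /andP[_ ->] /= sq; apply/eqP; clear -sp sq k1; lia.
  by case: (lparts x) lp r1 => //= b0; clear -b0 b1; lia.
have w_up : all (wtriple G) (map (up s) F).
  apply/allP=> _ /mapP[z zF ->]; case/and3P: (allP wF z zF) => wz cz rz.
  rewrite /wtriple /word /= size_map -/(word z) (wvalid_hi eps n'0 a2 vG') ?wz ?cz //.
  apply/allP=> u uz; apply/ltnW/(allP F1 u); rewrite letters_has.
  by apply/hasP; exists z.
rewrite /wsimple /wforest vert_gsumE perm_ivl all_cat /= listG //= all_cat listG //= w_ext w_up /=.
apply/andP; split; [apply/andP; split|].
- rewrite !(letters_cat, letters_cons) letters_up /word /=.
  rewrite -/(word x) -/(word y) wy /=.
  have /permPl-> : perm_eq (letters L1 ++ (word x ++ map (addn s) v) ++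
      letters L2 ++ map (addn s) (letters F))
      ((letters L1 ++ word x ++ letters L2) ++ map (addn s) (v ++ letters F)).
    by rewrite map_cat -!catA perm_cat2l perm_cat2l perm_catCA.
  rewrite perm_glue ?all_cat ?L1a ?xa ?L2a ?v1 ?F1 //.
  by move: pL; rewrite eL letters_cat letters_cons => ->.
(* Extending a word at its end keeps its first letter, so the first letters are those of L followed
   by the shifted ones of F, which exceed a. *)
- have heads_ext : [seq head 0 (word z) | z <- L1 ++ ext s x y :: L2] =
      [seq head 0 (word z) | z <- L].
    rewrite eL !map_cat /=; congr (_ ++ _ :: _).
    by rewrite {1}/word /= -/(word x); have := litem_size ix; case: (word x).
  rewrite -cat_cons catA map_cat heads_ext.
  have hF z : z \in F -> exists h t, word z = h :: t /\ 1 < h.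
    move=> zF; case/and3P: (allP wF z zF); case ez: (word z) => [//|h t] _ _ _.
    exists h, t; split=> //; apply: (allP F1 h); rewrite letters_has.
    by apply/hasP; exists z; rewrite // ez mem_head.
  have -> : [seq head 0 (word z) | z <- [seq up s z | z <- F]] =
      map (addn s) [seq head 0 (word z) | z <- F].
    rewrite -!map_comp; apply/eq_in_map => z /hF[h [t [ez _]]] /=.
    by rewrite {1}/word /= -/(word z) ez.
  apply: (@cat_sorted_ltn _ _ a) => //.
  + rewrite sorted_map; apply: (sub_sorted (e := ltn)).
      by move=> u u' /=; rewrite ltn_add2l.
    exact: path_sorted sF.
  + apply/allP=> _ /mapP[z zL ->]; case/and3P: (allP aL' z zL).
    case ez: (word z) => [//|h t] _ _ _ /=.
    have : h \in letters L by rewrite letters_has; apply/hasP; exists z; rewrite // ez mem_head.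
    by rewrite (perm_mem pL) mem_iota add1n ltnS => /andP[].
  apply/allP=> _ /mapP[_ /mapP[z /hF[h [t [ez h1]]] ->] ->] /=.
  by rewrite ez /= ltn_up.
by move: rL; rewrite eL; case: (L1).
Qed.

End GlueForest.

Definition cutL (a : nat) (x : ltriple) : ltriple :=
  if a \in word x then
    let w := [seq v <- word x | v <= a] in
    (w, (cutp (size w) (lparts x)).1, lrval x)
  else x.

(** The restricted tree in list form, already relabelled: a becomes 1, and the new first part is
    alpha_1 + ... + alpha_j - k + 1 with k = [size w]. *)
Definition cutR (a : nat) (x : ltriple) : ltriple :=
  let w := [seq v <- word x | v <= a] in
  let c := cutp (size w) (lparts x) in
  (1 :: [seq v - a.-1 | v <- word x & a < v], (sumn c.1 - (size w).-1) :: c.2, 1).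

Definition down (d : nat) (y : ltriple) : ltriple :=
  ([seq v - d | v <- word y], lparts y, lrval y).

(** A tree counts for the left side exactly when its smallest letter is at most a; only the tree
    containing a is divided between the two sides. *)
Definition cut (a : nat) (W : seq ltriple) : seq ltriple * seq ltriple :=
  let lo := [seq x <- W | head 0 (word x) <= a] in
  let x := nth ([::], [::], 0) lo (find (fun x => a \in word x) lo) in
  ([seq cutL a x | x <- lo],
   cutR a x :: [seq down a.-1 z | z <- W & a < head 0 (word z)]).

Section CutForest.

Variables (n' : nat) (G' : graph) (a : nat) (eps : bool).
Hypotheses (n'0 : 1 <= n') (a2 : 2 <= a) (vG' : vert G' = ivl n') (wfG' : wf_graph G').

Let G := gsum (Kgraph a eps) G'.
Local Notation s := (a.-1).

Lemma lforest_le b L x v : lforest a eps b L -> x \in L -> v \in word x -> 1 <= v <= a.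
Proof.
case/and4P=> _ pL _ _ xL vx; have : v \in letters L by rewrite letters_has; apply/hasP; exists x.
by rewrite (perm_mem pL) mem_iota add1n ltnS.
Qed.

Lemma wvalid_head H w : wvalid H w -> head 0 w \in w.
Proof. by case: w => // m t _; rewrite mem_head. Qed.

Lemma litem_valid b L x : lforest a eps b L -> x \in L -> wvalid (Kgraph a eps) (word x).
Proof. by case/and4P=> /allP h _ _ _ /h /and3P[]. Qed.

Lemma cut_glue y F L : wsimple G' (y :: F) ->
  lforest a eps (lalpha (y :: F)) L -> cut a (glue a L (y :: F)) = (L, y :: F).
Proof.
move=> sF fL; have [[v wy] ry] := wsimple_first n'0 vG' wfG' sF.
rewrite wy [behead _]/= all_cat => /andP[v1 F1].
have [q1 sq ey b1] := wsimple_pcond n'0 vG' wfG' sF.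
have {}sF := sF; case/andP: sF => /and3P[/= /andP[_ wF] _ _] _.
have hF z : z \in F -> 1 < head 0 (word z).
  move=> zF; case/and3P: (allP wF z zF) => /wvalid_head hz _ _.
  by apply: (allP F1); rewrite letters_has; apply/hasP; exists z.
have [L1 [x [L2 [eL a1 ax a2']]]] := lforest_split n'0 a2 fL.
have xL : x \in L by rewrite eL mem_cat mem_head orbT.
have hx : head 0 (word (ext s x y)) = head 0 (word x).
  by have := litem_valid fL xL; rewrite {2}/word /= -/(word x); case: (word x).
have hL z : z \in L -> head 0 (word z) <= a.
  by move=> zL; case/andP: (lforest_le fL zL (wvalid_head (litem_valid fL zL))).
have xa : all (fun u => u <= a) (word x).
  by apply/allP=> u ux; case/andP: (lforest_le fL xL ux).
have k1 : 1 <= size (word x) by have := litem_valid fL xL; case: (word x).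
have px : pcond (size (word x)) (lalpha (y :: F)) (lparts x).
  by case/and4P: fL => /allP/(_ x xL) /and3P[_ + _] _ _ _; rewrite ax.
rewrite eL (glue_split y F a1 ax a2') /cut.
have -> : [seq z <- L1 ++ ext s x y :: L2 ++ [seq up s z | z <- F] | head 0 (word z) <= a]
    = L1 ++ ext s x y :: L2.
  rewrite -cat_cons catA filter_cat (@eq_in_filter _ _ pred0 (map _ F)).
    rewrite filter_pred0 cats0; apply/all_filterP/allP => z.
    rewrite mem_cat inE => /or3P[zL|/eqP->|zL]; rewrite ?hx hL // eL mem_cat ?zL //.
    by rewrite inE zL !orbT.
  move=> _ /mapP[z zF ->]; have := hF z zF; rewrite {2}/word /= -/(word z).
  by case: (word z) => //= h t h1; rewrite (leq_up a2) leqNgt h1.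
have -> : [seq z <- L1 ++ ext s x y :: L2 ++ [seq up s z | z <- F] | a < head 0 (word z)]
    = [seq up s z | z <- F].
  rewrite -cat_cons catA filter_cat (@eq_in_filter _ _ pred0 (_ ++ _)).
    rewrite filter_pred0; apply/all_filterP/allP => _ /mapP[z zF ->].
    have := hF z zF; rewrite {2}/word /= -/(word z).
    by case: (word z) => //= h t h1; rewrite (ltn_up a2).
  move=> z; rewrite mem_cat inE => /or3P[zL|/eqP->|zL]; apply/negbTE; rewrite -leqNgt ?hx hL //;
    rewrite eL mem_cat ?zL //.
  by rewrite inE zL !orbT.
have h L0 : a \notin letters L0 -> [seq cutL a z | z <- L0] = L0.
  rewrite letters_has => /hasPn h; rewrite -[RHS]map_id; apply/eq_in_map => z /h.
  by rewrite /cutL => /negbTE->.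
have fx : [seq u <- word (ext s x y) | u <= a] = word x.
  rewrite {1}/word /= filter_cat (all_filterP xa) filter_map wy /=.
  rewrite (@eq_in_filter _ _ pred0) ?filter_pred0 ?cats0 // => u /(allP v1) /= u1.
  by rewrite (leq_up a2) leqNgt u1.
have aex : a \in word (ext s x y) by rewrite mem_cat ax.
have pe : cutp (size (word x)) (lparts (ext s x y)) = (lparts x, behead (lparts y)).
  exact: cutp_cat px.
have -> : nth ([::], [::], 0) (L1 ++ ext s x y :: L2)
    (find (fun x => a \in word x) (L1 ++ ext s x y :: L2)) = ext s x y.
  rewrite find_cat -letters_has (negbTE a1) /= aex addn0.
  by rewrite nth_cat ltnn subnn.
rewrite map_cat /= !h // /cutL aex fx pe /cutR fx pe /=.
have -> : [seq down s z | z <- [seq up s z | z <- F]] = F.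
  rewrite -map_comp -[RHS]map_id; apply/eq_in_map => -[[w p] r] _.
  rewrite /down /up /word /= -map_comp; congr (_, _, _).
  by rewrite -[RHS]map_id; apply/eq_map => u /=; rewrite addKn.
have -> : [seq u - s | u <- word (ext s x y) & a < u] = v.
  rewrite {1}/word /= filter_cat (@eq_in_filter _ _ pred0 (x.1.1)) ?filter_pred0 /=; last first.
    by move=> u /(allP xa) /= ua; rewrite ltnNge ua.
  rewrite wy /= filter_map (@eq_in_filter _ _ predT v).
    rewrite filter_predT -map_comp -[RHS]map_id; apply/eq_map => u /=; exact: addKn.
  by move=> u /(allP v1) /= u1; rewrite (ltn_up a2).
congr (_ ++ _ :: _, _ :: _); first by case: (x) => -[].
transitivity (word y, lparts y, lrval y); last by case: (y) => -[].
by have /and3P[_ /eqP -> _] := px; rewrite wy ry addKn -ey.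
Qed.

(** A letter z < a right after y > a would have y as its nearest larger letter, but no edge joins
    them; and a itself has already been read. *)
Lemma wrec_high p y v : wrec G (rcons p y) v -> a < y -> a \in p -> all (ltn a) v.
Proof.
elim: v p y => //= z v IHv p y /and3P[zp az wv] ya ap.
suff za : a < z by rewrite za (IHv (rcons p y) z) // mem_rcons inE ap orbT.
rewrite ltnNge; apply/negP; rewrite leq_eqVlt => /predU1P[za|za].
  by case/negP: zp; rewrite za mem_rcons inE ap orbT.
have := adj_mid n'0 a2 vG' wfG' az za; rewrite -cats1 par_nearest //; last first.
  exact: ltn_trans ya.
by rewrite leqNgt ya.
Qed.

(** The first letter above a exceeds everything before it, so it is attached to the maximum of that
    prefix, which must be a by [adj_mid]. From then on [wrec_high] forbids letters up to a. *)
Lemma split_word w : wvalid G w -> head 0 w <= a ->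
  exists u v, [/\ w = u ++ map (addn s) v, all (fun x => x <= a) u, all (ltn 1) v &
    v != [::] -> a \in u].
Proof.
case: w => // m t /and3P[_ _ wt] ma.
have [t1 [t2 [et t1a t2a]]] : exists t1 t2, [/\ t = t1 ++ t2, all (fun x => x <= a) t1 &
    if t2 is y :: _ then a < y else true].
  elim: (t) => [|x r [t1 [t2 [-> t1a t2a]]]]; first by exists [::], [::].
  case: (leqP x a) => xa; first by exists (x :: t1), t2; rewrite /= xa.
  by exists [::], (x :: t1 ++ t2).
case: t2 => [|y t2] in et t2a.
  by exists (m :: t1), [::]; rewrite et /= ma.
move: wt; rewrite et wrec_cat /= => /andP[_ /and3P[_ ay wt2]].
have p1 : all (fun x => x <= a) (m :: t1) by rewrite /= ma.
have ap : a \in m :: t1.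
  have pm := @seqmax_mem (m :: t1) isT; have := allP p1 _ pm.
  rewrite leq_eqVlt => /predU1P[<-//|lt].
  move: ay; rewrite par_max => [|]; last first.
    by apply/hasPn=> x /(allP p1) xa; rewrite -leqNgt (leq_trans xa) // ltnW.
  by rewrite adj_sym => /(adj_mid n'0 a2 vG' wfG')/(_ lt); rewrite leqNgt t2a.
have t2h := wrec_high (p := m :: t1) wt2 t2a ap.
exists (m :: t1), (map (subn^~ s) (y :: t2)); split=> //.
  rewrite -map_comp /=; congr (_ :: _ ++ _ :: _); first by clear -t2a; lia.
  rewrite -[LHS]map_id; apply/eq_in_map => x /(allP t2h) /= xa; clear -xa; lia.
rewrite all_map /=; apply/andP; split; first by clear -t2a a2; lia.
by apply/allP=> x /(allP t2h) /= xa; clear -xa a2; lia.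
Qed.

End CutForest.

Lemma sorted_split (T : Type) (f : T -> nat) c (W : seq T) : sorted ltn (map f W) ->
  exists lo hi, [/\ W = lo ++ hi, all (fun x => f x <= c) lo & all (fun x => c < f x) hi].
Proof.
elim: W => [|x W IHW] /= sW; first by exists [::], [::].
case: (leqP (f x) c) => xc.
  have [lo [hi [-> lc ch]]] := IHW (path_sorted sW).
  by exists (x :: lo), hi; rewrite /= xc.
exists [::], (x :: W); split=> //=; rewrite xc /=.
have := order_path_min ltn_trans sW; rewrite all_map; apply: sub_all => y /=.
exact: ltn_trans.
Qed.

Lemma wvalid_ge_head G w v : wvalid G w -> v \in w -> head 0 w <= v.
Proof.
case: w => // m t /and3P[_ mt _]; rewrite inE => /predU1P[->//|/(allP mt)].
exact: ltnW.
Qed.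

Section GlueSurjective.

Variables (n' : nat) (G' : graph) (a : nat) (eps : bool).
Hypotheses (n'0 : 1 <= n') (a2 : 2 <= a) (vG' : vert G' = ivl n') (wfG' : wf_graph G').

Let G := gsum (Kgraph a eps) G'.
Local Notation s := (a.-1).

Lemma litem_low b z : wtriple G z -> head 0 (word z) <= a -> a \notin word z ->
  litem a eps b z.
Proof.
case/and3P=> wz cz rz hz az; have [u [v [ez ua v1 au]]] := split_word n'0 a2 vG' wfG' wz hz.
have v0 : v = [::].
  apply/eqP/negP => /negP/au auu; move: az; by rewrite ez mem_cat auu.
rewrite v0 cats0 in ez; rewrite /litem (negbTE az) ez pcond1 -?ez ?cz ?rz ?andbT.
  by rewrite -(wvalid_lo eps n'0 a2 vG' wfG') // ez.
by move: wz; case: (word z).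
Qed.

Lemma down_high z : wtriple G z -> a < head 0 (word z) ->
  [/\ wtriple G' (down s z), up s (down s z) = z & all (ltn 1) (word (down s z))].
Proof.
case/and3P=> wz cz rz hz; have za u : u \in word z -> a < u.
  by move/(wvalid_ge_head wz); apply: leq_trans hz.
have e : map (addn s) [seq u - s | u <- word z] = word z.
  rewrite -map_comp -[RHS]map_id; apply/eq_in_map => u /za /= au; clear -au; lia.
have d1 : all (ltn 1) [seq u - s | u <- word z].
  by apply/allP=> _ /mapP[u /za au ->] /=; clear -au a2; lia.
split=> //; last by rewrite /up /word /= e; case: (z) => -[].
rewrite /wtriple /word /= size_map cz rz !andbT.
rewrite -(wvalid_hi eps n'0 a2 vG') ?e //.
by apply: sub_all d1 => u; apply: ltnW.
Qed.

Lemma glue_surj W : wsimple G W -> exists y F L,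
  [/\ wsimple G' (y :: F), lforest a eps (lalpha (y :: F)) L & W = glue a L (y :: F)].
Proof.
case/andP=> /and3P[wW pW sW] rW.
rewrite (vert_gsumE eps a2 vG') perm_ivl in pW.
have [lo [hi [eW loa hia]]] := sorted_split a sW.
have uW : uniq (letters W) by rewrite (perm_uniq pW) iota_uniq.
have aW : a \in letters W by rewrite (perm_mem pW) mem_iota; clear -a2 n'0; lia.
move: wW uW aW; rewrite eW all_cat letters_cat cat_uniq mem_cat.
case/andP=> wlo whi /and3P[ulo _ _] alohi.
have alo : a \in letters lo.
  case/orP: alohi => //; rewrite letters_has => /hasP[z zhi az].
  case/and3P: (allP whi z zhi) => wz _ _.
  by have := leq_trans (allP hia z zhi) (wvalid_ge_head wz az); rewrite ltnn.
have [L1 [x [L2 [elo a1 ax a2']]]] := letters_split ulo alo.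
move: wlo loa; rewrite elo !all_cat /= => /and3P[w1 wx w2'] /and3P[h1 hx h2].
case/and3P: (wx) => vx /andP[cx /eqP sx] rx.
have [u [v [ex ua v1 au]]] := split_word n'0 a2 vG' wfG' vx hx.
have {}au : a \in u.
  move: ax; rewrite ex mem_cat => /orP[//|/mapP[z /(allP v1) /= z1 e]].
  by move: z1; rewrite -(ltn_up a2) -e ltnn.
have k1 : 1 <= size u by case: (u) au.
rewrite ex size_cat size_map in sx.
have [|ep ks pp] := @cutpP (size u) (lparts x) _ cx.
  by rewrite k1 sx leq_addr.
set p := (cutp _ _).1 in ep ks pp; set q := (cutp _ _).2 in ep.
(* This counts the positions from the last letter of u to the end of the cut part; the first of them
   is taken over by the vertex a of the restricted tree. *)
set b := sumn p - (size u).-1 in pp.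
have b1 : 1 <= b by rewrite /b; clear -ks k1; lia.
pose y : ltriple := (1 :: v, b :: q, 1); pose x' : ltriple := (u, p, lrval x).
have vmix : wvalid (Kgraph a eps) u && wvalid G' (1 :: v).
  by rewrite -(wvalid_mix eps n'0 a2 vG' wfG') // -ex.
case/andP: vmix => vu v1'.
have ehi : map (up s) (map (down s) hi) = hi.
  rewrite -map_comp -[RHS]map_id; apply/eq_in_map => z zhi /=.
  by case: (down_high (allP whi z zhi) (allP hia z zhi)).
have whi1 : all (ltn 1) (letters (map (down s) hi)).
  apply/allP=> t; rewrite letters_has => /hasP[_ /mapP[z zhi ->] tz].
  by case: (down_high (allP whi z zhi) (allP hia z zhi)) => _ _ /allP; apply.
have item1 M : all (wtriple G) M -> all (fun z => head 0 (word z) <= a) M ->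
    a \notin letters M -> all (litem a eps b) M /\ all (fun t => t <= a) (letters M).
  elim: M => //= z M IHM /andP[wz wM] /andP[hz hM].
  rewrite letters_cons mem_cat all_cat => /norP[az aM].
  have [-> ->] := IHM wM hM aM; rewrite litem_low //=; split=> //.
  case/and3P: wz => wz _ _; have [t [r [et ta _ ar]]] := split_word n'0 a2 vG' wfG' wz hz.
  have r0 : r = [::] by apply/eqP/negP => /negP/ar aur; rewrite et mem_cat aur in az.
  by rewrite et r0 cats0 ta.
have [i1 l1] := item1 L1 w1 h1 a1; have [i2 l2] := item1 L2 w2' h2 a2'.
have pW' : perm_eq (letters L1 ++ u ++ letters L2) (iota 1 a) &&
    perm_eq (1 :: v ++ letters (map (down s) hi)) (iota 1 n').
  rewrite -perm_glue ?all_cat ?l1 ?ua ?l2 ?v1 ?whi1 //.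
  move: pW; rewrite eW -{1}ehi elo !letters_cat letters_cons letters_up ex.
  have /permPl-> // : perm_eq
      ((letters L1 ++ (u ++ map (addn s) v) ++ letters L2) ++
        map (addn s) (letters (map (down s) hi)))
      ((letters L1 ++ u ++ letters L2) ++
        map (addn s) (v ++ letters (map (down s) hi))).
  by rewrite map_cat -!catA perm_cat2l perm_cat2l perm_catCA.
case/andP: pW' => pL pF.
have eh : head 0 u = head 0 (word x) by rewrite ex; case: (u) k1.
have hx' : [seq head 0 (word z) | z <- L1 ++ x' :: L2] = [seq head 0 (word z) | z <- lo].
  by rewrite elo !map_cat /= {1}/word /= eh.
have rx' : head 0 [seq lrval z | z <- L1 ++ x' :: L2] == 1.
  by move: rW; rewrite eW elo; case: (L1).
have ly : lalpha (y :: map (down s) hi) = b by [].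
exists y, (map (down s) hi), (L1 ++ x' :: L2); split.
- rewrite /wsimple /wforest vG' perm_ivl.
  rewrite (_ : letters (y :: _) = 1 :: v ++ letters (map (down s) hi)) // pF /=.
  rewrite andbT; apply/andP; split=> //.
  + apply/andP; split.
      rewrite /wtriple (_ : word y = 1 :: v) // v1' andTb [head _ _]/= b1 andbT.
      move: cx; rewrite -ep all_cat => /andP[_ q1]; rewrite /composition_of /= b1 q1 /=.
      move: sx; rewrite -ep sumn_cat /b; clear -ks k1 => sx; apply/eqP; lia.
    by apply/allP=> _ /mapP[z zhi ->]; case: (down_high (allP whi z zhi) (allP hia z zhi)).
  have e : [seq head 0 (word z) | z <- map (down s) hi] =
      [seq h - s | h <- [seq head 0 (word z) | z <- hi]].
    rewrite -!map_comp; apply/eq_in_map => z /(allP whi)/and3P[wz _ _] /=.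
    by rewrite {1}/word /= -/(word z); case: (word z) wz.
  move: sW; rewrite eW map_cat => /cat_sorted2[_ shi].
  have ha : all (ltn a) [seq head 0 (word z) | z <- hi] by rewrite all_map.
  rewrite {1}/word /= (path_sortedE ltn_trans) e; apply/andP; split.
    by rewrite all_map; apply: sub_all ha => h /= ah; clear -ah a2; lia.
  rewrite sorted_map; apply: (sub_in_sorted _ ha shi) => h h'; rewrite !unfold_in /= => ah ah' hh.
  by clear -ah ah' hh a2; lia.
- rewrite ly; apply/and4P; split=> //; rewrite ?hx' ?rx' //.
  + rewrite all_cat i1 /= i2 andbT /litem /word /= vu au pp /lparts /lrval /=.
    move: rx; rewrite -{1}ep; case/and3P: pp => _ /eqP sp _.
    have : p != [::] by apply: contraTneq ks => ->; rewrite -ltnNge.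
    by case: (p).
  + by rewrite letters_cat letters_cons.
  by move: sW; rewrite eW map_cat => /cat_sorted2[].
rewrite glue_split // ehi -catA; congr (_ ++ _ :: _).
by rewrite /ext /word /lparts /lrval /= ep -ex; case: (x) => -[].
Qed.

End GlueSurjective.

(** * Sign, weight and type of a glued forest *)

Definition nsgn (W : seq ltriple) : nat := \sum_(x <- W) (size (lparts x)).-1.
Definition rsum (W : seq ltriple) : nat := \sum_(x <- W) (lrval x).-1.
Definition allparts (W : seq ltriple) : seq nat := flatten [seq lparts x | x <- W].

Lemma nsgn_cat W1 W2 : nsgn (W1 ++ W2) = nsgn W1 + nsgn W2.
Proof. by rewrite /nsgn big_cat. Qed.
Lemma nsgn_cons x W : nsgn (x :: W) = (size (lparts x)).-1 + nsgn W.
Proof. by rewrite /nsgn big_cons. Qed.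
Lemma rsum_cat W1 W2 : rsum (W1 ++ W2) = rsum W1 + rsum W2.
Proof. by rewrite /rsum big_cat. Qed.
Lemma rsum_cons x W : rsum (x :: W) = (lrval x).-1 + rsum W.
Proof. by rewrite /rsum big_cons. Qed.
Lemma allparts_cat W1 W2 : allparts (W1 ++ W2) = allparts W1 ++ allparts W2.
Proof. by rewrite /allparts map_cat flatten_cat. Qed.
Lemma allparts_cons x W : allparts (x :: W) = lparts x ++ allparts W.
Proof. by []. Qed.

Lemma eq_ginv G1 G2 t : (forall x y, x \in t -> y \in t -> adj G1 x y = adj G2 x y) ->
  ginv G1 t = ginv G2 t.
Proof.
elim: t => //= x t IHt h; rewrite IHt; last first.
  by move=> y z yt zt; apply: h; rewrite inE ?yt ?zt orbT.
congr (_ + _); apply: eq_in_count => y yt; rewrite h ?mem_head //.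
by rewrite inE yt orbT.
Qed.

Section GlueStats.

Variables (n' : nat) (G' : graph) (a : nat) (eps : bool).
Hypotheses (n'0 : 1 <= n') (a2 : 2 <= a) (vG' : vert G' = ivl n') (wfG' : wf_graph G').

Let G := gsum (Kgraph a eps) G'.
Local Notation s := (a.-1).

Lemma ginv_map t : all (leq 1) t -> ginv G (map (addn s) t) = ginv G' t.
Proof.
elim: t => //= x t IHt /andP[x1 t1]; rewrite IHt //; congr (_ + _).
rewrite count_map; apply: eq_in_count => y /(allP t1) y1 /=.
by rewrite ltn_add2l (adj_hi G' eps n'0 a2).
Qed.

(** No edge crosses a. The letter a lies in both filtered words, but as their maximum it is only the
    larger end of inversions in the first, and as their minimum only the smaller end in the
    second. *)
Lemma ginv_split t :
  ginv G t = ginv G [seq x <- t | x <= a] + ginv G [seq x <- t | a <= x].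
Proof.
elim: t => //= x t ->.
have h1 : x <= a -> count (fun y => (y < x) && adj G y x) t =
    count (fun y => (y < x) && adj G y x) [seq y <- t | y <= a].
  move=> xa; rewrite count_filter; apply: eq_count => y /=.
  by case: (ltnP y x) => //= yx; rewrite (ltnW (leq_trans yx xa)) andbT.
have h2 : a < x -> count (fun y => (y < x) && adj G y x) t =
    count (fun y => (y < x) && adj G y x) [seq y <- t | a <= y].
  move=> ax; rewrite count_filter; apply: eq_count => y /=.
  case: (boolP (adj G y x)) => [ayx|]; rewrite ?andbF //= andbT.
  case: (leqP a y) => ay; rewrite ?andbT ?andbF //.
  by have := adj_mid n'0 a2 vG' wfG' ayx ay; rewrite leqNgt ax.
case: (ltngtP x a) => [xa|ax|xa] /=.
- by rewrite (h1 (ltnW xa)) addnA.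
- by rewrite (h2 ax) addnCA.
rewrite (h1 (eq_leq xa)) -addnA; congr (_ + _).
rewrite (@eq_in_count _ _ pred0 [seq y <- t | a <= y]) ?count_pred0 //.
by move=> y; rewrite mem_filter xa => /andP[ay _] /=; rewrite ltnNge ay.
Qed.

(** Merging a part of L with the first part of F removes that first part from the type, hence
    [behead], and makes the number of parts minus one additive over the merged tree. *)
Lemma glue_stats y F L : wsimple G' (y :: F) ->
  lforest a eps (lalpha (y :: F)) L ->
  [/\ nsgn (glue a L (y :: F)) = nsgn L + nsgn (y :: F),
      rsum (glue a L (y :: F)) = rsum L + rsum (y :: F),
      perm_eq (allparts (glue a L (y :: F))) (allparts L ++ behead (allparts (y :: F))),
      lalpha (glue a L (y :: F)) = lalpha L &
      ginv G (letters (glue a L (y :: F))) =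
        ginv (Kgraph a eps) (letters L) + ginv G' (letters (y :: F))].
Proof.
move=> sF fL; have [[v wy] ry] := wsimple_first n'0 vG' wfG' sF.
rewrite wy [behead _]/= all_cat => /andP[v1 F1].
have [q1 sq ey b1] := wsimple_pcond n'0 vG' wfG' sF.
have [L1 [x [L2 [eL a1 ax a2']]]] := lforest_split n'0 a2 fL.
have eg := glue_split y F a1 ax a2'.
have xL : x \in L by rewrite eL mem_cat mem_head orbT.
have px : 0 < size (lparts x).
  case/and4P: fL => /allP/(_ x xL)/and3P[_ _].
  by case: (lparts x) => //=; case: (lrval x).
have La u : u \in letters L -> 1 <= u <= a.
  by case/and4P: fL => _ pL _ _; rewrite (perm_mem pL) mem_iota add1n ltnS.
have uL : uniq (letters L) by case/and4P: fL => _ pL _ _; rewrite (perm_uniq pL) iota_uniq.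
split.
- rewrite eL eg !(nsgn_cat, nsgn_cons) ey size_cat /=.
  have -> : nsgn (map (up s) F) = nsgn F by rewrite /nsgn big_map.
  by clear -px; case: (size (lparts x)) px => // k _; rewrite addSn /=; lia.
- by rewrite eL eg !(rsum_cat, rsum_cons) ry /rsum big_map -!addnA.
- rewrite eL eg !(allparts_cat, allparts_cons) ey /=.
  have -> : allparts (map (up s) F) = allparts F by rewrite /allparts -map_comp.
  by rewrite -!catA perm_cat2l perm_cat2l perm_catCA.
- rewrite eL eg; case: (L1) => //=; rewrite /lalpha /= {1}/lparts /= -/(lparts x).
  by case: (lparts x) px.
have lg : letters (glue a L (y :: F)) = letters L1 ++ (word x ++ map (addn s) v) ++
    letters L2 ++ map (addn s) (letters F).
  by rewrite eL eg !(letters_cat, letters_cons) letters_up {1}/word /= wy.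
have low t : all (ltn 1) t -> [seq u <- map (addn s) t | u <= a] = [::].
  move=> t1; rewrite (@eq_in_filter _ _ pred0) ?filter_pred0 // => _ /mapP[u /(allP t1) /= u1 ->].
  by rewrite (leq_up a2) leqNgt u1.
have high t : all (ltn 1) t -> [seq u <- map (addn s) t | a <= u] = map (addn s) t.
  move=> t1; apply/all_filterP/allP=> _ /mapP[u /(allP t1) /= u1 ->].
  by rewrite ltnW // (ltn_up a2).
have all_low t : {subset t <= letters L} -> [seq u <- t | u <= a] = t.
  by move=> sub; apply/all_filterP/allP=> u /sub/La/andP[].
have no_high t : {subset t <= letters L} -> a \notin t -> [seq u <- t | a <= u] = [::].
  move=> sub at_; rewrite (@eq_in_filter _ _ pred0) ?filter_pred0 // => u ut /=.
  apply/negbTE; rewrite -ltnNge ltn_neqAle; have /andP[_ ->] := La u (sub u ut).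
  by rewrite andbT; apply: contraNneq at_ => <-.
have sub1 : {subset letters L1 <= letters L}.
  by move=> u u1; rewrite eL letters_cat mem_cat u1.
have sub2 : {subset letters L2 <= letters L}.
  by move=> u u1; rewrite eL letters_cat letters_cons !mem_cat u1 !orbT.
have subx : {subset word x <= letters L}.
  by move=> u u1; rewrite eL letters_cat letters_cons !mem_cat u1 !orbT.
(* Among the letters of L only a survives this filter. As a is the image of 1, the upper half of the
   glued word is the shift of [letters (y :: F)]. *)
have xhigh : [seq u <- word x | a <= u] = [:: a].
  have ux : uniq (word x).
    by move: uL; rewrite eL letters_cat letters_cons !cat_uniq => /and3P[_ _ /and3P[]].
  rewrite -(filter_pred1_uniq ux ax); apply: eq_in_filter => u /subx/La/andP[_ ua] /=.
  by rewrite eqn_leq ua.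
rewrite lg ginv_split !filter_cat !low // !high // !all_low // xhigh !no_high //.
rewrite !cats0 -letters_cons -letters_cat -eL; congr (_ + _).
  by apply: eq_ginv => u w /La/andP[_ ua] /La/andP[_ wa]; rewrite (adj_lo eps n'0 a2 vG' wfG').
have FE : letters (y :: F) = 1 :: v ++ letters F by rewrite letters_cons wy.
have F1' : all (leq 1) (1 :: v ++ letters F).
  rewrite /= all_cat; apply/andP.
  by split; [apply: sub_all v1 | apply: sub_all F1] => u; exact: ltnW.
have s1 : s + 1 = a by clear -a2; lia.
by rewrite FE -(ginv_map F1') map_cons map_cat s1.
Qed.

End GlueStats.

(** * Generating functions *)

Section QIdentities.

Import GRing.Theory.
Local Open Scope ring_scope.

Variables (R : comNzRingType) (q : R) (e : nat -> R).

Definition qn (n : nat) : R := \sum_(i < n) q ^+ i.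

Lemma qn0 : qn 0 = 0. Proof. by rewrite /qn big_ord0. Qed.
Lemma qnS n : qn n.+1 = qn n + q ^+ n. Proof. by rewrite /qn big_ord_recr. Qed.

Lemma sum_triangle n (F : nat -> nat -> R) :
  \sum_(i < n) \sum_(j < i.+1) F j i = \sum_(j < n) \sum_(i < n - j) F j (i + j)%N.
Proof.
elim: n => [|n IHn]; first by rewrite !big_ord0.
rewrite big_ord_recr /= {}IHn [in RHS]big_ord_recr /=.
rewrite [X in _ = _ + X](_ : _ = F n n); last by rewrite subSnn big_ord1.
rewrite big_ord_recr /= addrA -big_split /=; congr (_ + _).
apply: eq_bigr => j _; rewrite subSn; last exact: ltnW.
by rewrite big_ord_recr /= subnK // ltnW.
Qed.

Lemma sum_triangle_sym n (F : nat -> nat -> R) :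
  \sum_(i < n) \sum_(j < n - i) F j i = \sum_(j < n) \sum_(i < n - j) F j i.
Proof.
have h (H : nat -> nat -> R) : \sum_(j < n) \sum_(i < n - j) H j i =
    \sum_(i < n) \sum_(j < i.+1) H j (i - j)%N.
  rewrite (sum_triangle n (fun j i => H j (i - j)%N)); apply: eq_bigr => j _.
  by apply: eq_bigr => i _; rewrite addnK.
rewrite h (h (fun i j => F j i)); apply: eq_bigr => i _.
rewrite (reindex_inj rev_ord_inj) /=; apply: eq_bigr => j _.
by congr F; have := ltn_ord j; lia.
Qed.

(* [C m] stands for the signed sum of e_p over the compositions p of m, weighted
   by a function f of the first part; the hypothesis [fE] splits p at its last
   part. *)
Variables (f C : nat -> R).
Hypotheses (f0 : f 0 = 0)
  (fE : forall m, f m * e m = \sum_(s < m) C s.+1 * e (m - s.+1)).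

(* The analogue of [C l.+1] for the compositions of l + b with last part >= b. *)
Definition Dsum (b l : nat) : R :=
  f (l + b)%N * e (l + b)%N - \sum_(s < l) C s.+1 * e (l + b - s.+1)%N.

(** Up to the factor [m-1]!, the signed sum over the forests on m letters of the clique, a being one
    of them; see [Phi] and [sum_forests]. *)
Definition nsum (b m : nat) : R :=
  \sum_(i < m) e i * e (m + b - i.+1)%N * (qn (m + b - i.+1) - qn i).

(** The terms in f(c + b - i) come directly from [Dsum]. Expanding the products f(i) e(i) by [fE]
    gives a double sum in C with coefficients [j] - [c]; [Dsum] gives one with [c] - [i], and these
    add up to the [j] - [i] of [nsum]. *)
Lemma leftsum0 (b c : nat) :
  \sum_(l < c.+1) (qn c - qn (c - l)) * e (c - l)%N * Dsum b l
    + \sum_(l < c) C l.+1 * nsum b (c - l) =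
  \sum_(i < c.+1) e i * e (c + b - i)%N *
    ((qn c - qn i) * f (c + b - i)%N + (qn (c + b - i) - qn c) * f i).
Proof.
rewrite (reindex_inj rev_ord_inj) /=.
under eq_bigr => i _.
  have -> : (c.+1 - i.+1 = c - i)%N by lia.
  have -> : (c - (c - i) = i)%N by have := ltn_ord i; lia.
  have -> : Dsum b (c - i) = f (c + b - i)%N * e (c + b - i)%N -
      \sum_(s < c - i) C s.+1 * e (c + b - i - s.+1)%N.
    by rewrite /Dsum (_ : c - i + b = c + b - i)%N //; have := ltn_ord i; lia.
  rewrite mulrBr; over.
rewrite big_split /= sumrN.
have -> : \sum_(i < c.+1) (qn c - qn i) * e i *
      (\sum_(s < c - i) C s.+1 * e (c + b - i - s.+1)%N) =
    \sum_(s < c) C s.+1 * \sum_(i < c - s) (qn c - qn i) * e i * e (c + b - i - s.+1)%N.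
  rewrite big_ord_recr /= subnn big_ord0 mulr0 addr0.
  under eq_bigr do rewrite mulr_sumr.
  rewrite (sum_triangle_sym c (fun s i => (qn c - qn i) * e i *
    (C s.+1 * e (c + b - i - s.+1)%N))).
  apply: eq_bigr => s _; rewrite mulr_sumr; apply: eq_bigr => i _; ring.
have -> : \sum_(i < c.+1) e i * e (c + b - i)%N *
      ((qn c - qn i) * f (c + b - i)%N + (qn (c + b - i) - qn c) * f i) =
    \sum_(i < c.+1) (qn c - qn i) * e i * (f (c + b - i)%N * e (c + b - i)%N) +
    \sum_(i < c.+1) e (c + b - i)%N * (qn (c + b - i) - qn c) * (f i * e i).
  rewrite -big_split /=; apply: eq_bigr => i _; ring.
rewrite -addrA; congr (_ + _).
have -> : \sum_(i < c.+1) e (c + b - i)%N * (qn (c + b - i) - qn c) * (f i * e i) =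
    \sum_(s < c) C s.+1 * \sum_(i < c - s)
      e i * e (c + b - i - s.+1)%N * (qn (c + b - i - s.+1) - qn c).
  rewrite big_ord_recl f0 mul0r mulr0 add0r.
  under eq_bigr do rewrite lift0 fE mulr_sumr.
  rewrite (sum_triangle c (fun s i => e (c + b - i.+1)%N * (qn (c + b - i.+1) - qn c) *
     (C s.+1 * e (i.+1 - s.+1)%N))).
  apply: eq_bigr => s _; rewrite mulr_sumr; apply: eq_bigr => i _.
  have -> : (c + b - (i + s).+1 = c + b - i - s.+1)%N by lia.
  by rewrite subSS addnK; ring.
rewrite addrC -sumrB; apply: eq_bigr => s _; rewrite -mulrBr; congr (_ * _).
rewrite /nsum -sumrB; apply: eq_bigr => i _.
have -> : (c - s + b - i.+1 = c + b - i - s.+1)%N by have := ltn_ord i; have := ltn_ord s; lia.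
ring.
Qed.

(** The correction for the missing edge: [leftsum] subtracts it with the factor q^(c-1), the cost of
    reading a directly after 1. *)
Lemma leftsum1 (b c : nat) :
  \sum_(l < c.+1) (0 < l)%:R * e (c - l)%N * Dsum b l =
  \sum_(i < c.+1) e i * e (c + b - i)%N * ((i < c)%:R * f (c + b - i)%N - f i).
Proof.
rewrite (reindex_inj rev_ord_inj) /= big_ord_recr /= subnn mul0r mul0r addr0.
under eq_bigr => i _.
  have -> : (c.+1 - i.+1 = c - i)%N by lia.
  have -> : (c - (c - i) = i)%N by have := ltn_ord i; lia.
  have -> : Dsum b (c - i) = f (c + b - i)%N * e (c + b - i)%N -
      \sum_(s < c - i) C s.+1 * e (c + b - i - s.+1)%N.
    by rewrite /Dsum (_ : c - i + b = c + b - i)%N //; have := ltn_ord i; lia.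
  rewrite subn_gt0 ltn_ord mul1r mulrBr; over.
rewrite sumrB.
under [X in _ - X]eq_bigr do rewrite mulr_sumr.
rewrite (sum_triangle_sym c (fun s i => e i * (C s.+1 * e (c + b - i - s.+1)%N))).
have -> : \sum_(j < c) \sum_(i < c - j) e i * (C j.+1 * e (c + b - i - j.+1)%N) =
    \sum_(i < c.+1) e (c + b - i)%N * (f i * e i).
  rewrite big_ord_recl f0 mul0r mulr0 add0r.
  under [RHS]eq_bigr do rewrite lift0 fE mulr_sumr.
  rewrite (sum_triangle c (fun s i => e (c + b - i.+1)%N * (C s.+1 * e (i.+1 - s.+1)%N))).
  apply: eq_bigr => s _; apply: eq_bigr => i _.
  have -> : (c + b - (i + s).+1 = c + b - i - s.+1)%N by lia.
  by rewrite subSS addnK; ring.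
have -> : \sum_(i < c) e i * (f (c + b - i)%N * e (c + b - i)%N) =
    \sum_(i < c.+1) e i * e (c + b - i)%N * ((i < c)%:R * f (c + b - i)%N).
  rewrite big_ord_recr /= ltnn mul0r mulr0 addr0; apply: eq_bigr => i _.
  by rewrite ltn_ord mul1r; ring.
by rewrite -sumrB; apply: eq_bigr => i _; ring.
Qed.

Lemma leftsum (eps : bool) (b c : nat) : (0 < c)%N ->
  \sum_(l < c.+1) (qn c - qn (c - l) - (eps && (0 < l)%N)%:R * q ^+ c.-1)
      * e (c - l)%N * Dsum b l
    + \sum_(l < c) C l.+1 * nsum b (c - l) =
  \sum_(i < c.+1) e i * e (c + b - i)%N *
    ((qn c - qn i - (eps && (i < c)%N)%:R * q ^+ c.-1) * f (c + b - i)%N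
     + (qn (c + b - i) - qn (c - eps)) * f i).
Proof.
case: c => // c _; rewrite [c.+1.-1]/=.
transitivity (\sum_(l < c.+2) (qn c.+1 - qn (c.+1 - l)) * e (c.+1 - l)%N * Dsum b l
    + \sum_(l < c.+1) C l.+1 * nsum b (c.+1 - l)
    - eps%:R * q ^+ c * \sum_(l < c.+2) (0 < l)%:R * e (c.+1 - l)%N * Dsum b l).
  rewrite addrAC mulr_sumr -sumrB; congr (_ + _); apply: eq_bigr => l _.
  by rewrite -mulnb natrM; ring.
rewrite leftsum0 leftsum1 mulr_sumr -sumrB; apply: eq_bigr => i _.
have -> : qn (c.+1 - eps) = qn c.+1 - eps%:R * q ^+ c.
  by case: eps; rewrite ?subn1 ?subn0 /= ?qnS ?mul1r ?addrK ?mul0r ?subr0.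
by rewrite -mulnb natrM; ring.
Qed.

(* The terms omitted on the right cancel under i <-> c + b - i. *)
Lemma goodsum (eps : bool) (b c : nat) : (0 < c)%N ->
  \sum_(i < c.+1) e i * e (c + b - i)%N *
    ((qn c - qn i - (eps && (i < c)%N)%:R * q ^+ c.-1) * f (c + b - i)%N
     + (qn (c + b - i) - qn (c - eps)) * f i) =
  \sum_(i < c.+1) e i * e (c + b - i)%N *
    ((i < b)%:R * (qn c - qn i - (eps && (i < c)%N)%:R * q ^+ c.-1) * f (c + b - i)%N
     + (c - eps <= c + b - i)%:R * (qn (c + b - i) - qn (c - eps)) * f i).
Proof.
move=> c0; apply/eqP; rewrite -subr_eq0 -sumrB; apply/eqP.
pose h i j := e i * e j * f j * (qn (c - eps) - qn i).
(* For eps = 1 the first coefficient is [c-1] - [i] when i < c and 0 when i = c, which explains the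
   bound c + 1 - eps. The second range may start at i = b + eps, where [c+b-i] = [c-eps] makes the
   term vanish. *)
transitivity (\sum_(b <= i < c.+1 - eps) h i (c + b - i)%N
              - \sum_(b + eps <= i < c.+1) h (c + b - i)%N i).
  have ind m n (F : nat -> R) : (n <= c.+1)%N ->
      \sum_(m <= i < n) F i = \sum_(i < c.+1) ((m <= i) && (i < n))%N%:R * F i.
    move=> nc; rewrite big_geq_mkord (big_ord_widen_cond _ _ _ nc) big_mkcond /=.
    by apply: eq_bigr => i _; case: ifP; rewrite ?mul1r ?mul0r.
  rewrite !ind ?leq_subr // -sumrB; apply: eq_bigr => i _.
  have ic : (i <= c)%N by rewrite -ltnS.
  have A1 : (i < b)%:R * (qn c - qn i - (eps && (i < c)%N)%:R * q ^+ c.-1) =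
      (qn c - qn i - (eps && (i < c)%N)%:R * q ^+ c.-1)
        - ((b <= i) && (i < c.+1 - eps))%N%:R * (qn (c - eps) - qn i).
    case: (leqP b i) => bi; last by rewrite mul1r mul0r subr0.
    rewrite mul0r /=; case: (eps) => /=; last first.
      by rewrite !subn0 ltnS ic mul1r !mul0r subr0 subrr.
    have qc : qn c = qn c.-1 + q ^+ c.-1 by rewrite -qnS prednK.
    rewrite !subn1 /=; case: (ltngtP i c) ic => // [_|->] _; first by rewrite !mul1r qc; ring.
    by rewrite !mul0r; ring.
  have A2 : (c - eps <= c + b - i)%:R * (qn (c + b - i) - qn (c - eps)) =
      (qn (c + b - i) - qn (c - eps))
        + ((b + eps <= i) && (i < c.+1))%N%:R * (qn (c - eps) - qn (c + b - i)).
    rewrite ltn_ord andbT.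
    have -> : (c - eps <= c + b - i)%N = (i <= b + eps)%N by lia.
    have [ib|ib|ib] := ltngtP i (b + eps)%N.
    - by rewrite mul1r mul0r addr0.
    - by rewrite mul0r mul1r; ring.
    have -> : (c + b - i = c - eps)%N by rewrite ib; lia.
    by rewrite !subrr !mulr0 addr0.
  by rewrite A1 A2 /h; ring.
rewrite big_addn [X in X - _]big_nat_rev /= !big_nat -sumrB big1 // => i /andP[bi ic].
have -> : (b + (c.+1 - eps) - i.+1 = c + b - (i + eps))%N by lia.
have -> : (c + b - (c + b - (i + eps)) = i + eps)%N by lia.
exact: subrr.
Qed.

End QIdentities.

(** Lists the p with [pcond k b p] by their last part: s is the sum of the other parts, at most k -
    1 because the last part is at least b, and those parts form an ordinary composition of s. The
    argument n is fuel for the recursion on s. *)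
Fixpoint compsn (n k b : nat) : seq (seq nat) :=
  if n is n'.+1 then
    [:: k.-1 + b] ::
      [seq rcons p (k.-1 + b - s) | s <- iota 1 k.-1, p <- compsn n' s 1]
  else [::].

Lemma compsn_fuel n m k b : 0 < k -> k <= n -> k <= m -> compsn n k b = compsn m k b.
Proof.
elim: n m k b => [|n IHn] [|m] [|k] b // _ kn km /=; congr (_ :: _).
congr flatten; apply/eq_in_map => s; rewrite mem_iota => /andP[s1 sk].
by rewrite (IHn m) //; lia.
Qed.

Definition comps (k b : nat) : seq (seq nat) := compsn k k b.
Arguments comps : simpl never.

Lemma comps_rec k b : comps k.+1 b =
  [:: k + b] :: [seq rcons p (k + b - s) | s <- iota 1 k, p <- comps s 1].
Proof.
rewrite /comps /=; congr (_ :: flatten _); apply/eq_in_map => s.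
by rewrite mem_iota => /andP[s1 sk]; rewrite (@compsn_fuel k s) //; lia.
Qed.

Lemma sumn_rcons p c : sumn (rcons p c) = sumn p + c.
Proof. by rewrite -cats1 sumn_cat /= addn0. Qed.

Lemma mem_comps k b p : 0 < k -> 0 < b -> (p \in comps k b) = pcond k b p.
Proof.
elim/ltn_ind: k b p => -[//|k] IHk b p _ b0; rewrite comps_rec inE.
apply/predU1P/and3P => [[->|/allpairsPdep[s [p' [sk p'k ->]]]]|[p1 /eqP sp lp]].
- by split; rewrite /= ?andbT ?addn_gt0 ?b0 ?orbT ?addn0 ?leq_addl.
- move: sk; rewrite mem_iota => /andP[s1 sk].
  move: p'k; rewrite IHk // => /and3P[p1 /eqP sp' _].
  split; rewrite ?all_rcons ?p1 ?last_rcons ?sumn_rcons ?sp' ?andbT.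
  + by lia.
  + by apply/eqP => /=; lia.
  by lia.
case/lastP: p => [|p c] in p1 sp lp *; first by move: lp; rewrite leqNgt b0.
move: p1 sp lp; rewrite all_rcons last_rcons sumn_rcons /= => /andP[c1 p1] sp lp.
have [ep|p0] := eqVneq p [::].
  by left; rewrite ep /= in sp *; congr [:: _]; lia.
have sp0 : 0 < sumn p.
  by case: (p) p0 p1 => //= x r _ /andP[x1 _]; rewrite addn_gt0 x1.
right; apply/allpairsPdep; exists (sumn p), p; split.
- by rewrite mem_iota; lia.
- rewrite IHk //; last by lia.
  apply/and3P; split; rewrite ?p1 //; first by apply/eqP; lia.
  by case/lastP: (p) p0 p1 => // r x _; rewrite all_rcons last_rcons => /andP[].
by congr rcons; lia.
Qed.

Lemma comps_uniq k b : 0 < k -> 0 < b -> uniq (comps k b).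
Proof.
elim/ltn_ind: k b => -[//|k] IHk b _ b0; rewrite comps_rec /=; apply/andP; split.
  apply/allpairsPdep => -[s [p [sk pk]]]; move: sk; rewrite mem_iota => /andP[s1 sk].
  by move: pk; rewrite mem_comps // => /and3P[_ /eqP]; case: p => [|x []] //=; lia.
apply: allpairs_uniq_dep; first exact: iota_uniq.
  by move=> s; rewrite mem_iota => /andP[s1 sk]; apply: IHk.
move=> _ _ /allpairsPdep[s [p [sk pk ->]]] /allpairsPdep[s' [p' [sk' pk' ->]]] /=.
move=> /rcons_inj[pp' _]; rewrite pp' in pk *.
move: sk sk' pk pk'; rewrite !mem_iota => /andP[s1 _] /andP[s1' _].
rewrite !mem_comps // => /and3P[_ /eqP e _] /and3P[_ /eqP e' _].
by have -> : s = s' by lia.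
Qed.

Fixpoint arr (l : nat) (S : seq nat) : seq (seq nat) :=
  if l is l'.+1 then [seq x :: u | x <- S, u <- arr l' (rem x S)] else [:: [::]].

Lemma mem_arr l S u : uniq S ->
  (u \in arr l S) = [&& size u == l, uniq u & all (mem S) u].
Proof.
elim: l S u => [|l IHl] S u uS /=; first by case: u.
apply/allpairsPdep/and3P => [[x [v [xS vS ->]]]|].
  move: vS; rewrite IHl ?rem_uniq // => /and3P[sv uv /allP vS].
  split; rewrite //= ?uv ?andbT ?xS /=.
    by apply/negP=> /vS /=; rewrite mem_rem_uniq // !inE eqxx.
  by apply/allP=> y /vS /=; rewrite mem_rem_uniq // inE => /andP[].
case=> + + +; case: u => //= x v sv /andP[xv uv] /andP[xS vS]; exists x, v; split=> //.
rewrite IHl ?rem_uniq // -eqSS sv uv /=; apply/allP=> y yv /=.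
have yS : y \in S by exact: (allP vS y yv).
by rewrite mem_rem_uniq // !inE yS andbT; apply: contraNneq xv => <-.
Qed.

Lemma arr_uniq l S : uniq S -> uniq (arr l S).
Proof.
elim: l S => //= l IHl S uS; apply: allpairs_uniq_dep => //.
  by move=> x _; apply: IHl; rewrite rem_uniq.
by move=> _ _ /allpairsPdep[x [u [_ _ ->]]] /allpairsPdep[y [v [_ _ ->]]] /= [-> ->].
Qed.

(* The number of pairs x > y with x in u and y in S following x in a word that
   starts with u and whose letters are those of S. *)
Fixpoint cost (u S : seq nat) : nat :=
  if u is x :: u' then count (fun y => y < x) S + cost u' (rem x S) else 0.

Fixpoint pinv (s : seq nat) : nat :=
  if s is x :: s' then count (fun y => y < x) s' + pinv s' else 0.

Lemma pinv_cat u v S : perm_eq (u ++ v) S -> pinv (u ++ v) = cost u S + pinv v.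
Proof.
elim: u S => //= x u IHu S pS; rewrite (IHu (rem x S)); last first.
  have xS : x \in S by rewrite -(perm_mem pS) mem_head.
  by rewrite -(perm_cons x); apply: perm_trans pS (perm_to_rem xS).
rewrite addnA -(permP pS) /= ltnn add0n //.
Qed.

(** * q-counting of arrangements and signed sums over compositions *)

Section ArrSums.

Import GRing.Theory.
Local Open Scope ring_scope.

Variables (R : comNzRingType) (q : R) (e : nat -> R).
Hypothesis e0 : e 0 = 1.

Local Notation qn := (qn q).

(** The q-falling factorial [n][n-1]...[n-l+1], which q-counts the words of l distinct letters out
    of n ([arr_sum]). *)
Fixpoint qfall (n l : nat) : R :=
  if l is l'.+1 then qn n * qfall n.-1 l' else 1.

Definition qfact (n : nat) : R := qfall n n.

Lemma qfactS n : qfact n.+1 = qn n.+1 * qfact n. Proof. by []. Qed.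

Lemma qfall_fact n l : (l <= n)%N -> qfall n l * qfact (n - l) = qfact n.
Proof.
elim: l n => [|l IHl] [|n] //= ln; rewrite ?subn0 ?mul1r //.
by rewrite subSS -mulrA IHl.
Qed.

Lemma qfall_gt n l : (n < l)%N -> qfall n l = 0.
Proof. by elim: l n => //= l IHl [|n] ln; rewrite ?qn0 ?mul0r // IHl ?mulr0. Qed.

Lemma rem_rcons_last (S : seq nat) x : x \notin S -> rem x (rcons S x) = S.
Proof.
elim: S => [|y S IHS] /=; first by rewrite eqxx.
by rewrite inE eq_sym => /norP[/negbTE-> /IHS->].
Qed.

Lemma sorted_rcons (S : seq nat) x : sorted ltn (rcons S x) ->
  [/\ sorted ltn S, all (fun y => y < x)%N S & x \notin S].
Proof.
rewrite -cats1 => h; have [hS _] := cat_sorted2 h; split=> //; last first.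
  by have := sorted_uniq ltn_trans ltnn h; rewrite cats1 rcons_uniq => /andP[].
move: h; rewrite (sorted_pairwise ltn_trans) pairwise_cat => /and3P[+ _ _].
by rewrite allrel1r.
Qed.

Lemma sum_count (S : seq nat) : sorted ltn S ->
  \sum_(x <- S) q ^+ count (fun y => y < x)%N S = qn (size S).
Proof.
elim/last_ind: S => [|S x IHS]; first by rewrite big_nil qn0.
move=> /sorted_rcons[sS Sx _]; rewrite -cats1 big_cat big_seq1 size_cat /= addn1 qnS.
rewrite -(IHS sS); congr (_ + q ^+ _); last first.
  by rewrite count_cat /= ltnn !addn0; apply/eqP; rewrite -all_count.
apply: eq_big_seq => y yS; rewrite count_cat /= !addn0.
by rewrite [(x < y)%N]ltnNge (ltnW (allP Sx y yS)) addn0.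
Qed.

Lemma sorted_rem (S : seq nat) x : sorted ltn S -> sorted ltn (rem x S).
Proof. by move=> sS; apply: (subseq_sorted ltn_trans (rem_subseq x S)). Qed.

Lemma arr_sum l (S : seq nat) : sorted ltn S ->
  \sum_(u <- arr l S) q ^+ cost u S = qfall (size S) l.
Proof.
elim: l S => [|l IHl] S sS /=; first by rewrite big_seq1.
rewrite big_allpairs_dep /= -(sum_count sS) mulr_suml; apply: eq_big_seq => x xS.
under eq_bigr do rewrite /= exprD.
by rewrite -mulr_sumr IHl ?sorted_rem // size_rem.
Qed.

(** As a is the largest letter, it adds nothing to the cost of a word that misses it; such words are
    counted as on S without a, and the words using a are the complement. *)
Lemma arr_sum_in (a l : nat) (S : seq nat) (h : bool -> R) :
  sorted ltn S -> a \in S -> all (fun x => x <= a)%N S ->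
  \sum_(u <- arr l S) q ^+ cost u S * h (a \in u) =
    h false * qfall (size S).-1 l + h true * (qfall (size S) l - qfall (size S).-1 l).
Proof.
elim: l S => [|l IHl] S sS aS Sa /=.
  by rewrite big_seq1 /= !mul1r mulr1 subrr mulr0 addr0.
case/lastP: S => // S x in sS aS Sa *; have [sS' Sx xS] := sorted_rcons sS.
have xa : x = a.
  apply/eqP; rewrite eqn_leq; move: Sa; rewrite all_rcons => /andP[-> _] /=.
  by move: aS; rewrite mem_rcons inE => /predU1P[->//|/(allP Sx)/ltnW].
rewrite {x}xa in sS aS Sa Sx xS *.
rewrite big_allpairs_dep -[X in \sum_(x <- X) _]cats1 big_cat big_seq1 /= size_rcons /=.
have -> : count (fun y => y < a)%N (rcons S a) = size S.
  by rewrite -cats1 count_cat /= ltnn !addn0; apply/eqP; rewrite -all_count.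
have -> : \sum_(u <- arr l (rem a (rcons S a)))
      q ^+ (size S + cost u (rem a (rcons S a))) * h (a \in a :: u) =
    q ^+ size S * (h true * qfall (size S) l).
  rewrite rem_rcons_last //; under eq_bigr do rewrite mem_head exprD -mulrA.
  by rewrite -mulr_sumr -mulr_suml arr_sum // [h _ * _]mulrC.
have -> : \sum_(x <- S) \sum_(u <- arr l (rem x (rcons S a)))
      q ^+ (count (fun y => y < x)%N (rcons S a) + cost u (rem x (rcons S a))) *
        h (a \in x :: u) =
    \sum_(x <- S) q ^+ count (fun y => y < x)%N S *
      (h false * qfall (size S).-1 l + h true * (qfall (size S) l - qfall (size S).-1 l)).
  apply: eq_big_seq => x xS'; have xa : (x < a)%N := allP Sx x xS'.
  have -> : count (fun y => y < x)%N (rcons S a) = count (fun y => y < x)%N S.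
    by rewrite -cats1 count_cat /= [(a < x)%N]ltnNge (ltnW xa) !addn0.
  have srem : size (rem x (rcons S a)) = size S.
    by rewrite size_rem ?size_rcons // mem_rcons inE xS' orbT.
  have := IHl (rem x (rcons S a)); rewrite srem => <-.
  - rewrite mulr_sumr; apply: eq_bigr => u _.
    by rewrite exprD -mulrA in_cons [a == x]eq_sym (ltn_eqF xa).
  - exact: sorted_rem.
  - rewrite mem_rem_uniq ?(sorted_uniq ltn_trans ltnn sS) // !inE mem_rcons mem_head andbT.
    by rewrite eq_sym (ltn_eqF xa).
  by apply/allP=> y /mem_rem/(allP Sa).
rewrite -mulr_suml sum_count // qnS.
by ring.
Qed.

(** A leading a exceeds the other letters and costs |S| - 1. The empty word is excluded because
    [head 0] then gives 0 and 0 < a, whence the factor (0 < l). *)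
Lemma arr_sum_head (a l : nat) (S : seq nat) (h : bool -> R) :
  sorted ltn S -> a \in S -> all (fun x => x <= a)%N S -> (0 < a)%N ->
  \sum_(u <- arr l S | head 0 u == a) q ^+ cost u S * h (a \in u) =
    (0 < l)%N%:R * h true * q ^+ (size S).-1 * qfall (size S).-1 l.-1.
Proof.
case: l => [|l] sS aS Sa a0 /=.
  by rewrite big_cons big_nil /= [(0 == a)%N]eq_sym gtn_eqF // !mul0r.
case/lastP: S => // S x in sS aS Sa *; have [sS' Sx xS] := sorted_rcons sS.
have xa : x = a.
  apply/eqP; rewrite eqn_leq; move: Sa; rewrite all_rcons => /andP[-> _] /=.
  by move: aS; rewrite mem_rcons inE => /predU1P[->//|/(allP Sx)/ltnW].
rewrite {x}xa in sS aS Sa Sx xS *.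
rewrite big_mkcond big_allpairs_dep -[X in \sum_(x <- X) _]cats1 big_cat big_seq1 /= size_rcons /=.
rewrite big_seq big1 => [|x xS']; last first.
  by rewrite big1 // => u _; rewrite ltn_eqF // (allP Sx).
have -> : count (fun y => y < a)%N (rcons S a) = size S.
  by rewrite -cats1 count_cat /= ltnn !addn0; apply/eqP; rewrite -all_count.
rewrite add0r rem_rcons_last // eqxx.
under eq_bigr do rewrite mem_head exprD -mulrA.
by rewrite -mulr_sumr -mulr_suml arr_sum //; ring.
Qed.

Definition cweight (f : nat -> R) (p : seq nat) : R :=
  (-1) ^+ (size p).-1 * f (head 0%N p) * \prod_(c <- p) e c.

Definition csum (f : nat -> R) (k : nat) : R := \sum_(p <- comps k 1) cweight f p.

(** Removing the last part of a p with at least two parts flips the sign, takes out one factor e and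
    keeps the first part; what remains is an ordinary composition. *)
Lemma sum_comps (f : nat -> R) b l :
  \sum_(p <- comps l.+1 b) cweight f p = Dsum e f (csum f) b l.
Proof.
rewrite comps_rec big_cons /Dsum; congr (_ + _).
  by rewrite /cweight /= big_seq1 expr0 mul1r.
rewrite big_allpairs_dep -sumrN -(big_mkord xpredT (fun s => - (csum f s.+1 * e (l + b - s.+1)%N))).
rewrite -(big_add1 _ _ 0 l.+1 xpredT (fun s => - (csum f s * e (l + b - s)%N))).
rewrite /index_iota subn1 /=; apply: eq_big_seq => s; rewrite mem_iota => /andP[s1 sl].
rewrite /csum mulr_suml -sumrN; apply: eq_big_seq => p.
rewrite mem_comps // => /and3P[_ /eqP sp _].
have p0 : p != [::] by apply: contraTneq s1 => p0; rewrite p0 /= in sp; lia.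
rewrite /cweight size_rcons /= -cats1 big_cat big_seq1 /=.
by case: (p) p0 => //= x r _; rewrite exprS; ring.
Qed.

(** The case b = 1 of [sum_comps], its left-hand side becoming the last summand by means of e(0) =
    1. It supplies the hypothesis [fE] of the q-identities. *)
Lemma csumE (f : nat -> R) m : f 0%N = 0 ->
  f m * e m = \sum_(s < m) csum f s.+1 * e (m - s.+1)%N.
Proof.
case: m => [|m] f0; first by rewrite big_ord0 f0 mul0r.
rewrite big_ord_recr /= subnn e0 mulr1 {2}/csum sum_comps /Dsum addn1.
by rewrite addrC subrK.
Qed.

End ArrSums.

Definition arrs (S : seq nat) : seq (seq nat) :=
  [seq u | l <- iota 0 (size S).+1, u <- arr l S].

Lemma mem_arrs S u : uniq S -> (u \in arrs S) = uniq u && all (mem S) u.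
Proof.
move=> uS; apply/allpairsPdep/andP => [[l [v [_ + ->]]]|[uu uSu]].
  by rewrite mem_arr // => /and3P[_ -> ->].
exists (size u), u; rewrite mem_arr // eqxx uu uSu; split=> //.
by rewrite mem_iota /= ltnS uniq_leq_size // => x /(allP uSu).
Qed.

Lemma arrs_uniq S : uniq S -> uniq (arrs S).
Proof.
move=> uS; apply: allpairs_uniq_dep; first exact: iota_uniq.
  by move=> l _; apply: arr_uniq.
move=> _ _ /allpairsPdep[l [u [_ ul ->]]] /allpairsPdep[l' [u' [_ ul' ->]]] /= e.
rewrite e !mem_arr // in ul ul' *.
by move: ul ul' => /and3P[/eqP <- _ _] /and3P[/eqP <- _ _].
Qed.

Lemma filter_notin_cons m S (u : seq nat) : m \notin S ->
  [seq v <- S | v \notin m :: u] = [seq v <- S | v \notin u].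
Proof.
by move=> mS; apply: eq_in_filter => v vS; rewrite inE negb_or (contraNneq _ mS) // => <-.
Qed.

Lemma arrs_perm m S u t : uniq (m :: S) -> u \in arrs S ->
  perm_eq t [seq v <- S | v \notin m :: u] -> perm_eq (u ++ t) S.
Proof.
move=> /andP[mS uS]; rewrite mem_arrs // filter_notin_cons // => /andP[uu uSu] pt.
have pu : perm_eq u [seq v <- S | v \in u].
  apply: uniq_perm; rewrite ?filter_uniq // => v; rewrite mem_filter.
  by apply/idP/andP => [vu|[]//]; split=> //; apply: (allP uSu).
apply: perm_trans (permEl (perm_filterC (mem u) S)).
by apply: perm_cat pt.
Qed.

(** * Explicit enumeration of the forests on a set of letters *)

Section Enumeration.

Variables (a b : nat).
Hypothesis b0 : 0 < b.

(** On the complete graph every word of distinct letters that starts with its smallest letter is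
    valid ([wvalid_K]), so no graph appears in the condition. *)
Definition sitem (x : ltriple) : bool :=
  [&& if word x is m :: u then all (ltn m) u else false,
      pcond (size (word x)) (if a \in word x then b else 1) (lparts x) &
      1 <= lrval x <= head 0 (lparts x)].

Definition sforest (S : seq nat) (L : seq ltriple) : bool :=
  [&& all sitem L, perm_eq (letters L) S & sorted ltn [seq head 0 (word x) | x <- L]].

(** The function [rs] gives the values of r allowed for a first part c: all of 1, ..., c in general,
    but only 1 for the first tree of a simple forest. *)
Definition items (rs : nat -> seq nat) (m : nat) (us : seq (seq nat)) : seq ltriple :=
  [seq x | u <- us,
    x <- [seq (m :: u, p, r) | p <- comps (size u).+1 (if a \in m :: u then b else 1),
                               r <- rs (head 0 p)]].

Lemma mem_items (rs : nat -> seq nat) m (us : seq (seq nat)) x : reflect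
  [/\ exists2 u, u \in us & word x = m :: u,
      pcond (size (word x)) (if a \in word x then b else 1) (lparts x) &
      lrval x \in rs (head 0 (lparts x))]
  (x \in items rs m us).
Proof.
have bb (w : seq nat) : 0 < (if a \in w then b else 1) by case: ifP.
apply: (iffP allpairsPdep) => [[u [_ [uu /allpairsPdep[p [r [pc rr ->]]] ->]]]|].
  by split=> //; [exists u | move: pc; rewrite mem_comps].
case: x => [[w p] r] [[u uu ew] pc rr]; change (w = m :: u) in ew.
exists u, (w, p, r); split=> //; apply/allpairsPdep; exists p, r.
by rewrite mem_comps // -[(size u).+1]/(size (m :: u)) -ew.
Qed.

Lemma items_uniq (rs : nat -> seq nat) m (us : seq (seq nat)) :
  uniq us -> (forall c, uniq (rs c)) -> uniq (items rs m us).
Proof.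
move=> uu ur; apply: allpairs_uniq_dep => // [u _|].
  apply: allpairs_uniq_dep => [|//|]; first by apply: comps_uniq => //; case: ifP.
  by move=> _ _ /allpairsPdep[? [? [_ _ ->]]] /allpairsPdep[? [? [_ _ ->]]] /= [-> ->].
move=> _ _ /allpairsPdep[u [x [_ xu ->]]] /allpairsPdep[u' [x' [_ xu' ->]]] /= e.
move: xu xu'; rewrite e => /allpairsPdep[? [? [_ _ ->]]] /allpairsPdep[? [? [_ _ []]]].
by move=> ->.
Qed.

(** The first tree must start with the smallest letter m. The argument n is fuel, sufficient once it
    reaches the number of letters. *)
Fixpoint forests (n : nat) (S : seq nat) : seq (seq ltriple) :=
  if S is m :: S' then
    if n is n'.+1 then
      [seq x :: L | x <- items (iota 1) m (arrs S'),
                    L <- forests n' [seq v <- S' | v \notin word x]]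
    else [::]
  else [:: [::]].

Lemma sitem_head x v : sitem x -> v \in word x -> head 0 (word x) <= v.
Proof.
case/and3P; case: (word x) => // m u mu _ _; rewrite inE => /predU1P[->//|].
by move/(allP mu)/ltnW.
Qed.

Lemma sforest_cons m S x L : sorted ltn (m :: S) ->
  sforest (m :: S) (x :: L) =
    (x \in items (iota 1) m (arrs S)) && sforest [seq v <- S | v \notin word x] L.
Proof.
move=> smS; have uS : uniq (m :: S) := sorted_uniq ltn_trans ltnn smS.
have mS : all (ltn m) S := order_path_min ltn_trans smS.
have /andP[mS' uS'] := uS.
apply/idP/andP => [/and3P[/= /andP[ix iL] pL sL]|[/mem_items[[u + ew] px rx] /and3P[iL pL sL]]].
  case/and3P: (ix); case ew: (word x) => [//|h u] hu px rx.
  have mh : m = h.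
    have hmS : h \in m :: S by rewrite -(perm_mem pL) letters_cons ew mem_head.
    have mL : m \in letters (x :: L) by rewrite (perm_mem pL) mem_head.
    apply/eqP; rewrite eqn_leq; apply/andP; split.
      by move: hmS; rewrite inE => /predU1P[->//|/(allP mS)/ltnW].
    move: mL; rewrite letters_cons mem_cat => /orP[/(sitem_head ix)|]; first by rewrite ew.
    rewrite letters_has => /hasP[z zL mz].
    have hz : h < head 0 (word z).
      move: sL; rewrite ew /= => /(order_path_min ltn_trans)/allP; apply.
      exact: (map_f (fun x => head 0 (word x))).
    by apply: leq_trans (ltnW hz) (sitem_head (allP iL z zL) mz).
  rewrite -mh in ew hu px *; rewrite letters_cons ew /= perm_cons in pL.
  have : uniq (u ++ letters L) by rewrite (perm_uniq pL).
  rewrite cat_uniq => /and3P[uu /hasPn uL _].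
  have uSu : all (mem S) u by apply/allP=> v vu /=; rewrite -(perm_mem pL) mem_cat vu.
  split.
    apply/mem_items; split; rewrite ?ew //; last by rewrite mem_iota add1n ltnS.
    by exists u; rewrite // mem_arrs // uu.
  apply/and3P; split=> //; last exact: path_sorted sL.
  have := perm_filter (fun v => v \notin m :: u) pL; rewrite filter_cat.
  rewrite (@eq_in_filter _ _ pred0 u) ?filter_pred0 => [|v vu]; last first.
    by rewrite inE vu orbT.
  rewrite (@eq_in_filter _ _ predT (letters L)) ?filter_predT // => v vL.
  rewrite inE negb_or uL // andbT; apply: contraNneq mS' => <-.
  by rewrite -(perm_mem pL) mem_cat vL orbT.
move=> ua; have := ua; rewrite mem_arrs // => /andP[uu uSu].
rewrite ew in pL.
have sm : all (ltn m) (letters L).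
  by apply/allP=> v; rewrite (perm_mem pL) mem_filter => /andP[_ /(allP mS)].
apply/and3P; split.
- rewrite /= iL andbT; apply/and3P; split=> //.
    by rewrite ew; apply/allP=> v /(allP uSu)/(allP mS).
  by move: rx; rewrite mem_iota add1n ltnS.
- by rewrite letters_cons ew /= perm_cons (arrs_perm uS).
rewrite /= (path_sortedE ltn_trans) sL andbT ew /=; apply/allP=> _ /mapP[z zL ->].
apply: (allP sm); rewrite letters_has; apply/hasP; exists z => //.
by case/and3P: (allP iL z zL); case: (word z) => // h t _ _ _; rewrite mem_head.
Qed.

Lemma sforest_nil L : sforest [::] L = (L == [::]).
Proof.
case: L => // x L; apply/negbTE/negP=> /and3P[/= /andP[ix _] pL _].
case/and3P: ix; case ew: (word x) => [//|m u] _ _ _.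
by move/perm_size: pL; rewrite letters_cons ew.
Qed.

Lemma mem_forests n S L : sorted ltn S -> size S <= n ->
  (L \in forests n S) = sforest S L.
Proof.
elim: n S L => [|n IHn] [|m S] L sS Sn; rewrite ?sforest_nil ?mem_seq1 //.
have sf x : sorted ltn [seq v <- S | v \notin word x].
  by apply: sorted_filter (path_sorted sS); exact: ltn_trans.
have szf x : size [seq v <- S | v \notin word x] <= n.
  by rewrite size_filter (leq_trans (count_size _ _)).
apply/allpairsPdep/idP => [[x [L1 [xi L1f ->]]]|].
  by rewrite sforest_cons // xi -IHn.
case: L => [|x L1]; first by case/and3P=> _ /perm_size.
by rewrite sforest_cons // => /andP[xi L1f]; exists x, L1; rewrite IHn.
Qed.

Lemma forests_uniq n S : sorted ltn S -> uniq (forests n S).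
Proof.
elim: n S => [|n IHn] [|m S] sS //.
have uS : uniq S := sorted_uniq ltn_trans ltnn (path_sorted sS).
apply: allpairs_uniq_dep => [|x _|].
- by apply: items_uniq => [|c]; [apply: arrs_uniq | apply: iota_uniq].
- by apply: IHn; apply: sorted_filter (path_sorted sS); exact: ltn_trans.
by move=> _ _ /allpairsPdep[? [? [_ _ ->]]] /allpairsPdep[? [? [_ _ ->]]] /= [-> ->].
Qed.

(** The only edge that can be missing is {1, a}. The new letters exceed 1, so it could matter only
    for the letter a, which is attached to the maximum of at least two distinct letters and hence
    not to 1. *)
Lemma wrec_K eps p s : 1 < size p -> uniq (p ++ s) ->
  all (fun x => 1 <= x <= a) (p ++ s) -> all (ltn 1) s -> wrec (Kgraph a eps) p s.
Proof.
elim: s p => //= x s IHs p p2 us ha /andP[x1 s1].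
have xp : x \notin p.
  by move: us; rewrite cat_uniq => /and3P[_ /hasPn h _]; apply: (h x); rewrite mem_head.
rewrite xp /= -cat_rcons in us ha *.
rewrite IHs ?size_rcons 1?ltnW // andbT.
have pp : par p x \in p by apply: par_mem; case: (p) p2.
have px : x != par p x by apply: contraNneq xp => {1}->.
have /andP[x0 xa] : 1 <= x <= a.
  by apply: (allP ha); rewrite mem_cat mem_rcons mem_head.
have /andP[y0 ya] : 1 <= par p x <= a.
  by apply: (allP ha); rewrite mem_cat mem_rcons inE pp orbT.
have py : x = a -> 1 < par p x.
  move=> e; have : exists2 y, y \in p & 1 < y.
    case: (p) p2 us ha => [|y [|z r]] //= _ /andP[/norP[yz _] _] /and3P[/andP[y1 _] /andP[z1 _] _].
    case: (ltngtP y 1) y1 => // [y1 _|y1 _].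
      by exists y; rewrite ?mem_head.
    exists z; first by rewrite !inE eqxx orbT.
    by rewrite ltn_neqAle z1 andbT -y1.
  case=> y yp y1; rewrite par_max; first exact: leq_trans y1 (seqmax_ge yp).
  apply/hasPn=> z zp; rewrite -leqNgt e.
  by have /andP[] : 1 <= z <= a by apply: (allP ha); rewrite mem_cat mem_rcons inE zp orbT.
rewrite /adj !edge_K x0 xa y0 ya /=.
clear -px py x1.
case: (ltngtP x (par p x)) px => // _ _ /=; rewrite ?orbF; apply/negP=> /and3P[_ /eqP e1 /eqP e2].
  by rewrite e1 in x1.
by have := py e2; rewrite e1.
Qed.

(** By [wrec_K] only the second letter can meet the missing edge, and it is always attached to the
    first letter. *)
Lemma wvalid_K eps w : uniq w -> all (fun x => 1 <= x <= a) w ->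
  wvalid (Kgraph a eps) w =
    if w is m :: u then all (ltn m) u && ~~ [&& eps, m == 1 & head 0 u == a] else false.
Proof.
case: w => // m u umu ha; rewrite [LHS]/=.
have -> : m \in vert (Kgraph a eps) by rewrite mem_ivl (allP ha) ?mem_head.
rewrite andTb; case mu: (all _ _) => //=.
case: u => [|v u] in umu ha mu *.
  have /andP[m1 ma] : 1 <= m <= a by apply: (allP ha); rewrite mem_head.
  by rewrite /= [0 == a]ltn_eqF ?andbF // (leq_trans m1).
rewrite /= in umu ha mu *; case/and3P: ha => /andP[m1 ma] /andP[v1 va] ua.
case/andP: mu => mv mu; rewrite wrec_K //= ?m1 ?ma ?v1 ?va //; last first.
  by apply: sub_all mu => y; apply: leq_ltn_trans.
rewrite !andbT inE eq_sym ltn_eqF //= /par /= ltnNge (ltnW mv) /= maxn0 /adj !edge_K.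
by rewrite mv m1 v1 va ma [v < m]ltnNge (ltnW mv) /=.
Qed.

(** The missing edge constrains only the tree containing 1, which comes first; the other trees are
    those of the complete graph. *)
Definition lforests (eps : bool) : seq (seq ltriple) :=
  [seq x :: L | x <- items (fun=> [:: 1]) 1
      [seq u <- arrs (iota 2 a.-1) | ~~ (eps && (head 0 u == a))],
    L <- forests a [seq v <- iota 2 a.-1 | v \notin word x]].

Lemma litemE eps x : uniq (word x) -> all (fun x => 1 <= x <= a) (word x) ->
  litem a eps b x = sitem x && ~~ [&& eps, head 0 (word x) == 1 & nth 0 (word x) 1 == a].
Proof.
move=> uw wa; rewrite /litem /sitem wvalid_K //; case: (word x) => [|m u]; first by [].
by rewrite /= nth0 andbAC.
Qed.

Lemma mem_lforests eps L : 0 < a -> (L \in lforests eps) = lforest a eps b L.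
Proof.
move=> a0; have ia : iota 1 a = 1 :: iota 2 a.-1 by case: (a) a0.
have sa : sorted ltn (1 :: iota 2 a.-1) by rewrite -ia iota_ltn_sorted.
have sf x : sorted ltn [seq v <- iota 2 a.-1 | v \notin word x].
  by apply: sorted_filter (path_sorted sa); exact: ltn_trans.
have szf x : size [seq v <- iota 2 a.-1 | v \notin word x] <= a.
  by rewrite size_filter (leq_trans (count_size _ _)) // size_iota leq_pred.
have split_forest x L1 : lforest a eps b (x :: L1) =
    [&& sforest (1 :: iota 2 a.-1) (x :: L1), lrval x == 1 &
        ~~ (eps && (nth 0 (word x) 1 == a))].
  rewrite /lforest /sforest -ia; case pL: (perm_eq _ _); rewrite ?andbF //=.
  case sL: (path _ _ _); rewrite ?andbF //= !andbT.
  have ok z : z \in x :: L1 -> uniq (word z) /\ all (fun v => 1 <= v <= a) (word z).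
    move=> zL; have zin v : v \in word z -> v \in letters (x :: L1).
      by move=> vz; rewrite letters_has; apply/hasP; exists z.
    split; last by apply/allP=> v /zin; rewrite (perm_mem pL) mem_iota add1n ltnS.
    have : uniq (letters (x :: L1)) by rewrite (perm_uniq pL) iota_uniq.
    case/splitPr: zL => l r; rewrite letters_cat letters_cons !cat_uniq.
    by case/and3P=> _ _ /and3P[].
  have [ux ax] := ok x (mem_head _ _).
  rewrite litemE //; case ix: (sitem x) => //=.
  have x1 : 1 <= head 0 (word x).
    by case/and3P: ix ax; case: (word x) => // v w _ _ _ /andP[/andP[]].
  have e1 : all (litem a eps b) L1 = all sitem L1.
    apply: eq_in_all => z zL; have [uz az] := ok z (mem_behead (s := x :: L1) zL).
    rewrite litemE //; case sz: (sitem z) => //=.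
    have lt : head 0 (word x) < head 0 (word z).
      have /allP := order_path_min ltn_trans sL; apply.
      exact: (map_f (fun x => head 0 (word x))).
    by rewrite [_ == 1]gtn_eqF ?andbF // (leq_ltn_trans x1).
  rewrite e1; case aL: (all _ _); rewrite ?andbF //= andbT andbC.
  suff -> : head 0 (word x) = 1 by rewrite eqxx.
  have : sforest (1 :: iota 2 a.-1) (x :: L1).
    by apply/and3P; rewrite /= ix aL sL -ia pL.
  by rewrite sforest_cons // => /andP[/mem_items[[u _ ->]]].
apply/allpairsPdep/idP => [[x [L1 [/mem_items[[u + ew] px rx] L1f ->]]]|].
  rewrite mem_filter => /andP[eu ua]; rewrite split_forest sforest_cons //.
  rewrite mem_forests // in L1f; rewrite L1f andbT ew /= nth0 eu andbT.
  move: rx; rewrite mem_seq1 => /eqP r1; rewrite r1 eqxx andbT.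
  apply/mem_items; split=> //; first by exists u.
  rewrite r1 mem_iota add1n ltnS /=; case/and3P: px => p1 /eqP sp lp.
  case: (lparts x) p1 lp => [_|c p /andP[] //] /=.
  by case: ifP => _; rewrite leqNgt ?b0.
case: L => [|x L1]; first by case/and4P=> _ _ _.
rewrite split_forest sforest_cons // => /and3P[/andP[/mem_items[[u ua ew] px rx] L1f] /eqP r1 eu].
exists x, L1; rewrite mem_forests //; split=> //.
apply/mem_items; split=> //; last by rewrite r1 mem_seq1.
by exists u => //; rewrite mem_filter ua andbT; move: eu; rewrite ew /= nth0.
Qed.

Lemma lforests_uniq eps : uniq (lforests eps).
Proof.
have ui : uniq (iota 2 a.-1) by exact: iota_uniq.
apply: allpairs_uniq_dep => [|x _|].
- by apply: items_uniq => //; rewrite filter_uniq // arrs_uniq.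
- by apply: forests_uniq; apply: sorted_filter (iota_ltn_sorted _ _); exact: ltn_trans.
by move=> _ _ /allpairsPdep[? [? [_ _ ->]]] /allpairsPdep[? [? [_ _ ->]]] /= [-> ->].
Qed.

End Enumeration.

(** * Signed sums over the forests on a clique *)

Section ForestSums.

Import GRing.Theory.
Local Open Scope ring_scope.

Variables (R : comNzRingType) (q : R) (e : nat -> R) (a b : nat).
Hypotheses (e0 : e 0 = 1) (b0 : (0 < b)%N).

Local Notation qn := (qn q).
Local Notation qfall := (qfall q).
Local Notation qfact := (qfact q).
Local Notation nsum := (nsum q e).
Local Notation csum := (csum e).
Local Notation DS f := (Dsum e f (csum f)).

(** Plain inversions are used in place of those of K_a^eps; the two numbers agree by
    [lforest_pinv]. *)
Definition gweight (L : seq ltriple) : R :=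
  (-1) ^+ nsgn L * q ^+ (pinv (letters L) + rsum L) * \prod_(c <- allparts L) e c.

Lemma gweight_nil : gweight [::] = 1.
Proof. by rewrite /gweight /nsgn /rsum !big_nil /= !mulr1. Qed.

Lemma gweight_cons m S u p r L : sorted ltn (m :: S) -> u \in arrs S ->
  perm_eq (letters L) [seq v <- S | v \notin m :: u] ->
  gweight ((m :: u, p, r) :: L) =
    q ^+ cost u S * ((-1) ^+ (size p).-1 * q ^+ r.-1 * \prod_(c <- p) e c) * gweight L.
Proof.
move=> smS ua pL; have uS := sorted_uniq ltn_trans ltnn smS.
have mS := order_path_min ltn_trans smS; have pS := arrs_perm uS ua pL.
rewrite /gweight nsgn_cons rsum_cons letters_cons allparts_cons.
rewrite /word /lparts /lrval /= (pinv_cat pS) big_cat /=.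
have -> : count (fun y => y < m)%N (u ++ letters L) = 0%N.
  rewrite (permP pS); apply/eqP; rewrite -leqn0 leqNgt -has_count.
  by apply/hasPn => x /(allP mS) /= mx; rewrite -leqNgt ltnW.
by rewrite add0n !exprD; ring.
Qed.

(** The sum over the remaining trees depends only on the letters u of the first tree, not on its
    composition or on r; so it can be taken out as [Psi u]. *)
Lemma sum_first rs m us (Fs : ltriple -> seq (seq ltriple)) (F : seq ltriple -> R)
    (W : seq nat -> seq nat -> nat -> R) (Psi : seq nat -> R) :
  (forall u p r, u \in us -> p \in comps (size u).+1 (if a \in m :: u then b else 1)%N ->
     r \in rs (head 0%N p) ->
     \sum_(L <- Fs (m :: u, p, r)) F ((m :: u, p, r) :: L) = W u p r * Psi u) ->
  \sum_(L <- [seq x :: L1 | x <- items a b rs m us, L1 <- Fs x]) F L =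
  \sum_(u <- us) (\sum_(p <- comps (size u).+1 (if a \in m :: u then b else 1)%N)
     \sum_(r <- rs (head 0%N p)) W u p r) * Psi u.
Proof.
move=> h; rewrite big_allpairs_dep /items big_allpairs_dep.
apply: eq_big_seq => u uu; rewrite big_allpairs_dep mulr_suml; apply: eq_big_seq => p pp.
by rewrite mulr_suml; apply: eq_big_seq => r rr; apply: h.
Qed.

Lemma sum_arrs (S : seq nat) (X : nat -> bool -> R) : sorted ltn S ->
  all (fun x => x <= a)%N S ->
  \sum_(u <- arrs S) q ^+ cost u S * X (size u) (a \in u) =
  \sum_(l < (size S).+1)
    if a \in S then X l false * qfall (size S).-1 l
                    + X l true * (qfall (size S) l - qfall (size S).-1 l)
    else X l false * qfall (size S) l.
Proof.
move=> sS Sa; have uS := sorted_uniq ltn_trans ltnn sS.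
rewrite big_allpairs_dep -[iota _ _]/(index_iota 0 (size S).+1) big_mkord.
apply: eq_bigr => l _.
transitivity (\sum_(u <- arr l S) q ^+ cost u S * X l (a \in u)).
  by apply: eq_big_seq => u; rewrite mem_arr // => /and3P[/eqP->].
case: ifP => aS; first exact: arr_sum_in.
rewrite -(arr_sum q l sS) mulr_sumr; apply: eq_big_seq => u.
rewrite mem_arr // => /and3P[_ _ uS']; rewrite mulrC; congr (X _ _ * _).
by apply/negP=> /(allP uS'); rewrite /= aS.
Qed.

(** The value of the sum over all forests on k letters ([sum_forests]). If a is not among them, it
    is [k]! e_k, the chromatic quasisymmetric function of the complete graph. *)
Definition Phi (k : nat) (aS : bool) : R :=
  if aS then qfact k.-1 * nsum b k else qfact k * e k.

Lemma rest_size (S u : seq nat) m : uniq (m :: S) -> u \in arrs S ->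
  size [seq v <- S | v \notin m :: u] = (size S - size u)%N.
Proof.
move=> uS ua; have := perm_size (arrs_perm uS ua (perm_refl _)).
by rewrite size_cat => <-; rewrite addKn.
Qed.

Lemma rest_mem (S u : seq nat) m v : m \notin S ->
  (v \in [seq v <- S | v \notin m :: u]) = (v \in S) && (v \notin u).
Proof. by move=> mS; rewrite filter_notin_cons // mem_filter andbC. Qed.

Lemma Dsum1 f l : DS f 1 l = csum f l.+1.
Proof. by rewrite -sum_comps. Qed.

Lemma qfall_out s l : (l < s)%N -> qfall s.-1 l * qfact (s - l).-1 = qfact s.-1.
Proof.
case: s => // s; rewrite ltnS => ls /=.
by rewrite subSn //= qfall_fact.
Qed.

Lemma qfall_in s l : (0 < s)%N -> (l <= s)%N ->
  (qfall s l - qfall s.-1 l) * qfact (s - l) = qfact s.-1 * (qn s - qn (s - l)).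
Proof.
case: s => // s _; rewrite leq_eqVlt [s.+1.-1]/= => /predU1P[->|ls].
  by rewrite subnn qn0 subr0 (qfall_gt q (ltnSn s)) subr0 mulr1 mulrC -qfactS.
rewrite mulrBl qfall_fact; last exact: ltnW.
rewrite subSn // !qfactS mulrCA.
rewrite -[qfact s](@qfall_fact _ q s l) //; ring.
Qed.

Lemma sum_arrs_head (S : seq nat) (X : nat -> bool -> R) : sorted ltn S ->
  all (fun x => x <= a)%N S -> a \in S -> (0 < a)%N ->
  \sum_(u <- arrs S | head 0%N u == a) q ^+ cost u S * X (size u) (a \in u) =
  \sum_(l < (size S).+1)
    (0 < l)%N%:R * X l true * q ^+ (size S).-1 * qfall (size S).-1 l.-1.
Proof.
move=> sS Sa aS a0; have uS := sorted_uniq ltn_trans ltnn sS.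
rewrite big_mkcond big_allpairs_dep -[iota _ _]/(index_iota 0 (size S).+1) big_mkord.
apply: eq_bigr => l _; rewrite -big_mkcond /= -(arr_sum_head q l (X l) sS aS Sa a0).
rewrite big_seq_cond [RHS]big_seq_cond; apply: eq_bigr => u /andP[].
by rewrite mem_arr // => /and3P[/eqP->].
Qed.

(* The coefficients [T] and [O] stand for the contributions of the first tree
   when it contains, respectively misses, the vertex a. *)
Lemma sum_arrs_split (eps : bool) (S : seq nat) (X : nat -> bool -> R)
    (T O V : nat -> R) : sorted ltn S -> all (fun x => x <= a)%N S -> a \in S ->
  (0 < a)%N -> (0 < size S)%N ->
  (forall l, (l <= size S)%N -> X l true = T l * (qfact (size S - l) * e (size S - l)%N)) ->
  (forall l, (l < size S)%N -> X l false = O l * (qfact (size S - l).-1 * V l)) ->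
  \sum_(u <- arrs S | ~~ (eps && (head 0%N u == a))) q ^+ cost u S * X (size u) (a \in u) =
  qfact (size S).-1 * (\sum_(l < (size S).+1)
    (qn (size S) - qn (size S - l) - (eps && (0 < l))%N%:R * q ^+ (size S).-1)
      * e (size S - l)%N * T l + \sum_(l < size S) O l * V l).
Proof.
move=> sS Sa aS a0 S0 XT XF.
transitivity (\sum_(u <- arrs S) q ^+ cost u S * X (size u) (a \in u)
   - eps%:R * \sum_(u <- arrs S | head 0%N u == a) q ^+ cost u S * X (size u) (a \in u)).
  case: eps => /=; last by rewrite mul0r subr0.
  by rewrite [in RHS](bigID (fun u => head 0%N u == a)) /= mul1r addrAC subrr add0r.
rewrite sum_arrs // aS sum_arrs_head // mulr_sumr.
rewrite big_split /= -addrA -sumrB addrC mulrDr !mulr_sumr; congr (_ + _).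
  apply: eq_bigr => l _; have ls : (l <= size S)%N by rewrite -ltnS.
  rewrite XT //; have h := qfall_in S0 ls.
  (* The factor (0 < l) guards the truncated l - 1: at l = 0 both sides are 0. *)
  have h' : (0 < l)%N%:R * (qfall (size S).-1 l.-1 * qfact (size S - l)) =
      (0 < l)%N%:R * qfact (size S).-1.
    case: posnP => [_|l0]; first by rewrite !mul0r.
    rewrite -(@qfall_fact _ q (size S).-1 l.-1); last by clear -l0 ls; lia.
    by rewrite (_ : (size S).-1 - l.-1 = size S - l)%N //; clear -l0 ls; lia.
  rewrite -mulnb natrM; move: h h'.
  move: (q ^+ _) (qfall _ l.-1) (qn (size S) - _) (qfall _ _ - _) => x1 x2 x3 x4.
  move: (qfact _) (qfact _) => x5 x6.
  move: (T l) (e _) (0 < l)%N%:R eps%:R => y1 y2 y3 y4 h h'.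
  transitivity (y1 * y2 * (x4 * x6 - y4 * x1 * (y3 * (x2 * x6)))); first by ring.
  by rewrite h h'; ring.
(* The term l = |S| drops out: a word using all the letters of S cannot miss a. *)
rewrite big_ord_recr /= qfall_gt ?ltn_predL // mulr0 addr0; apply: eq_bigr => l _.
rewrite XF // -(qfall_out (ltn_ord l)).
move: (O _) (V _) (qfact _) (qfall _ _) => x1 x2 x3 x4.
by ring.
Qed.

Lemma sum_iota_qn c : \sum_(r <- iota 1 c) q ^+ r.-1 = qn c.
Proof.
have -> : iota 1 c = index_iota 1 c.+1 by rewrite /index_iota subn1.
rewrite big_add1 /= big_mkord.
by [].
Qed.

(** Remove the first tree. Summing over r makes f(m) = [m], so [csumE] settles the case without a
    and [leftsum0] the case of an a beyond the first letter. There, with A = [|S|], the coefficient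
    collapses by (A - x) y + (y - A) x = A (y - x), and A completes the q-factorial. *)
Lemma sum_forests n S : sorted ltn S -> (size S <= n)%N ->
  all (fun x => x <= a)%N S ->
  \sum_(L <- forests a b n S) gweight L = Phi (size S) (a \in S).
Proof.
elim: n S => [|n IHn] [|m S] sS Sn Sa; rewrite /Phi /=.
- by rewrite big_seq1 gweight_nil e0 mulr1.
- by [].
- by rewrite big_seq1 gweight_nil e0 mulr1.
have uS := sorted_uniq ltn_trans ltnn sS; have /andP[mS uS'] := uS.
have /andP[ma Sa'] := Sa; have sS' := path_sorted sS.
pose bb u := (if a \in m :: u then b else 1)%N.
rewrite (@sum_first _ _ _ (fun x => forests a b n [seq v <- S | v \notin word x]) _
  (fun u p r => q ^+ cost u S * ((-1) ^+ (size p).-1 * q ^+ r.-1 * \prod_(c <- p) e c))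
  (fun u => Phi (size S - size u) ((a \in S) && (a \notin u)))); last first.
  move=> u p r ua pc rr; rewrite /word /= -(rest_size uS ua) -(rest_mem _ _ mS) -IHn.
  - rewrite mulr_sumr; apply: eq_big_seq => L LF; apply: gweight_cons => //.
    move: LF; rewrite mem_forests //; first by case/and3P.
      by apply: sorted_filter (path_sorted sS); exact: ltn_trans.
    by rewrite size_filter (leq_trans (count_size _ _)).
  - by apply: sorted_filter (path_sorted sS); exact: ltn_trans.
  - by rewrite size_filter (leq_trans (count_size _ _)).
  by apply/allP=> v; rewrite mem_filter => /andP[_ /(allP Sa')].
transitivity (\sum_(u <- arrs S) q ^+ cost u S *
    (DS qn (bb u) (size u) * Phi (size S - size u) ((a \in S) && (a \notin u)))).
  apply: eq_bigr => u _; rewrite mulrA; congr (_ * _).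
  rewrite -sum_comps mulr_sumr; apply: eq_bigr => p _.
  rewrite /cweight -sum_iota_qn mulr_sumr mulr_suml mulr_sumr.
  by apply: eq_bigr => r _; ring.
(* The letter m is the smallest and a the largest, so a = m leaves only a one-letter tree. *)
rewrite inE; case: (eqVneq a m) => [am|am] /=.
  have S0 : S = [::].
    case: (S) Sa' sS => //= x r /andP[xa _] /andP[mx _].
    by move: mx; rewrite -am ltnNge xa.
  rewrite S0 /arrs /= big_seq1 /bb am mem_head /Dsum big_ord0 /Phi /nsum big_ord1 /=.
  rewrite /qfact /= e0 qn0 add0n add1n subn1 /=.
  by ring.
case: ifP => aS; last first.
  transitivity (\sum_(u <- arrs S) q ^+ cost u S *
      (csum qn (size u).+1 * Phi (size S - size u) false)).
    apply: eq_big_seq => u; rewrite mem_arrs // => /andP[_ uSu].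
    rewrite /bb inE (negbTE am) /= (_ : a \in u = false) ?Dsum1 //.
    by apply/negP=> /(allP uSu); rewrite /= aS.
  rewrite (sum_arrs (fun l _ => csum qn l.+1 * Phi (size S - l) false)) // aS.
  rewrite (qfactS q (size S)) mulrAC (csumE e0); last exact: qn0.
  rewrite mulr_suml; apply: eq_bigr => l _.
  have ls : (l <= size S)%N by rewrite -ltnS.
  rewrite subSS /Phi -(qfall_fact q ls).
  move: (csum _ _) (qfall _ _) (qfact _) (e _) => x1 x2 x3 x4.
  by ring.
have S0 : (0 < size S)%N by case: (S) aS.
pose X l (t : bool) : R := if t then DS qn b l * Phi (size S - l) false
  else csum qn l.+1 * Phi (size S - l) true.
transitivity (\sum_(u <- arrs S) q ^+ cost u S * X (size u) (a \in u)).
  apply: eq_bigr => u _; rewrite /X /bb inE (negbTE am) /=.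
  by case: ifP; rewrite ?Dsum1.
have ma0 : (0 < a)%N by apply: leq_ltn_trans (allP (order_path_min ltn_trans sS) a aS).
have := @sum_arrs_split false S X (DS qn b) (fun l => csum qn l.+1)
  (fun l => nsum b (size S - l)) sS' Sa' aS ma0 S0 (fun _ _ => erefl) (fun _ _ => erefl).
rewrite big_mkcond /= => ->; under eq_bigr do rewrite mul0r subr0.
rewrite (leftsum0 q (qn0 q) (fun m => csumE e0 m (qn0 q))).
have -> : qfact (size S) = qfact (size S).-1 * qn (size S).
  by rewrite -{1}(prednK S0) qfactS prednK // mulrC.
rewrite -mulrA; congr (_ * _); rewrite /nsum mulr_sumr.
apply: eq_bigr => i _; rewrite addSn subSS.
move: (qn _) (qn (i : nat)) (qn _) (e _) => x1 x2 x3 x4.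
by ring.
Qed.

End ForestSums.

(* The single part of the composition of an atom is the size of the tree. *)
Definition gooditem (a : nat) (eps : bool) (x : ltriple) : bool :=
  (size (lparts x) == 1) &&
  ((a \in word x) ==>
     (if 1 \in word x then a <= head 0 (lparts x) else a - eps <= lrval x)).

(** For an atom the condition seg <= 2 says that at most two trees meet [a], see [segE]. *)
Definition goodforest (a : nat) (eps : bool) (L : seq ltriple) : bool :=
  (size L <= 2) && all (gooditem a eps) L.

(** * Signed sums over the left factors, all and allowed *)

Section LeftSums.

Import GRing.Theory.
Local Open Scope ring_scope.

Variables (R : comNzRingType) (q : R) (e t : nat -> R) (a b : nat) (eps : bool).
Hypotheses (e0 : e 0 = 1) (t0 : t 0 = 0) (b0 : (0 < b)%N) (a2 : (2 <= a)%N).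

Local Notation qn := (qn q).
Local Notation qfall := (qfall q).
Local Notation qfact := (qfact q).
Local Notation nsum := (nsum q e).
Local Notation csum := (csum e).
Local Notation DS f := (Dsum e f (csum f)).
Local Notation gweight := (gweight q e).
Local Notation s := (a.-1).
Local Notation S1 := (iota 2 a.-1).

Let sS : sorted ltn (1%N :: S1).
Proof. by rewrite -[1%N :: S1]/(iota 1 a.-1.+1) iota_ltn_sorted. Qed.
Let sS' : sorted ltn S1. Proof. exact: iota_ltn_sorted. Qed.
Let uS : uniq (1%N :: S1). Proof. exact: (sorted_uniq ltn_trans ltnn sS). Qed.
Let Sa : all (fun x => x <= a)%N S1.
Proof. by apply/allP=> x; rewrite mem_iota; lia. Qed.
Let aS : a \in S1. Proof. by rewrite mem_iota; lia. Qed.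
Let a0 : (0 < a)%N. Proof. exact: ltnW. Qed.
Let s0 : (0 < size S1)%N. Proof. by rewrite size_iota; lia. Qed.
Let a1 : (a == 1%N) = false. Proof. by rewrite gtn_eqF. Qed.

(** The first tree has r = 1 and so contributes t of its first part in place of a q-integer;
    [sum_forests] sums over the other trees, and [leftsum] with f = t gives the closed form. *)
Lemma left_sum :
  \sum_(L <- lforests a b eps) gweight L * t (lalpha L) =
  qfact s.-1 * \sum_(i < s.+1) e i * e (s + b - i)%N *
    ((qn s - qn i - (eps && (i < s)%N)%:R * q ^+ s.-1) * t (s + b - i)%N
     + (qn (s + b - i) - qn (s - eps)) * t i).
Proof.
rewrite -(leftsum q t0 (fun m => csumE e0 m t0)); last by rewrite -(size_iota 2 s).
pose bb u := (if a \in 1%N :: u then b else 1)%N.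
rewrite /lforests (@sum_first _ _ _ _ _ _ (fun x => forests a b a [seq v <- S1 | v \notin word x]) _
  (fun u p r => q ^+ cost u S1 * ((-1) ^+ (size p).-1 * \prod_(c <- p) e c) * t (head 0%N p))
  (fun u => Phi q e b (s - size u) (a \notin u))); last first.
  move=> u p r; rewrite mem_filter => /andP[_ ua] pc; rewrite mem_seq1 => /eqP->.
  have /andP[mS _] := uS; have rs := rest_size uS ua; rewrite size_iota in rs.
  have am : (a \in [seq v <- S1 | v \notin 1%N :: u]) = (a \notin u) by rewrite rest_mem // aS.
  rewrite /word /= -am -rs.
  have sr : sorted ltn [seq v <- S1 | v \notin 1%N :: u].
    by apply: sorted_filter sS'; exact: ltn_trans.
  have szr : (size [seq v <- S1 | v \notin 1%N :: u] <= a)%N.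
    by rewrite size_filter (leq_trans (count_size _ _)) // size_iota leq_pred.
  rewrite -(@sum_forests _ q e a b e0 b0 a) //; last first.
    by apply/allP=> v; rewrite mem_filter => /andP[_ /(allP Sa)].
  rewrite mulr_sumr; apply: eq_big_seq => L LF.
  rewrite (gweight_cons _ _ _ _ sS ua) /=; last first.
    by move: LF; rewrite mem_forests // => /and3P[].
  rewrite /lalpha /= /lparts /= expr0 mulr1; ring.
rewrite big_filter.
pose X l (h : bool) : R := if h then DS t b l * (qfact (size S1 - l) * e (size S1 - l)%N)
  else csum t l.+1 * (qfact (size S1 - l).-1 * nsum b (size S1 - l)).
transitivity (\sum_(u <- arrs S1 | ~~ (eps && (head 0%N u == a)))
   q ^+ cost u S1 * X (size u) (a \in u)).
  apply: eq_bigr => u _.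
  have -> : X (size u) (a \in u) = DS t (bb u) (size u) * Phi q e b (s - size u) (a \notin u).
    by rewrite /X /bb /Phi size_iota inE a1 /=; case: ifP; rewrite ?Dsum1.
  rewrite mulrA; congr (_ * _); rewrite -sum_comps mulr_sumr.
  apply: eq_bigr => p _; rewrite big_seq1 /cweight; ring.
rewrite (sum_arrs_split (e := e) eps (T := DS t b) (O := fun l => csum t l.+1)
  (V := fun l => nsum b (size S1 - l))) // size_iota.
by [].
Qed.

Lemma sum_comps1 k c (P : pred (seq nat)) (H : seq nat -> R) :
  \sum_(p <- comps k.+1 c) ((size p == 1%N) && P p)%:R * H p =
  (P [:: (k + c)%N])%:R * H [:: (k + c)%N].
Proof.
rewrite comps_rec big_cons /= big_seq big1 ?addr0 // => p /allpairsPdep[l [p' [lk pl ->]]].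
move: lk pl; rewrite mem_iota => /andP[l1 _]; rewrite mem_comps // => /and3P[_ /eqP sp _].
case: p' sp => [|x p' _]; first by rewrite /=; lia.
by rewrite size_rcons /= mul0r.
Qed.

(** The sum is empty as long as c <= a - 1 - eps, and at c = a - 1 - eps the difference on the right
    vanishes as well, so it may be included in the condition. *)
Lemma sum_iota_tail c :
  \sum_(r <- iota 1 c) (a - eps <= r)%:R * q ^+ r.-1 =
  (s - eps <= c)%:R * (qn c - qn (s - eps)).
Proof.
elim: c => [|c IHc].
  rewrite big_nil; case: leqP; rewrite ?mul0r // leqn0 => /eqP->.
  by rewrite subrr mulr0.
rewrite -[c.+1]addn1 iotaD big_cat /= big_seq1 {}IHc addn1 add1n qnS /=.
have -> : (a - eps <= c.+1)%N = (s - eps <= c)%N by lia.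
case: (leqP (s - eps) c) => sc; first by rewrite (leqW sc) !mul1r addrAC.
rewrite !mul0r addr0; case: (leqP (s - eps) c.+1) => sc'; rewrite ?mul0r //.
have -> : (s - eps = c.+1)%N by lia.
by rewrite qnS subrr mulr0.
Qed.

Definition tail (c : nat) : R := (s - eps <= c)%:R * (qn c - qn (s - eps)).

(** The analogue of [Phi] when at most one tree, with one part, is allowed. Without a nothing is
    lost: the sum over r completes [k-1]! to [k]!, so the value is that of [Phi]. *)
Definition Psi (k : nat) (aS : bool) : R :=
  if aS then qfact k.-1 * (e (k.-1 + b)%N * tail (k.-1 + b)) else qfact k * e k.

Lemma sum_single n S : sorted ltn S -> (size S <= n)%N -> all (fun x => x <= a)%N S ->
  1%N \notin S ->
  \sum_(L <- forests a b n S)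
    ((size L <= 1)%N && all (gooditem a eps) L)%:R * gweight L = Psi (size S) (a \in S).
Proof.
have fnil m : forests a b m [::] = [:: [::]] by case: m.
case: S => [|m S] smS Sn maS S1.
  by rewrite fnil big_seq1 /= gweight_nil /Psi /= e0 !mulr1.
case: n Sn => // n Sn; have uS' := sorted_uniq ltn_trans ltnn smS.
have /andP[mS uSS] := uS'; have sSS := path_sorted smS; have /andP[ma maS'] := maS.
pose bb u := (if a \in m :: u then b else 1)%N.
rewrite /= (@sum_first _ _ _ _ _ _ (fun x => forests a b n [seq v <- S | v \notin word x]) _
  (fun u p r => ((size p == 1%N) &&
       ((size u == size S) && ((a \in m :: u) ==> (a - eps <= r)%N)))%:R *
     (q ^+ cost u S * ((-1) ^+ (size p).-1 * q ^+ r.-1 * \prod_(c <- p) e c)))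
  (fun u => 1)); last first.
  move=> u p r ua pc rr; rewrite /word /= mulr1.
  have m1 : 1%N \in m :: u = false.
    apply/negP=> m1; move: S1; rewrite inE; case/norP => n1 S1.
    move: m1 ua; rewrite inE (negbTE n1) /= mem_arrs // => u1 /andP[_ /allP/(_ _ u1)].
    by rewrite /= (negbTE S1).
  have sr : sorted ltn [seq v <- S | v \notin m :: u].
    by apply: sorted_filter sSS; exact: ltn_trans.
  have szr : (size [seq v <- S | v \notin m :: u] <= n)%N.
    by rewrite size_filter (leq_trans (count_size _ _)).
  have szu := rest_size uS' ua; have ule : (size u <= size S)%N.
    by have := perm_size (arrs_perm uS' ua (perm_refl _)); rewrite size_cat => <-; apply: leq_addr.
  (* If the first tree does not use all the letters, a further tree must follow, so the indicator is
     0. *)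
  case: (eqVneq (size u) (size S)) => us; last first.
    rewrite andbF mul0r big_seq big1 // => L; rewrite mem_forests // => LF.
    suff -> : (size L < 1)%N = false by rewrite mul0r.
    apply/negbTE; rewrite -leqNgt lt0n; apply/negP=> /nilP L0; move: LF.
    rewrite L0 => /and3P[_ /perm_size + _]; rewrite szu => /esym/eqP.
    by rewrite subn_eq0 leqNgt ltn_neqAle us ule.
  have re : [seq v <- S | v \notin m :: u] = [::].
    by apply/nilP; rewrite /nilp szu us subnn.
  rewrite re fnil big_seq1 (gweight_cons _ _ _ _ smS ua) ?re //=.
  by rewrite /gooditem /= /word /lparts /lrval /= m1 gweight_nil mulr1 andbT.
pose E1 l : R := e (l + b)%N * tail (l + b); pose E0 l : R := e (l.+1)%N * qn l.+1.
pose X l (h : bool) : R := (l == size S)%:R * if (a == m) || h then E1 l else E0 l.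
transitivity (\sum_(u <- arrs S) q ^+ cost u S * X (size u) (a \in u)).
  apply: eq_bigr => u _; rewrite mulr1.
  transitivity (\sum_(p <- comps (size u).+1 (bb u)) ((size p == 1%N) && true)%:R *
    \sum_(r <- iota 1 (head 0%N p))
     ((size u == size S) && ((a \in m :: u) ==> (a - eps <= r)%N))%:R *
     (q ^+ cost u S * ((-1) ^+ (size p).-1 * q ^+ r.-1 * \prod_(c <- p) e c))).
    apply: eq_bigr => p _; rewrite mulr_sumr; apply: eq_bigr => r _.
    by rewrite andbT; case: (size p == 1%N); rewrite /= ?mul1r ?mul0r.
  rewrite (sum_comps1 _ _ xpredT) mul1r /= big_seq1 expr0 /X /bb inE.
  case: (eqVneq (size u) (size S)) => us /=; last first.
    by rewrite mul0r mulr0 big1 // => r _; rewrite mul0r.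
  rewrite mul1r; case: ifP => _ /=.
    rewrite /E1 /tail -sum_iota_tail !mulr_sumr; apply: eq_bigr => r _; ring.
  rewrite /E0 addn1 -(sum_iota_qn q) !mulr_sumr; apply: eq_bigr => r _; ring.
rewrite (sum_arrs q X sSS maS').
have X0 l h : (l < size S)%N -> X l h = 0 by move=> ls; rewrite /X ltn_eqF // mul0r.
rewrite big_ord_recr /= big1 ?add0r => [|l _]; last by rewrite !X0 // !mul0r addr0 if_same.
have XS h : X (size S) h = if (a == m) || h then E1 (size S) else E0 (size S).
  by rewrite /X eqxx mul1r.
rewrite !XS inE orbT; case: (boolP (a \in S)) => aS' /=.
  rewrite orbT qfall_gt; last by rewrite ltn_predL; case: (S) aS'.
  by rewrite mulr0 add0r subr0 /Psi /= mulrC.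
rewrite !orbF; case: ifP => _; rewrite /Psi /E1 /E0 /=; first by rewrite mulrC.
by rewrite qfactS -/(qfact _); move: (qfact _) (qn _) (e _) => x1 x2 x3; ring.
Qed.

(** The allowed L produce the two terms of [goodsum]. If the first tree contains a and l further
    letters from [2, a], put i = a - 1 - l: its part l + b is at least a exactly when i < b. If it
    misses a, put i equal to its size: the second tree has size a - 1 + b - i and its sum over r is
    [tail]. *)
Lemma good_sum :
  \sum_(L <- lforests a b eps) (goodforest a eps L)%:R * (gweight L * t (lalpha L)) =
  \sum_(L <- lforests a b eps) gweight L * t (lalpha L).
Proof.
rewrite left_sum goodsum //; last by rewrite -(size_iota 2 s).
pose bb u := (if a \in 1%N :: u then b else 1)%N.
rewrite /lforests (@sum_first _ _ _ _ _ _ (fun x => forests a b a [seq v <- S1 | v \notin word x]) _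
  (fun u p r => ((size p == 1%N) && ((a \in 1%N :: u) ==> (a <= head 0%N p)%N))%:R *
     (q ^+ cost u S1 * ((-1) ^+ (size p).-1 * \prod_(c <- p) e c) * t (head 0%N p)))
  (fun u => Psi (s - size u) (a \notin u))); last first.
  move=> u p r; rewrite mem_filter => /andP[_ ua] pc; rewrite mem_seq1 => /eqP->.
  have /andP[mS _] := uS; have rs := rest_size uS ua; rewrite size_iota in rs.
  have am : (a \in [seq v <- S1 | v \notin 1%N :: u]) = (a \notin u) by rewrite rest_mem // aS.
  rewrite /word /= -am -rs.
  have sr : sorted ltn [seq v <- S1 | v \notin 1%N :: u].
    by apply: sorted_filter sS'; exact: ltn_trans.
  have szr : (size [seq v <- S1 | v \notin 1%N :: u] <= a)%N.
    by rewrite size_filter (leq_trans (count_size _ _)) // size_iota leq_pred.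
  rewrite -(@sum_single a) //; last 2 first.
  - by apply/allP=> v; rewrite mem_filter => /andP[_ /(allP Sa)].
  - by rewrite mem_filter mem_head.
  rewrite mulr_sumr; apply: eq_big_seq => L LF.
  rewrite (gweight_cons _ _ _ _ sS ua) /=; last first.
    by move: LF; rewrite mem_forests // => /and3P[].
  rewrite /goodforest /= {1}/gooditem /word /lparts /= ltnS.
  rewrite andbCA -mulnb natrM /lalpha /= /lparts /= expr0 mulr1.
  move: (_%:R) (_%:R) (t _) (q ^+ _) (\prod_(c <- p) e c) (gweight _) => *; ring.
rewrite big_filter.
pose T l : R := (a <= l + b)%N%:R * (t (l + b)%N * e (l + b)%N).
pose O l : R := t l.+1 * e l.+1.
pose V l : R := e ((s - l).-1 + b)%N * tail ((s - l).-1 + b).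
pose X l (h : bool) : R := if h then T l * (qfact (size S1 - l) * e (size S1 - l)%N)
  else O l * (qfact (size S1 - l).-1 * V l).
transitivity (\sum_(u <- arrs S1 | ~~ (eps && (head 0%N u == a)))
   q ^+ cost u S1 * X (size u) (a \in u)).
  apply: eq_bigr => u _; under eq_bigr do rewrite big_seq1.
  rewrite (sum_comps1 _ _ (fun p => (a \in 1%N :: u) ==> (a <= head 0%N p)%N)).
  rewrite /X /T /O /V /Psi size_iota inE a1 /= big_seq1 expr0.
  case: (a \in u) => /=; first by move: (qfact _) => x; ring.
  by rewrite addn1; move: (qfact _) (tail _) => x1 x2; ring.
rewrite (sum_arrs_split (e := e) eps (T := T) (O := O) (V := V)) // size_iota.
congr (_ * _); rewrite (reindex_inj rev_ord_inj) /=.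
have -> : \sum_(l < s) O l * V l =
    \sum_(i < s.+1) e i * e (s + b - i)%N * ((s - eps <= s + b - i)%:R *
      (qn (s + b - i) - qn (s - eps)) * t i).
  rewrite big_ord_recl t0 !mulr0 add0r; apply: eq_bigr => i _; rewrite lift0 /V /tail /O.
  have -> : ((s - i).-1 + b = s + b - i.+1)%N by have := ltn_ord i; lia.
  by move: (_%:R) (qn _ - _) (e _) (e _) => *; ring.
rewrite -big_split /=; apply: eq_bigr => i _; have is1 : (i <= s)%N by rewrite -ltnS.
rewrite subSS subKn // subn_gt0 /T.
have -> : (s - i + b = s + b - i)%N by lia.
have -> : (a <= s + b - i)%N = (i < b)%N by lia.
by move: (_%:R) (_%:R) (_%:R) (qn _) (qn _) (qn _) (e _) (e _) (t _) (t _) => *; ring.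
Qed.

End LeftSums.

(** * The fixed points *)

Section Restriction.

Variables (n' : nat) (G' : graph) (a : nat) (eps : bool).
Hypotheses (n'0 : 1 <= n') (a2 : 2 <= a) (vG' : vert G' = ivl n') (wfG' : wf_graph G').

Let G := gsum (Kgraph a eps) G'.
Local Notation s := (a.-1).

Variables (y : ltriple) (F1 L : seq ltriple).
Hypotheses (sF : wsimple G' (y :: F1)) (fL : lforest a eps (lalpha (y :: F1)) L).

Local Notation W := (glue a L (y :: F1)).
Local Notation FW := [seq of_list x | x <- W].

Lemma glue_shape : exists L1 x L2 v,
  [/\ [/\ L = L1 ++ x :: L2, W = L1 ++ ext s x y :: L2 ++ map (up s) F1,
          a \notin letters L1 & a \in word x],
      [/\ word y = 1 :: v, all (ltn 1) v & all (ltn 1) (letters F1)],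
      (forall z, z \in L -> all (fun u => 1 <= u <= a) (word z) /\ 0 < size (word z)),
      [/\ pcond (size (word x)) (lalpha (y :: F1)) (lparts x), uniq (word x) &
          a \notin letters L2] &
      lrval y = 1].
Proof.
have [[v wy] ry] := wsimple_first n'0 vG' wfG' sF.
rewrite wy all_cat => /andP[v1 F11].
have [L1 [x [L2 [eL a1 ax a2']]]] := lforest_split n'0 a2 fL.
exists L1, x, L2, v; split=> //.
- by split=> //; rewrite eL glue_split.
- move=> z zL; split; first by apply/allP=> u; apply: lforest_le fL zL.
  by case: (word z) (litem_valid fL zL).
have xL : x \in L by rewrite eL mem_cat mem_head orbT.
have px : pcond (size (word x)) (lalpha (y :: F1)) (lparts x).
  by case/and4P: fL => /allP/(_ x xL)/and3P[_ + _] _ _ _; rewrite ax.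
by split=> //; apply: wvalid_uniq (litem_valid fL xL).
Qed.

Let sW : wsimple G W. Proof. exact: (glue_simple n'0 a2 vG' wfG' sF fL). Qed.

Let wfG : wf_graph G. Proof. exact: (gsum_wf n'0 a2 vG' wfG'). Qed.

Let tW : [seq to_list x | x <- FW] = W.
Proof. by have [] := of_list_simple wfG sW. Qed.

Variables (L1 L2 : seq ltriple) (x : ltriple) (v : seq nat).
Hypotheses (eL : L = L1 ++ x :: L2) (eW : W = L1 ++ ext s x y :: L2 ++ map (up s) F1)
  (a1 : a \notin letters L1) (ax : a \in word x) (wy : word y = 1 :: v)
  (v1 : all (ltn 1) v) (F11 : all (ltn 1) (letters F1))
  (Lz : forall z, z \in L -> all (fun u => 1 <= u <= a) (word z) /\ 0 < size (word z))
  (px : pcond (size (word x)) (lalpha (y :: F1)) (lparts x)) (ux : uniq (word x))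
  (ry : lrval y = 1).

Lemma tree_indexE : tree_index a FW = size L1.
Proof.
rewrite eW /tree_index find_map find_cat.
have -> : has (preim of_list (fun x => a \in vert (tree x))) L1 = false.
  apply: contraNF a1 => /hasP[z zL]; rewrite /= mem_vert_wtree => az.
  by rewrite letters_has; apply/hasP; exists z.
by rewrite /= mem_vert_wtree {1}/word /= mem_cat ax addn0.
Qed.

(** The trees of L come first in the glued forest and are exactly those that meet [a]; positions are
    counted from 0. *)
Lemma last_indexE : last_index a FW = (size L).-1.
Proof.
have ti := tree_indexE.
have szL : size L = (size L1 + size L2).+1 by rewrite eL size_cat /= addnS.
have szW : size FW = size L + size F1.
  by rewrite size_map eW szL size_cat /= size_cat size_map addnS addnA.
have meets t : t < size FW ->
    (vert (tree (nth ttriple0 FW t)) `&` ivl a != fset0) = (t < size L).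
  move=> tF; have tW' : t < size W by rewrite -(size_map of_list).
  rewrite (nth_map ([::], [::], 0)) //; set z := nth _ _ t.
  apply/fset0Pn/idP => [[u]|tL].
    rewrite in_fsetI mem_vert_wtree mem_ivl => /andP[uz /andP[u0 ua]].
    rewrite ltnNge; apply/negP=> Lt; move: uz.
    have -> : z = up s (nth ([::], [::], 0) F1 (t - size L)).
      rewrite /z eW -cat_cons catA nth_cat size_cat /= addnS -szL ltnNge Lt /=.
      by rewrite (nth_map ([::], [::], 0)) // ltn_subLR // -szW.
    have tF1 : t - size L < size F1 by rewrite ltn_subLR // -szW.
    case/mapP=> u' u'F eu; move: ua; rewrite eu (leq_up a2) leqNgt => /negP; apply.
    apply: (allP F11); rewrite letters_has; apply/hasP; eexists; last exact: u'F.
    exact: mem_nth.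
  have [z0 z0L sub] : exists2 z0, z0 \in L & {subset word z0 <= word z}.
    have Ez : z \in L1 ++ ext s x y :: L2.
      rewrite /z eW -cat_cons catA nth_cat size_cat /= addnS -szL tL mem_nth //.
      by rewrite size_cat /= addnS -szL.
    move: Ez; rewrite mem_cat inE => /or3P[zL|/eqP->|zL].
    - by exists z; rewrite // eL mem_cat zL.
    - by exists x; [rewrite eL mem_cat mem_head orbT | move=> u uinx; rewrite mem_cat uinx].
    by exists z; rewrite // eL mem_cat inE zL !orbT.
  have [z0a] := Lz z0L; case ez: (word z0) => [//|u r] _.
  have uz0 : u \in word z0 by rewrite ez mem_head.
  by exists u; rewrite in_fsetI mem_vert_wtree sub // mem_ivl (allP z0a).
rewrite /last_index ti; apply/eqP; rewrite eqn_leq; apply/andP; split.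
  apply/bigmax_leqP => t /andP[_]; rewrite meets // szL => tL.
  by rewrite -ltnS.
have lt : (size L).-1 < size FW by rewrite szW szL /= addSn ltnS leq_addr.
apply: (@leq_bigmax_cond _ _ (fun t : 'I_(size FW) => t : nat) (Ordinal lt)) => /=.
by rewrite meets // szL /= leq_addr /=.
Qed.

Lemma triple_atE : triple_at a FW = of_list (ext s x y).
Proof.
rewrite /triple_at tree_indexE.
rewrite (nth_map ([::], [::], 0)) ?eW ?size_cat /= ?addnS ?ltnS ?leq_addr //.
by rewrite nth_cat ltnn subnn.
Qed.

Lemma atom_of_list (V : seq ltriple) :
  atom [seq of_list x | x <- V] = all (fun x => size (lparts x) == 1) V.
Proof. by rewrite /atom all_map. Qed.

(** The merged composition has one part fewer than x and y together, so it has a single part exactly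
    when both of them do. *)
Lemma atom_glue : atom FW =
  all (fun x => size (lparts x) == 1) L && all (fun x => size (lparts x) == 1) (y :: F1).
Proof.
have [_ _ ey _] := wsimple_pcond n'0 vG' wfG' sF.
rewrite atom_of_list eW eL !all_cat /= all_cat all_map /=.
rewrite {1}/lparts /= size_cat -/(lparts x).
have p0 : 0 < size (lparts x).
  have [_ _ _ b1] := wsimple_pcond n'0 vG' wfG' sF.
  by case/and3P: px; case: (lparts x) => // _ _ /=; rewrite leqNgt b1.
have -> : (size (lparts x) + size (behead (lparts y)) == 1) =
    (size (lparts x) == 1) && (size (lparts y) == 1).
  rewrite ey /=; case: (size (lparts x)) p0 => // k _.
  by rewrite addSn !eqSS addn_eq0.
by rewrite -!andbA; do !bool_congr.
Qed.

Hypothesis atomF : atom FW.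

Lemma glue_atom_parts : exists2 c, lparts (ext s x y) = [:: c] &
  [/\ c = (size (word x)).-1 + lalpha (y :: F1), lparts x = [:: c] &
      lparts y = [:: lalpha (y :: F1)]].
Proof.
case/and3P: px => _ /eqP sp _; move: atomF; rewrite atom_glue eL all_cat /=.
case/andP=> /and3P[_ sx _] /andP[sy _].
have [_ _ ey _] := wsimple_pcond n'0 vG' wfG' sF.
rewrite /ext {1}/lparts /= -/(lparts x) -/(lparts y).
move: sy; rewrite ey; case: (behead (lparts y)) => // _.
move: sx sp; case: (lparts x) => [|c []] //= _; rewrite addn0 => ->.
by eexists.
Qed.

Lemma vert_cut : vert (tree (triple_at a FW)) `&` ivl a = [fset u in word x].
Proof.
apply/fsetP=> u; rewrite triple_atE in_fsetI mem_vert_wtree mem_ivl inE /=.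
rewrite {1}/word /= mem_cat wy /=; have xL : x \in L by rewrite eL mem_cat mem_head orbT.
have [xa _] := Lz xL.
case: (boolP (u \in word x)) => [/(allP xa)->//|_] /=.
apply/negP=> /andP[/mapP[w /(allP v1) /= w1 ->]].
by case/andP=> _; rewrite (leq_up a2) leqNgt w1.
Qed.

Lemma cut_sizeE : cut_size a (tree (triple_at a FW)) = size (word x).
Proof. by rewrite /cut_size vert_cut card_fseq undup_id. Qed.

Lemma seg_treeE : seg_tree a (triple_at a FW) = 1.
Proof.
have [c pc [ec _ _]] := glue_atom_parts.
rewrite /seg_tree cut_sizeE triple_atE; change (parts _) with (lparts (ext s x y)).
rewrite pc /= addn0.
have [_ _ _ b1] := wsimple_pcond n'0 vG' wfG' sF.
have x0 : 0 < size (word x) by case: (word x) ax.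
by rewrite x0 ec (_ : _ <= _) //; case: (size (word x)) x0 => // k _ /=; rewrite -addn1 leq_add2l.
Qed.

Lemma segE : seg a FW = size L.
Proof.
have szL : size L = (size L1 + size L2).+1 by rewrite eL size_cat /= addnS.
rewrite /seg seg_treeE last_indexE tree_indexE.
have szW : size FW = size L + size F1.
  by rewrite size_map eW szL size_cat /= size_cat size_map addnS addnA.
have aW := atomF; rewrite atom_of_list in aW.
transitivity (1 + \sum_(t < size FW | (t <= (size L).-1) && (t != size L1 :> nat)) 1).
  congr (_ + _); apply: eq_bigr => t _.
  rewrite (nth_map ([::], [::], 0)); last by rewrite -(size_map of_list).
  by apply/eqP; apply: (allP aW); apply: mem_nth; rewrite -(size_map of_list).
rewrite -(big_mkord (fun t => (t <= (size L).-1) && (t != size L1)) (fun=> 1)).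
have lt1 : size L1 < size L by rewrite szL ltnS leq_addr.
rewrite szW (big_cat_nat (leq0n _) (leq_addr (size F1) (size L))) /=.
have -> : \sum_(size L <= t < size L + size F1 | (t <= (size L).-1) && (t != size L1)) 1 = 0.
  rewrite big_nat_cond big_pred0 // => t; apply/negbTE/negP=> /andP[/andP[Lt _] /andP[tL _]].
  by move: (leq_trans Lt tL); rewrite szL ltnn.
rewrite addn0.
have -> : \sum_(0 <= t < size L | (t <= (size L).-1) && (t != size L1)) 1 =
    \sum_(0 <= t < size L | t != size L1) 1.
  rewrite big_nat_cond [RHS]big_nat_cond; apply: eq_bigl => t.
  by rewrite szL /= ltnS; case: (t <= _).
(* The leading 1, coming from the tree that contains a, is the term t = [size L1] missing from the
   sum; together they count all indices below [size L]. *)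
have := sum_nat_const_nat 0 (size L) 1.
rewrite (bigD1_seq (size L1)) ?iota_uniq ?mem_index_iota //= subn0 muln1.
by [].
Qed.

Lemma restr_listE : restr_list a FW = y :: F1.
Proof.
have szL : size L = (size L1 + size L2).+1 by rewrite eL size_cat /= addnS.
have [c pc [ec pcx pcy]] := glue_atom_parts.
pose M := L1 ++ ext s x y :: L2.
have eW' : W = M ++ map (up s) F1 by rewrite eW /M -catA.
have szM : size M = size L by rewrite szL /M size_cat /= addnS.
clearbody M.
rewrite /restr_list last_indexE prednK ?szL // -szL.
have -> : drop (size L) FW = [seq of_list z | z <- map (up s) F1].
  by rewrite eW' map_cat drop_size_cat // size_map szM.
have -> : [seq to_list z | z <- [seq of_list z | z <- map (up s) F1]] = map (up s) F1.
  have := tW; rewrite eW' !map_cat => /eqP; rewrite eqseq_cat ?size_map //.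
  by case/andP=> _ /eqP.
rewrite map_cons; congr (_ :: _).
  rewrite /restr_tree seg_treeE cut_sizeE triple_atE.
  change (parts _) with (lparts (ext s x y)); rewrite pc /=.
  have wW : wvalid G (word (ext s x y)).
    case/andP: sW => /and3P[/allP/(_ (ext s x y)) + _ _] _; rewrite eW mem_cat mem_head orbT.
    by case/(_ isT)/and3P.
  rewrite (list_of_wtree wW) /lshift_by /=.
  rewrite {1}/word /= drop_size_cat // wy /= -map_comp.
  have -> : map ((subn^~ s) \o addn s) v = v.
    by rewrite -[RHS]map_id; apply/eq_map => u /=; rewrite addKn.
  transitivity (word y, lparts y, lrval y); last by case: (y) => -[].
  rewrite wy pcy ry; congr (_ :: _, [:: _], _).
    by clear -a2; lia.
  (* With k = [size (word x)] the single part is c = k - 1 + [lalpha (y :: F1)], so c - k + 1 is the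
     first part of y again. *)
  rewrite addn0 ec; have x0 : 0 < size (word x) by case: (word x) ax.
  have [_ _ _ b1] := wsimple_pcond n'0 vG' wfG' sF.
  by clear -x0 b1; lia.
rewrite -map_comp -[RHS]map_id; apply/eq_map => -[[w p] r] /=.
rewrite /lshift_by /up /word /= -map_comp; congr (_, _, _).
by rewrite -[RHS]map_id; apply/eq_map => u /=; rewrite addKn.
Qed.

End Restriction.

(** The formulas for seg, the restriction and the tree size are proved for atoms, so [main] assumes
    one. In the converse direction atomicity comes from [goodforest] for L, and for F' from its
    being a fixed point of a nice involution. *)
Lemma goodness n' G' a eps phi' y F1 L : 1 <= n' -> 2 <= a -> vert G' = ivl n' ->
  wf_graph G' -> nice_involution G' phi' -> wsimple G' (y :: F1) ->
  lforest a eps (lalpha (y :: F1)) L ->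
  let F := [seq of_list x | x <- glue a L (y :: F1)] in
  [/\ atom F,
      exists F' : forest, is_restriction a G' F F' /\ phi' F' = F',
      seg a F <= 2,
      1 \notin vert (tree (triple_at a F)) -> a - eps <= rval (triple_at a F) &
      1 \in vert (tree (triple_at a F)) -> a <= nvert (tree (triple_at a F))] <->
  phi' [seq of_list x | x <- y :: F1] = [seq of_list x | x <- y :: F1] /\
  goodforest a eps L.
Proof.
move=> n'0 a2 vG' wfG' nice sF fL F.
have [L1 [x [L2 [v [[eL eW a1 ax] [wy v1 F11] Lz [px ux a2'] ry]]]]] :=
  glue_shape n'0 a2 vG' wfG' sF fL.
have [sF' tF'] := of_list_simple wfG' sF.
have tE := triple_atE eW a1 ax.
have aE : (atom F : bool) = _ := atom_glue n'0 vG' wfG' sF eL eW px.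
have in1 : 1 \in vert (tree (triple_at a F)) = (1 \in word x).
  rewrite tE mem_vert_wtree {1}/word /= mem_cat wy /=.
  have -> : 1 \in map (addn a.-1) v = false; last by rewrite orbF.
  apply/negbTE/negP=> /mapP[u /(allP v1) /= u1 e1].
  by have := leq_up a2 u; rewrite -e1 (ltnW a2) leqNgt u1.
have main : atom F -> seg a F = size L /\ (forall F', is_restriction a G' F F' <->
    F' = [seq of_list x | x <- y :: F1]) /\
    (goodforest a eps L <-> size L <= 2 /\ gooditem a eps x) /\
    nvert (tree (triple_at a F)) = head 0 (lparts x).
  move=> aF; split; first exact: (segE n'0 a2 vG' wfG' sF eL eW a1 ax wy v1 F11 Lz px ux aF).
  have rE := restr_listE n'0 a2 vG' wfG' sF fL eL eW a1 ax wy v1 F11 Lz px ux ry aF.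
  split; first move=> F'.
    rewrite /is_restriction rE; split=> [[sF0 eF']|->]; last by split.
    by have [_ <-] := to_list_simple sF0; rewrite eF'.
  split.
    have others z : z \in L1 ++ L2 -> gooditem a eps z.
      move=> zL; rewrite /gooditem; have -> : a \in word z = false.
        apply/negbTE/negP=> az; move: zL; rewrite mem_cat => /orP[] zL.
          by case/negP: a1; rewrite letters_has; apply/hasP; exists z.
        by case/negP: a2'; rewrite letters_has; apply/hasP; exists z.
      rewrite andbT; move: aF; rewrite aE eL => /andP[/allP aL _]; apply: aL.
      by move: zL; rewrite !mem_cat inE => /orP[] ->; rewrite ?orbT.
    rewrite /goodforest {2}eL all_cat /=; split=> [/andP[-> /and3P[_ ->]]//|[-> ->]].
    by rewrite /= -all_cat; apply/allP.
  have [c pc [ec pcx pcy]] := glue_atom_parts n'0 vG' wfG' sF eL eW px aF.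
  have wfG := gsum_wf (eps := eps) n'0 a2 vG' wfG'.
  have sW := glue_simple n'0 a2 vG' wfG' sF fL.
  have wW : wvalid (gsum (Kgraph a eps) G') (word (ext a.-1 x y)).
    case/andP: sW => /and3P[/allP/(_ (ext a.-1 x y)) + _ _] _; rewrite eW mem_cat mem_head orbT.
    by case/(_ isT)/and3P.
  rewrite tE /= (nvert_wtree (wvalid_uniq wW)) pcx /= ec.
  have [_ sy _ _] := wsimple_pcond n'0 vG' wfG' sF; rewrite pcy wy /= addn0 in sy.
  rewrite {1}/word /= size_cat size_map wy /= sy.
  by case: (word x) ax => //= u w _; rewrite addnS.
split.
  case=> aF [F' [rF pF']] sg h1 h2; have [sE [rE [gE nE]]] := main aF.
  have eF' := (rE F').1 rF; rewrite eF' in pF'; split=> //.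
  apply/gE; split; first by rewrite -sE.
  rewrite /gooditem; apply/andP; split.
    by move: aF; rewrite aE eL => /andP[/allP aL _]; apply: aL; rewrite mem_cat mem_head orbT.
  apply/implyP=> _; rewrite -nE -in1; case: ifPn => [/h2//|/h1].
  by rewrite tE.
case=> pF gF; have aF' : atom [seq of_list x | x <- y :: F1].
  by have [_ _ _ + _] := nice _ sF'; apply.
have aF : atom F.
  rewrite atom_of_list in aF'; rewrite aE aF' andbT; case/andP: gF => _; apply: sub_all => z.
  by case/andP.
have [sE [rE [gE nE]]] := main aF; have [sL gx] := gE.1 gF.
split=> //; first by exists [seq of_list x | x <- y :: F1]; split=> //; apply/rE.
- by rewrite sE.
- move/negbTE; rewrite in1 => n1; move: gx; rewrite /gooditem ax n1 /= => /andP[_].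
  by rewrite tE.
rewrite in1 nE => n1; move: gx; rewrite /gooditem ax n1 /=.
by case/andP.
Qed.

(** * Involutions and signed counts *)

Section SumInvolution.

Import GRing.Theory.

(** The sum over the elements that are not fixed equals its own opposite, so it vanishes in the
    absence of 2-torsion. *)
Lemma sum_involution (T : eqType) (V : zmodType) (s : seq T) (f : T -> T) (h : T -> V) :
  (forall v : V, v + v = 0 -> v = 0)%R -> uniq s ->
  (forall x, x \in s -> f x \in s) -> (forall x, x \in s -> f (f x) = x) ->
  (forall x, x \in s -> f x <> x -> h (f x) = - h x)%R ->
  (\sum_(x <- s) h x = \sum_(x <- s | f x == x) h x)%R.
Proof.
move=> tors us fs ff hf; rewrite (bigID (fun x => f x == x)) /=.
suff -> : (\sum_(x <- s | f x != x) h x = 0)%R by rewrite addr0.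
rewrite -big_filter; set s0 := [seq x <- s | f x != x].
have s0P x : (x \in s0) = (f x != x) && (x \in s) by rewrite mem_filter.
have ps : perm_eq (map f s0) s0.
  apply: uniq_perm; rewrite ?filter_uniq //.
    rewrite map_inj_in_uniq ?filter_uniq // => x y.
    by rewrite !s0P => /andP[_ xs] /andP[_ ys] e; rewrite -(ff x) // e ff.
  move=> y; apply/mapP/idP => [[x]|].
    by rewrite !s0P => /andP[fx xs] ->; rewrite fs // ff // eq_sym fx.
  rewrite s0P => /andP[fy ys]; exists (f y); last by rewrite ff.
  by rewrite s0P fs // ff // eq_sym fy.
have e : (\sum_(x <- s0) h x = \sum_(x <- s0) h (f x))%R.
  by rewrite -(perm_big _ ps) big_map.
apply: tors; rewrite {1}e -big_split /= big1_seq // => x.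
by rewrite s0P => /and3P[_ /eqP fx xs]; rewrite hf // addNr.
Qed.

End SumInvolution.

(** Within each key, the i-th negative element is exchanged with the i-th positive element that is
    not good; the hypothesis on counts makes the lists [A] and [B] equally long. *)
Lemma sign_reversing_matching (T K : eqType) (s : seq T) (key : T -> K)
    (neg good : pred T) : uniq s -> {in s, forall x, good x -> ~~ neg x} ->
  (forall k, count (fun x => [&& key x == k, ~~ neg x & ~~ good x]) s =
             count (fun x => (key x == k) && neg x) s) ->
  exists f : T -> T, forall x, x \in s ->
    [/\ f x \in s, f (f x) = x, key (f x) = key x, f x = x <-> good x &
        f x <> x -> neg (f x) = ~~ neg x].
Proof.
move=> us gn cnt.
pose A k := [seq x <- s | [&& key x == k, ~~ neg x & ~~ good x]].
pose B k := [seq x <- s | (key x == k) && neg x].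
have sAB k : size (A k) = size (B k) by rewrite !size_filter.
have uA k : uniq (A k) by rewrite filter_uniq.
have uB k : uniq (B k) by rewrite filter_uniq.
pose f x := if x \notin s then x else if good x then x
  else if neg x then nth x (A (key x)) (index x (B (key x)))
  else nth x (B (key x)) (index x (A (key x))).
have fN x : x \in s -> neg x -> [/\ f x \in A (key x), x \in B (key x) &
    f x = nth x (A (key x)) (index x (B (key x)))].
  move=> xs nx; have xB : x \in B (key x) by rewrite mem_filter eqxx nx.
  have -> : f x = nth x (A (key x)) (index x (B (key x))).
    by rewrite /f xs /= nx; case: ifP => // /(gn x xs); rewrite nx.
  by split=> //; apply: mem_nth; rewrite sAB index_mem.
have fP x : x \in s -> ~~ neg x -> ~~ good x -> [/\ f x \in B (key x), x \in A (key x) &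
    f x = nth x (B (key x)) (index x (A (key x)))].
  move=> xs nx gx; have xA : x \in A (key x) by rewrite mem_filter eqxx nx gx.
  have -> : f x = nth x (B (key x)) (index x (A (key x))).
    by rewrite /f xs /= (negbTE gx) (negbTE nx).
  by split=> //; apply: mem_nth; rewrite -sAB index_mem.
exists f => x xs; have [gx|gx] := boolP (good x).
  have fx : f x = x by rewrite /f xs gx.
  by rewrite !fx.
have [nx|nx] := boolP (neg x).
  have [fA xB fE] := fN x xs nx.
  have := fA; rewrite mem_filter => /andP[/and3P[/eqP kf nf gf] fs].
  have [ffB _ ffE] := fP (f x) fs nf gf.
  split=> //.
  - rewrite ffE kf {2}fE index_uniq ?sAB ?index_mem //.
    by rewrite (set_nth_default x) ?index_mem // nth_index.
  - by split=> // fx; move: nf; rewrite fx nx.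
  by rewrite (negbTE nf).
have [fB xA fE] := fP x xs nx gx.
have := fB; rewrite mem_filter => /andP[/andP[/eqP kf nf] fs].
have [ffA _ ffE] := fN (f x) fs nf.
split=> //.
- rewrite ffE kf {2}fE index_uniq -?sAB ?index_mem //.
  by rewrite (set_nth_default x) ?index_mem // nth_index.
by split=> // fx; move: nf; rewrite fx (negbTE nx).
Qed.

(** The leading 1 is the larger end of no inversion, and the missing edge {1, a} does not join
    letters above 1. *)
Lemma ginv_K a eps t : all (fun x => 1 < x <= a) t ->
  ginv (Kgraph a eps) (1 :: t) = pinv (1 :: t).
Proof.
move=> ta /=; congr (_ + _).
  by rewrite !(@eq_in_count _ _ pred0) // => y /(allP ta)/andP[y1 _] /=; rewrite ltnNge (ltnW y1).
elim: t ta => //= x t IHt /andP[/andP[x1 xa] ta]; rewrite IHt //; congr (_ + _).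
apply: eq_in_count => y /(allP ta)/andP[y1 ya] /=.
rewrite /adj !edge_K (gtn_eqF x1) (gtn_eqF y1) !andbF /= !andbT.
by case: (ltngtP y x) => //= yx; rewrite xa (ltnW y1).
Qed.

Lemma lforest_pinv a eps b L : 0 < b -> 0 < a -> lforest a eps b L ->
  ginv (Kgraph a eps) (letters L) = pinv (letters L).
Proof.
move=> b0 a0 fL; have := fL; rewrite -mem_lforests // => /allpairsPdep[x [L1 [xi _ eL]]].
have [[u _ ew] _ _] := mem_items a b0 _ _ _ _ xi.
case/and4P: fL => _ pL _ _; move: pL; rewrite eL letters_cons ew /= => pL.
apply: ginv_K; apply/allP=> v vL.
have : uniq (1 :: u ++ letters L1) by rewrite (perm_uniq pL) iota_uniq.
case/andP=> n1 _; have : v \in iota 1 a by rewrite -(perm_mem pL) inE vL orbT.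
rewrite mem_iota add1n ltnS => /andP[v0 ->]; rewrite andbT ltn_neqAle v0 andbT.
by apply: contraNneq n1 => ->.
Qed.

(** * Type, weight and first part as a monomial *)

Section KeyMonomials.

Import GRing.Theory.
Local Open Scope ring_scope.

Variable n : nat.

Local Notation N := (n + n).+1.

(* Variable 0 is q, variables 1, ..., n are the e_c, and n + 1, ..., 2n mark
   the first part of the first composition. *)
Definition var (i : nat) : 'I_N := inord i.

Definition qvar : {mpoly int[N]} := 'X_(var 0).
(** The values at 0, here and in [tvar], are those that the q-identities require: e(0) = 1 and f(0)
    = 0. *)
Definition evar (c : nat) : {mpoly int[N]} := if c is 0%N then 1 else 'X_(var c).
Definition tvar (c : nat) : {mpoly int[N]} := if c is 0%N then 0 else 'X_(var (n + c)).

Definition key_mon (w : nat) (p : seq nat) (c : nat) : 'X_{1..N} :=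
  (U_(var 0) *+ w + \big[mnm_add/0%MM]_(d <- p) U_(var d) + U_(var (n + c)))%MM.

Lemma key_monE w p c : all (leq 1) p -> (0 < c)%N ->
  'X_[key_mon w p c] = qvar ^+ w * \prod_(d <- p) evar d * tvar c.
Proof.
move=> p1 c0; rewrite /key_mon !mpolyXD -mpolyXn; congr (_ * _ * _); last by case: c c0.
elim: p p1 => [|d p IHp] /=; first by rewrite !big_nil mpolyX0.
case/andP=> d1 p1; rewrite !big_cons mpolyXD IHp //; congr (_ * _).
by case: d d1.
Qed.

Lemma var_eq i j : (i < N)%N -> (j < N)%N -> (var i == var j) = (i == j).
Proof. by move=> iN jN; rewrite -val_eqE /= !inordK. Qed.

Lemma key_mon_coef w p c (i : 'I_N) :
  key_mon w p c i = ((var 0 == i) * w + \sum_(d <- p) (var d == i) + (var (n + c) == i))%N.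
Proof.
rewrite /key_mon !mnmDE mulmnE !mnm1E; congr (_ + _ + _)%N.
by elim: p => [|d p IHp]; rewrite ?big_nil ?mnm0E // !big_cons mnmDE mnm1E IHp.
Qed.

(** The bounds by n keep q, the parts and the marker in disjoint ranges of variables, so each is
    read off from its own exponents. *)
Lemma key_mon_inj w w' p p' c c' :
  all (fun d => 0 < d <= n)%N p -> all (fun d => 0 < d <= n)%N p' ->
  (0 < c <= n)%N -> (0 < c' <= n)%N ->
  key_mon w p c = key_mon w' p' c' -> [/\ w = w', perm_eq p p' & c = c'].
Proof.
move=> pn pn' /andP[c0 cn] /andP[c0' cn'] e.
have coef i : key_mon w p c i = key_mon w' p' c' i by rewrite e.
have sumE (r : seq nat) j : all (fun d => 0 < d <= n)%N r -> (j < N)%N ->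
    (\sum_(d <- r) (var d == var j) = count_mem j r)%N.
  move=> rn jN; rewrite -sum1_count [RHS]big_mkcond /=; apply: eq_big_seq => d dr.
  rewrite var_eq //=.
  by have /andP[_ dn] := allP rn d dr; rewrite ltnS (leq_trans dn) // leq_addr.
have cE j : (j < N)%N -> (((0 == j) * w + count_mem j p + (n + c == j))%N =
    ((0 == j) * w' + count_mem j p' + (n + c' == j))%N).
  move=> jN; have := coef (var j); rewrite !key_mon_coef !sumE //.
  by rewrite !var_eq // ltnS leq_add2l.
have no (r : seq nat) j : all (fun d => 0 < d <= n)%N r -> ~~ (0 < j <= n)%N -> count_mem j r = 0%N.
  move=> rn jn; apply/eqP; rewrite -leqn0 leqNgt -has_count; apply/hasPn => d dr /=.
  by apply: contraNneq jn => <-; apply: (allP rn).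
split.
- have := cE 0%N isT; rewrite !no // eqxx !mul1n !addn0.
  by rewrite !addn_eq0 [c == 0%N]gtn_eqF // [c' == 0%N]gtn_eqF // !andbF !addn0.
- apply/allP=> j _ /=; apply/eqP.
  case: (boolP (0 < j <= n)%N) => [/andP[j0 jn]|jn]; last by rewrite !no.
  have jN : (j < N)%N by rewrite ltnS (leq_trans jn) // leq_addr.
  have := cE j jN; rewrite [0%N == j]ltn_eqF // !mul0n !add0n.
  by rewrite [(n + c)%N == j]gtn_eqF ?[(n + c')%N == j]gtn_eqF ?addn0 //; lia.
have big : ~~ (0 < n + c <= n)%N by lia.
have nN : (n + c < N)%N by rewrite ltnS leq_add2l.
have := cE (n + c)%N nN; rewrite !no // eqn_add2l eqxx.
have -> : (0 == n + c)%N = false by lia.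
by rewrite !mul0n !add0n eqn_add2l; case: eqP.
Qed.

Lemma mpoly_double (v : {mpoly int[N]}) : v + v = 0 -> v = 0.
Proof.
move=> vv; apply/mpolyP => m; rewrite mcoeff0.
have : (v + v)@_m = 0 by rewrite vv mcoeff0.
by rewrite mcoeffD; lia.
Qed.

End KeyMonomials.

(** * Listing the simple forests of a graph *)

Lemma sforest_of_wsimple n G W : vert G = ivl n -> wsimple G W ->
  sforest 0 1 (iota 1 n) W.
Proof.
move=> vG /andP[/and3P[aW pW sW] _]; rewrite vG perm_ivl in pW.
apply/and3P; split=> //; apply/allP=> x xW; case/and3P: (allP aW x xW) => vx cx rx.
have x0 : 0 \notin word x.
  apply/negP=> x0; have : 0 \in letters W by rewrite letters_has; apply/hasP; exists x.
  by rewrite (perm_mem pW) mem_iota.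
rewrite /sitem (negbTE x0) rx andbT; case: (word x) vx cx => // m u /and3P[_ mu _] cx.
by rewrite mu pcond1.
Qed.

(* As no word contains the letter 0, [forests 0 1] enumerates all word forests. *)
Definition wsimples (n : nat) (G : graph) : seq (seq ltriple) :=
  [seq W <- forests 0 1 n (iota 1 n) | wsimple G W].

Lemma mem_wsimples n G W : vert G = ivl n -> (W \in wsimples n G) = wsimple G W.
Proof.
move=> vG; rewrite mem_filter; apply/andP/idP => [[]//|sW]; split=> //.
by rewrite mem_forests ?size_iota ?iota_ltn_sorted // (sforest_of_wsimple vG).
Qed.

Lemma wsimples_uniq n G : uniq (wsimples n G).
Proof. by rewrite filter_uniq // forests_uniq ?iota_ltn_sorted. Qed.

Lemma wsimple_bounds n G W : 1 <= n -> vert G = ivl n -> wf_graph G -> wsimple G W ->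
  all (fun d => 0 < d <= n) (allparts W) /\ 0 < lalpha W <= n.
Proof.
move=> n0 vG wfG sW; have [y [F eW]] : exists y F, W = y :: F.
  case/andP: sW => /and3P[_ pW _] _; rewrite vG perm_ivl in pW.
  by case: W pW => [/perm_size|y F _]; [rewrite size_iota; case: n n0 {vG} | exists y, F].
have bnd : all (fun d => 0 < d <= n) (allparts W).
  case/andP: sW => /and3P[aW pW _] _; rewrite vG perm_ivl in pW.
  apply/allP=> d /flattenP[_ /mapP[x xW ->] dx].
  case/and3P: (allP aW x xW) => vx /andP[p1 /eqP sp] _; rewrite (allP p1 d dx) /=.
  apply: leq_trans (_ : size (word x) <= _).
    rewrite -sp; case/splitPr: dx => l r; rewrite sumn_cat /= addnCA.
    exact: leq_addr.
  have := perm_size pW; rewrite size_iota => <-.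
  case/splitPr: xW => l r; rewrite letters_cat letters_cons !size_cat addnCA.
  exact: leq_addr.
split=> //; apply: (allP bnd); rewrite eW in sW *.
have [_ _ ey _] := wsimple_pcond n0 vG wfG sW.
by rewrite allparts_cons ey mem_head.
Qed.

Lemma odd_signs m n : ((-1) ^+ m = - (-1) ^+ n :> int)%R -> odd m = ~~ odd n.
Proof. by rewrite -GRing.signr_odd -[((-1) ^+ n)%R]GRing.signr_odd; case: odd; case: odd. Qed.

Lemma ftypeE F : ftype F = sort geq (allparts [seq to_list x | x <- F]).
Proof. by rewrite /ftype /allparts -map_comp. Qed.

Lemma ftype_perm F F' : ftype F = ftype F' <->
  perm_eq (allparts [seq to_list x | x <- F]) (allparts [seq to_list x | x <- F']).
Proof.
have tot : total geq by move=> x y; apply: leq_total.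
have tr : transitive geq by move=> y x z /= yx zy; apply: leq_trans yx.
have an : antisymmetric geq by move=> x y; rewrite andbC; apply: anti_leq.
by rewrite !ftypeE; split=> /(perm_sortP tot tr an).
Qed.

Lemma alpha11E F : alpha11 F = lalpha [seq to_list x | x <- F].
Proof. by rewrite /alpha11 /lalpha -map_comp. Qed.

Lemma fsignE F : fsign F = ((-1) ^+ nsgn [seq to_list x | x <- F])%R.
Proof. by rewrite /fsign /nsgn big_map. Qed.

Lemma atom_nsgn W : all (fun x => size (lparts x) == 1) W -> nsgn W = 0.
Proof. by move=> /allP h; rewrite /nsgn big1_seq // => x /andP[_ /h/eqP->]. Qed.

(** * The signed count of glued forests *)

Section Main.

Import GRing.Theory.

Variables (n' : nat) (G' : graph) (phi' : forest -> forest) (a : nat) (eps : bool).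
Hypotheses (n'0 : 1 <= n') (a2 : 2 <= a) (vG' : vert G' = ivl n') (wfG' : wf_graph G')
  (nice : nice_involution G' phi').

Let G := gsum (Kgraph a eps) G'.
Local Notation n := (a.-1 + n').
Local Notation q := (qvar n).
Local Notation e := (@evar n).
Local Notation t := (@tvar n).

Let vG : vert G = ivl n. Proof. exact: (vert_gsumE eps a2 vG'). Qed.
Let wfG : wf_graph G. Proof. exact: (gsum_wf n'0 a2 vG' wfG'). Qed.
Let n0 : 1 <= n. Proof. by rewrite addn_gt0 n'0 orbT. Qed.

Definition psi (F : seq ltriple) : seq ltriple :=
  [seq to_list x | x <- phi' [seq of_list x | x <- F]].

Lemma psi_nice F : wsimple G' F ->
  [/\ wsimple G' (psi F), psi (psi F) = F,
      [/\ perm_eq (allparts (psi F)) (allparts F),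
        ginv G' (letters (psi F)) + rsum (psi F) = ginv G' (letters F) + rsum F &
        lalpha (psi F) = lalpha F],
      psi F = F <-> phi' [seq of_list x | x <- F] = [seq of_list x | x <- F] &
      psi F <> F -> odd (nsgn (psi F)) = ~~ odd (nsgn F)].
Proof.
move=> sF; have [sF' tF] := of_list_simple wfG' sF.
have [sP PP [ty we al] at1 sg] := nice sF'.
have [sP' oP] := to_list_simple sP.
have fixE : psi F = F <-> phi' [seq of_list x | x <- F] = [seq of_list x | x <- F].
  by split=> [e'|e']; [rewrite -oP -/(psi F) e' | rewrite /psi e' tF].
split=> //.
- by rewrite {1}/psi -/(psi F) /psi oP PP tF.
- split; last by rewrite -[in RHS]tF -!alpha11E.
    by have := (ftype_perm _ _).1 ty; rewrite tF.
  by move: we; rewrite !weightE tF.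
move=> nF; apply: odd_signs; have := sg (fun e' => nF (fixE.2 e')).
by rewrite !fsignE tF.
Qed.

Definition glued : seq (seq ltriple) :=
  [seq glue a L F | F <- wsimples n' G', L <- lforests a (lalpha F) eps].

(** By [goodness] these are the fixed points that the theorem prescribes. *)
Definition good (W : seq ltriple) : bool :=
  (psi (cut a W).2 == (cut a W).2) && goodforest a eps (cut a W).1.

Lemma glued_ind F : F \in wsimples n' G' ->
  exists y F1, [/\ F = y :: F1, wsimple G' (y :: F1) & 0 < lalpha F].
Proof.
rewrite mem_wsimples // => sF; have [y [F1 eF]] : exists y F1, F = y :: F1.
  case/andP: (sF) => /and3P[_ pF _] _; rewrite vG' perm_ivl in pF.
  case: F pF {sF} => [/perm_size|y F _]; last by exists y, F.
  by rewrite size_iota; case: n' n'0.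
exists y, F1; rewrite eF in sF *; split=> //.
by have [_ _ _] := wsimple_pcond n'0 vG' wfG' sF.
Qed.

Lemma mem_glued W : (W \in glued) = wsimple G W.
Proof.
have a0 : 0 < a by exact: ltnW.
apply/allpairsPdep/idP => [[F [L [Fi Li ->]]]|sW].
  have [y [F1 [eF sF b0]]] := glued_ind Fi; rewrite eF in Li b0 *.
  rewrite mem_lforests // in Li.
  exact: (glue_simple n'0 a2 vG' wfG' sF Li).
have [y [F [L [sF fL ->]]]] := glue_surj n'0 a2 vG' wfG' sW.
have [_ _ _ b0] := wsimple_pcond n'0 vG' wfG' sF.
by exists (y :: F), L; rewrite mem_wsimples // mem_lforests.
Qed.

Lemma cut_glued F L : F \in wsimples n' G' -> L \in lforests a (lalpha F) eps ->
  cut a (glue a L F) = (L, F).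
Proof.
have a0 : 0 < a by exact: ltnW.
move=> Fi; have [y [F1 [eF sF b0]]] := glued_ind Fi; rewrite eF in b0 *.
by rewrite mem_lforests // => fL; apply: (cut_glue n'0 a2 vG' wfG' sF fL).
Qed.

Lemma glued_uniq : uniq glued.
Proof.
apply: allpairs_uniq_dep; first exact: wsimples_uniq.
  by move=> F /glued_ind[y [F1 [_ _ b0]]]; apply: lforests_uniq.
move=> _ _ /allpairsPdep[F [L [Fi Li ->]]] /allpairsPdep[F' [L' [Fi' Li' ->]]] /= eg.
by have := cut_glued Fi Li; rewrite eg cut_glued // => -[-> ->].
Qed.

Definition wkey (W : seq ltriple) : 'X_{1..(n + n).+1} :=
  key_mon n (ginv G (letters W) + rsum W) (allparts W) (lalpha W).

Local Open Scope ring_scope.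

(** The first part of F is left out, since after gluing it belongs to the part contributed by L. *)
Definition rweight (F : seq ltriple) : {mpoly int[(n + n).+1]} :=
  (-1) ^+ nsgn F * q ^+ (ginv G' (letters F) + rsum F) *
    \prod_(c <- behead (allparts F)) e c.

Lemma glue_weight F L : F \in wsimples n' G' -> L \in lforests a (lalpha F) eps ->
  (-1) ^+ nsgn (glue a L F) * 'X_[wkey (glue a L F)] =
    rweight F * (gweight q e L * t (lalpha L)).
Proof.
move=> Fi Li; have a0 : (0 < a)%N by exact: ltnW.
have [y [F1 [eF sF b0]]] := glued_ind Fi.
have sW : wsimple G (glue a L F).
  by rewrite -mem_glued; apply/allpairsPdep; exists F, L.
have [pn /andP[c0 _]] := wsimple_bounds n0 vG wfG sW.
have p1 : all (leq 1) (allparts (glue a L F)).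
  by apply: sub_all pn => d /andP[].
have fL : lforest a eps (lalpha F) L by rewrite -mem_lforests.
rewrite key_monE //; rewrite eF in fL *.
have [-> -> pp -> gi] := glue_stats n'0 a2 vG' wfG' sF fL.
rewrite -/G in gi; rewrite gi (lforest_pinv _ _ fL) //; last by rewrite -eF.
rewrite (perm_big _ pp) big_cat /gweight /rweight !exprD /=.
move: (\prod_(c <- _) e c) (\prod_(c <- _) e c) (t _) => x1 x2 x3.
by ring.
Qed.

(** The inner sum depends on F only through its first part, which [psi] preserves along with type
    and weight; so [psi] merely changes the sign of the summand of a forest that it moves. *)
Lemma psi_gf : \sum_(F <- wsimples n' G')
    rweight F * \sum_(L <- lforests a (lalpha F) eps) gweight q e L * t (lalpha L) =
  \sum_(F <- wsimples n' G' | psi F == F)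
    rweight F * \sum_(L <- lforests a (lalpha F) eps) gweight q e L * t (lalpha L).
Proof.
apply: sum_involution.
- exact: mpoly_double.
- exact: wsimples_uniq.
- by move=> F; rewrite !mem_wsimples // => /psi_nice[].
- by move=> F; rewrite !mem_wsimples // => /psi_nice[].
move=> F Fi pF; have sF := Fi; rewrite mem_wsimples // in sF.
have [sP _ [pp we la] _ /(_ pF) sg] := psi_nice sF; rewrite la.
rewrite -mulNr; congr (_ * _); rewrite /rweight we.
have pb : perm_eq (behead (allparts (psi F))) (behead (allparts F)).
  have hd F0 : F0 \in wsimples n' G' -> allparts F0 = lalpha F0 :: behead (allparts F0).
    move=> /glued_ind[y [F1 [-> sF0 _]]]; have [_ _ ey _] := wsimple_pcond n'0 vG' wfG' sF0.
    by rewrite allparts_cons {1 2}ey.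
  rewrite -(perm_cons (lalpha F)) -{1}la -!hd //.
  by rewrite mem_wsimples.
rewrite (perm_big _ pb) -!mulNr; congr (_ * _ * _).
by rewrite -signr_odd sg -[in RHS]signr_odd; case: odd; rewrite /= ?expr0 ?expr1 ?opprK.
Qed.

Lemma good_nsgn W : W \in glued -> good W -> nsgn W = 0%N.
Proof.
move=> /allpairsPdep[F [L [Fi Li ->]]]; rewrite /good cut_glued // => /andP[/eqP pF gL].
have a0 : (0 < a)%N by exact: ltnW.
have [y [F1 [eF sF b0]]] := glued_ind Fi.
have sF' : wsimple G' F by rewrite eF.
have fL : lforest a eps (lalpha F) L by rewrite -mem_lforests.
rewrite eF in fL; have [h _ _ _ _] := glue_stats n'0 a2 vG' wfG' sF fL.
rewrite -eF in h; rewrite {}h.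
rewrite !atom_nsgn //; last by case/andP: gL => _; apply: sub_all => x /andP[].
have [sFF _] := of_list_simple wfG' sF'; have [_ _ _ at1 _] := nice sFF.
rewrite -atom_of_list; apply: at1.
by have [_ _ _ /iffLR/(_ pF)] := psi_nice sF'.
Qed.

(** Once F is fixed by [psi], [good_sum] with b = [lalpha F] replaces all L by the allowed ones. No
    sign is left on the right because good forests are atoms. *)
Lemma glued_gf : \sum_(W <- glued) (-1) ^+ nsgn W * 'X_[wkey W] =
  \sum_(W <- glued | good W) 'X_[wkey W] :> {mpoly int[(n + n).+1]}.
Proof.
have a0 : (0 < a)%N by exact: ltnW.
rewrite [RHS]big_mkcond !big_allpairs_dep /=.
transitivity (\sum_(F <- wsimples n' G')
    rweight F * \sum_(L <- lforests a (lalpha F) eps) gweight q e L * t (lalpha L)).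
  apply: eq_big_seq => F Fi; rewrite mulr_sumr; apply: eq_big_seq => L Li.
  exact: glue_weight.
rewrite psi_gf big_mkcond; apply: eq_big_seq => F Fi /=.
have [y [F1 [eF sF b0]]] := glued_ind Fi.
case: (eqVneq (psi F) F) => pF; last first.
  rewrite big_seq big1 // => L Li; rewrite /good cut_glued //=.
  by rewrite (negbTE pF).
rewrite -good_sum // mulr_sumr; apply: eq_big_seq => L Li.
have GE : good (glue a L F) = goodforest a eps L by rewrite /good cut_glued // pF eqxx.
rewrite GE; case: ifP => gL; last by rewrite mul0r mulr0.
rewrite mul1r -glue_weight // good_nsgn ?mul1r // ?GE //.
by apply/allpairsPdep; exists F, L.
Qed.

Lemma count_int (T : Type) (s : seq T) (P : pred T) :
  \sum_(x <- s) (P x)%:R = (count P s)%:R :> int.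
Proof. by elim: s => [|x s IHs]; rewrite ?big_nil // big_cons IHs /= natrD. Qed.

(** This compares the coefficients of the monomial k in [glued_gf]: positive minus negative forests
    equals good ones, and the good ones are positive. *)
Lemma glued_count k :
  count (fun W => [&& wkey W == k, ~~ odd (nsgn W) & ~~ good W]) glued =
  count (fun W => (wkey W == k) && odd (nsgn W)) glued.
Proof.
have := congr1 (mcoeff k) glued_gf; rewrite [in RHS]big_mkcond !raddf_sum /= => /eqP.
rewrite -subr_eq0 -sumrB => /eqP h.
suff : (count (fun W => [&& wkey W == k, ~~ odd (nsgn W) & ~~ good W]) glued)%:R -
    (count (fun W => (wkey W == k) && odd (nsgn W)) glued)%:R = 0 :> int by lia.
rewrite -!count_int -sumrB -[RHS]h; apply: eq_big_seq => W Wi.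
rewrite -signr_odd; have := good_nsgn Wi; case: (good W) => [->|_] //=.
  by rewrite /= ?expr0 mul1r ?andbF !subrr.
rewrite mcoeff0 subr0 andbT.
case: odd => /=; rewrite ?andbT ?andbF ?expr0 ?expr1 ?mulN1r ?mul1r ?mcoeffN mcoeffX.
  by rewrite sub0r.
by rewrite subr0.
Qed.

End Main.

Theorem theorem4p10 (n' : nat) (G' : graph) (phi' : forest -> forest)
    (a : nat) (eps : bool) :
  1 <= n' ->
  natural_unit_interval n' G' ->
  nice_involution G' phi' ->
  2 <= a ->
  let G := gsum (Kgraph a eps) G' in
  exists phi : forest -> forest,
    nice_involution G phi /\
    forall F : forest, simple_forest_triple G F ->
      (phi F = F <->
       [/\ atom F,
           exists F' : forest, is_restriction a G' F F' /\ phi' F' = F',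
           seg a F <= 2,
           1 \notin vert (tree (triple_at a F)) ->
             a - eps <= rval (triple_at a F) &
           1 \in vert (tree (triple_at a F)) ->
             a <= nvert (tree (triple_at a F))]).
Proof.
move=> n'0 [vG' wfG' _] nice a2 G.
have a0 : 0 < a by exact: ltnW.
have n0 : 1 <= a.-1 + n' by rewrite addn_gt0 n'0 orbT.
have vG : vert G = ivl (a.-1 + n') := vert_gsumE eps a2 vG'.
have wfG : wf_graph G := gsum_wf n'0 a2 vG' wfG'.
(* Negative means that [nsgn] is odd; a good forest is positive since its [nsgn] is 0. *)
have [f fP] := sign_reversing_matching
  (glued_uniq eps n'0 a2 vG' wfG')
  (fun W Wi gW => introT negPf (congr1 odd (good_nsgn n'0 a2 vG' wfG' nice Wi gW)))
  (glued_count eps n'0 a2 vG' wfG' nice).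
have memS F : simple_forest_triple G F -> [seq to_list x | x <- F] \in glued n' G' a eps.
  by move=> /to_list_simple[sW _]; rewrite mem_glued.
pose phi (F : forest) : forest := [seq of_list x | x <- f [seq to_list x | x <- F]].
have phiP F : simple_forest_triple G F ->
    [/\ simple_forest_triple G (phi F),
        [seq to_list x | x <- phi F] = f [seq to_list x | x <- F] &
        phi F = F <-> f [seq to_list x | x <- F] = [seq to_list x | x <- F]].
  move=> sF; have [Wf _ _ _ _] := fP _ (memS F sF); rewrite mem_glued // in Wf.
  have [sP tP] := of_list_simple wfG Wf; split=> //.
  split=> [e|e]; first by rewrite -tP -/(phi F) e.
  by rewrite /phi e; have [] := to_list_simple sF.
have goodP F : simple_forest_triple G F -> good phi' a eps [seq to_list x | x <- F] <->
       [/\ atom F,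
           exists F' : forest, is_restriction a G' F F' /\ phi' F' = F',
           seg a F <= 2,
           1 \notin vert (tree (triple_at a F)) ->
             a - eps <= rval (triple_at a F) &
           1 \in vert (tree (triple_at a F)) ->
             a <= nvert (tree (triple_at a F))].
  move=> sF; have [sW oW] := to_list_simple sF.
  have [y [F1 [L [sF1 fL eW]]]] := glue_surj n'0 a2 vG' wfG' sW.
  have := goodness n'0 a2 vG' wfG' nice sF1 fL; rewrite -eW oW => ->.
  rewrite /good eW (cut_glue n'0 a2 vG' wfG' sF1 fL) /=.
  have [_ _ _ fixE _] := psi_nice wfG' nice sF1; rewrite -fixE.
  by split=> [/andP[/eqP-> ->]|[-> ->]]; rewrite ?eqxx.
exists phi; split=> [F sF|F sF]; last first.
  have [_ _ ->] := phiP F sF; have [_ _ _ -> _] := fP _ (memS F sF).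
  exact: goodP.
have Wi := memS F sF; have [sP tP fixE] := phiP F sF.
have [fW ff kf fix2 sg] := fP _ Wi.
have [sW oW] := to_list_simple sF.
have sfW : wsimple G (f [seq to_list x | x <- F]) by rewrite -(mem_glued eps n'0 a2 vG' wfG').
have [b1 c1] := wsimple_bounds n0 vG wfG sW; have [b2 c2] := wsimple_bounds n0 vG wfG sfW.
(* The matching preserves keys, and the bounds on the parts let a key determine weight, type and
   first part. *)
have [ew ep ec] := key_mon_inj b2 b1 c2 c1 kf.
split=> //.
- by rewrite {1}/phi tP ff.
- split; last by rewrite !alpha11E tP.
    by apply/ftype_perm; rewrite tP.
  by rewrite !weightE tP.
- by move=> /fixE/fix2/(goodP F sF)[].
move=> nF; have /sg od : f [seq to_list x | x <- F] <> [seq to_list x | x <- F].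
  by move/fixE.
by rewrite !fsignE tP -GRing.signr_odd od -[in RHS]GRing.signr_odd; case: odd.
Qed.
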